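(* Let $\lambda\in\Lambda_n$. Then: (a) for every $w\in\mathfrak R(\lambda)$ there is a sign $\eta_w\in\{1,-1\}$ such that $\eta_w C_w\in Z_w+\hat{\mathcal N}^\lambda\subseteq\mathcal N^\lambda$; (b) $\mathcal N^\lambda$ equals the $A$-span of all $C_w$ such that $w\in\mathfrak R(\mu)$ for some $\mu\in\Lambda_n$ with $\lambda\trianglelefteq\mu$.
   Context: Hecke algebra and Kazhdan–Lusztig basis. Let $W=\mathfrak S_n$ act on $\{1,\dots,n\}$ on the left, with Coxeter generators $S=\{s_1,\dots,s_{n-1}\}$, $s_i=(i,i+1)$. Let $l$ be the length function and $\varepsilon_w=(-1)^{l(w)}$. Let $A=\mathbb Z[v,v^{-1}]$ with ring involution $a\mapsto\bar a$, $\bar v=v^{-1}$. The Iwahori–Hecke algebra $\mathcal H$ is free over $A$ with basis $\{T_w\}$ and multiplication $T_sT_w=T_{sw}$ if $l(sw)=l(w)+1$, $T_sT_w=T_{sw}+(v-v^{-1})T_w$ if $l(sw)=l(w)-1$. Let $h\mapsto\bar h$ be the ring involution of $\mathcal H$ with $\overline{\sum a_wT_w}=\sum\bar a_wT_{w^{-1}}^{-1}$. For $w\in W$, $C_w$ is the unique element with $\overline{C_w}=C_w$ and $C_w-T_w\in\sum_y v\mathbb Z[v]T_y$; $\{C_w\}$ is an $A$-basis of $\mathcal H$. Partitions. $\Lambda_n$ is the set of partitions of $n$, with dominance order: $\lambda\trianglelefteq\mu$ iff $\lambda_1+\dots+\lambda_i\le\mu_1+\dots+\mu_i$ for all $i$;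 $\lambda\triangleleft\mu$ means $\lambda\trianglelefteq\mu$, $\lambda\ne\mu$. For $\lambda$ with parts $\lambda_1\ge\lambda_2\ge\cdots$, $\mathfrak S_\lambda$ is the Young subgroup generated by the $s_k$ with $k\notin\{\lambda_1+\dots+\lambda_i: i\ge1\}$, $w_\lambda$ its longest element, $X_\lambda$ the set of elements of minimal length in their left coset $x\mathfrak S_\lambda$, and $P_\lambda=\sum_{u\in\mathfrak S_\lambda}v^{2l(u)}$. Characters and leading coefficients. $K=\mathbb R(v)$, $\mathcal H_K=K\otimes_A\mathcal H$ (split semisimple). Its irreducible characters are labelled $\chi_\lambda$ ($\lambda\in\Lambda_n$) so that for every $\lambda$ the character induced from the sign representation $T_u\mapsto\varepsilon_uv^{-l(u)}$ ($u\in\mathfrak S_\lambda$) of the parabolic subalgebra spanned by $\{T_u:u\in\mathfrak S_\lambda\}$ is $\chi_\lambda$ plus a sum of $\chi_\mu$ with $\lambda\triangleleft\mu$. Let $d_\lambda=\chi_\lambda(T_1)$ and $a(\lambda)=l(w_\lambda)$. Let $\mathcal O\subset K$ be the localization of $\mathbb R[v]$ at the ideal $(v)$, $\mathfrak p=v\mathcal O$; the constant term of $f\in\mathcal O$ is its value at $v=0$. For each $\lambda$ a matrix representation $\mathfrak X_\lambda:\mathcal H_K\to M_{d_\lambda}(K)$ affording $\chi_\lambda$ is fixed which is orthogonal (there is an invertible diagonal matrix $P$ with diagonal entries in $1+v\mathbb R[v]$ and $\mathfrak X_\lambda(T_{w^{-1}})=P^{-1}\mathfrak X_\lambda(T_w)^{tr}P$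 for all $w$); then $v^{a(\lambda)}\mathfrak X_\lambda^{ij}(T_w)$ and $v^{a(\lambda)}\mathfrak X^{ij}_\lambda(C_w)$ lie in $\mathcal O$ and have the same constant term, written $\varepsilon_wc^{ij}_{w,\lambda}$ (leading matrix coefficients), and the $\mathfrak X_\lambda$ are chosen so that all $c^{ij}_{w,\lambda}\in\mathbb Z$. Then for every $\lambda$ and $1\le i,j\le d_\lambda$ there is a unique $w=:\mathbf w_\lambda(i,j)$ with $c^{ij}_{w,\lambda}\ne0$, and $(\lambda,i,j)\mapsto\mathbf w_\lambda(i,j)$ is a bijection onto $\mathfrak S_n$. Set $\mathfrak R(\lambda)=\{\mathbf w_\lambda(i,j):1\le i,j\le d_\lambda\}$. The $\mathfrak X_\lambda$ are normalized so that $\mathbf w_\lambda(1,1)=w_\lambda$; then $\mathbf w_\lambda(i,1)=x_iw_\lambda$ for uniquely determined $x_i\in X_\lambda$, with $x_1=1$. $Z_w$. For $w=\mathbf w_\lambda(i,j)\in\mathfrak R(\lambda)$, set $Z_w=P_\lambda^{-1}\,\varepsilon_{w_\lambda}v^{l(w_\lambda)}C_{x_iw_\lambda}C_{w_\lambda x_j^{-1}}\in\mathcal H_K$. Murphy-type basis. For $\lambda\in\Lambda_n$, a $\lambda$-tableau is a bijection $\mathfrak t$ from $[\lambda]=\{(i,j):1\le j\le\lambda_i\}$ to $\{1,\dots,n\}$; it is row-standard if entries increase along rows, standard if they increase along rows and columns; $\mathbb T(\lambda)$ is the set of standard $\lambda$-tableaux; $\mathfrak t^\lambda$ is the tableau with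 $1,\dots,n$ entered row by row from the top; $(w.\mathfrak t)(i,j)=w(\mathfrak t(i,j))$; for row-standard $\mathfrak t$, $d(\mathfrak t)$ is the unique element of $X_\lambda$ with $\mathfrak t=d(\mathfrak t).\mathfrak t^\lambda$. For $\mathfrak s,\mathfrak t\in\mathbb T(\lambda)$ put $\tilde y_{\mathfrak s\mathfrak t}=T_{d(\mathfrak s)}C_{w_\lambda}T_{d(\mathfrak t)^{-1}}$. $\mathcal N^\lambda$ is the $A$-span of all $\tilde y_{\mathfrak s\mathfrak t}$ with $\mathfrak s,\mathfrak t\in\mathbb T(\mu)$, $\lambda\trianglelefteq\mu$; $\hat{\mathcal N}^\lambda$ is the same with $\lambda\triangleleft\mu$. (These $\tilde y_{\mathfrak s\mathfrak t}$ form an $A$-basis of $\mathcal H$ and $\mathcal N^\lambda,\hat{\mathcal N}^\lambda$ are two-sided ideals.) *)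

(* Defs.v *)
From HB Require Import structures.
From mathcomp Require Import all_boot all_order all_algebra all_fingroup fraction.
From mathcomp Require Import Rstruct.
From Stdlib Require Rdefinitions.
Set Implicit Arguments. Unset Strict Implicit. Unset Printing Implicit Defensive.
Import Order.TTheory GRing.Theory Num.Theory.
Local Open Scope ring_scope.

Notation Real := Rdefinitions.R.
Notation K := {fraction {poly Real}}.
Definition vK : K := tofrac 'X.

Definition evZ (p : {poly int}) (x : K) : K :=
  (map_poly (fun z : int => z%:~R) p).[x].

Definition inA (a : K) : Prop :=
  exists (p : {poly int}) (k : nat), a = evZ p vK / vK ^+ k.

Definition barRel (a b : K) : Prop :=
  exists (p : {poly int}) (k : nat),
    a = evZ p vK / vK ^+ k /\ b = evZ p (vK^-1) * vK ^+ k.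

Definition in_vZv (a : K) : Prop :=
  exists p : {poly int}, p`_0 = 0 /\ a = evZ p vK.

Definition constTerm (f : K) (c : Real) : Prop :=
  exists p q : {poly Real},
    q.[0] != 0 /\ f = tofrac p / tofrac q /\ c = p.[0] / q.[0].

Notation hecke n := {ffun 'S_n -> K}.

Definition hscale (n : nat) (a : K) (h : hecke n) : hecke n := [ffun y => a * h y].

Definition Aspan (n : nat) (I : finType) (P : I -> Prop) (f : I -> hecke n)
  (h : hecke n) : Prop :=
  exists a : I -> K, (forall i, inA (a i)) /\ (forall i, ~ P i -> a i = 0) /\
    h = \sum_i hscale (a i) (f i).

Section Hecke.
Variable n : nat.
Local Notation W := 'S_n.

(* W acts on the left: wmul x y is the composite x o y, i.e. (wmul x y) k = x (y k).
   (mathcomp's (y * x)%g is "first y, then x".)  Points 1..n are 'I_n = 0..n-1. *)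
Definition wmul (x y : W) : W := (y * x)%g.

Definition gens : {set W} :=
  [set s : W | [exists i : 'I_n, exists j : 'I_n,
                  (val j == (val i).+1) && (s == tperm i j)]].

Definition word_prod (s : seq W) : W := foldr wmul 1%g s.

Definition len_le (w : W) (k : nat) : bool :=
  [exists t : k.-tuple W, all (mem gens) t && (word_prod t == w)].

(* Coxeter length: the least k (k <= n*n suffices) such that w is a product of k
   generators *)
Definition len (w : W) : nat := find (len_le w) (iota 0 (n * n).+1).

Definition eps (w : W) : K := (-1) ^+ len w.

(* The Hecke algebra H_K: elements are coefficient vectors w.r.t. (T_w) *)

Definition Tb (w : W) : hecke n := [ffun y => ((y == w) : nat)%:R].

(* left multiplication by T_s, s a generator:
   T_s T_w = T_{sw} if l(sw) > l(w), T_{sw} + (v - v^-1) T_w otherwise *)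
Definition Tsmul (s : W) (h : hecke n) : hecke n :=
  [ffun y => h (wmul s y) +
             (if (len (wmul s y) < len y)%N then (vK - vK^-1) * h y else 0)].

(* left multiplication by T_x, via T_x = T_s T_{sx} when l(sx) < l(x) *)
Fixpoint Tact_rec (k : nat) (x : W) (h : hecke n) : hecke n :=
  match k with
  | 0 => h
  | k'.+1 =>
      match [pick s in gens | (len (wmul s x) < len x)%N] with
      | Some s => Tsmul s (Tact_rec k' (wmul s x) h)
      | None => h
      end
  end.

Definition Tact (x : W) (h : hecke n) : hecke n := Tact_rec (len x) x h.

Definition hmul (h1 h2 : hecke n) : hecke n := \sum_(x : W) hscale (h1 x) (Tact x h2).

Definition hone : hecke n := Tb 1%g.

(* C : W -> hecke is the Kazhdan--Lusztig basis:
   C_w - T_w in sum_y vZ[v] T_y, and bar(C_w) = C_w where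
   bar(sum a_y T_y) = sum bar(a_y) T_{y^-1}^-1 *)
Definition isKL (C : W -> hecke n) : Prop :=
  forall w : W,
    (forall y, in_vZv (C w y - ((y == w) : nat)%:R)) /\
    (forall g : W -> hecke n,
       (forall y, hmul (Tb y) (g y) = hone /\ hmul (g y) (Tb y) = hone) ->
       exists b : W -> K, (forall y, barRel (C w y) (b y)) /\
                          C w = \sum_y hscale (b y) (g (y^-1)%g)).

(* Partitions of n, as weakly decreasing n-tuples padded with zeros *)
Definition is_part (t : n.-tuple 'I_n.+1) : bool :=
  (\sum_(i < n) (tnth t i : nat) == n)%N &&
  [forall i : 'I_n, forall j : 'I_n, (i <= j)%N ==> (tnth t j <= tnth t i)%N].

Definition part := {t : n.-tuple 'I_n.+1 | is_part t}.

(* lam l k = lambda_{k+1} (0 beyond the last part) *)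
Definition lam (l : part) (k : nat) : nat := nth 0%N [seq val x | x <- val l] k.

Definition partsum (l : part) (i : nat) : nat := (\sum_(0 <= k < i) lam l k)%N.

Definition domle (l m : part) : bool :=
  [forall i : 'I_n.+1, (partsum l i <= partsum m i)%N].
Definition sdomlt (l m : part) : bool := domle l m && (l != m).

Definition young (l : part) : {group W} :=
  <<[set s : W | [exists i : 'I_n, exists j : 'I_n,
        [&& val j == (val i).+1, s == tperm i j &
            (val i).+1 \notin [seq partsum l k | k <- iota 1 n]]]]>>%G.

Definition wlong (l : part) : W := [arg max_(u > 1%g in young l) len u].

Definition inX (l : part) (x : W) : bool :=
  [forall u in young l, (len x <= len (wmul x u))%N].

Definition Plam (l : part) : K := \sum_(u in young l) vK ^+ (2 * len u).

(* The lambda-tableau w.t^lambda (t^lambda(i,j) = lambda_1+..+lambda_i + j, 0-based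
   row i and column j) is standard.  Every tableau is w.t^lambda for a unique w,
   and for standard tableaux d(w.t^lambda) = w. *)
Definition std (l : part) (w : W) : bool :=
  [forall a : 'I_n, forall b : 'I_n, forall i : 'I_n, forall j : 'I_n,
     ([&& (j.+1 < lam l i)%N, val a == (partsum l i + j)%N &
          val b == (partsum l i + j.+1)%N] ==> (w a < w b)%N) &&
     ([&& (j < lam l i.+1)%N, val a == (partsum l i + j)%N &
          val b == (partsum l i.+1 + j)%N] ==> (w a < w b)%N)].

(* y~_{st} = T_{d(s)} C_{w_lambda} T_{d(t)^-1} *)
Definition ytilde (C : W -> hecke n) (l : part) (x y : W) : hecke n :=
  hmul (hmul (Tb x) (C (wlong l))) (Tb (y^-1)%g).

Definition inN (C : W -> hecke n) (l : part) (h : hecke n) : Prop :=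
  Aspan (fun p : part * W * W => let '(m, x, y) := p in domle l m /\ std m x /\ std m y)
        (fun p => let '(m, x, y) := p in ytilde C m x y) h.
Definition inNhat (C : W -> hecke n) (l : part) (h : hecke n) : Prop :=
  Aspan (fun p : part * W * W => let '(m, x, y) := p in sdomlt l m /\ std m x /\ std m y)
        (fun p => let '(m, x, y) := p in ytilde C m x y) h.

Section Rep.
Variable d : nat.
Variable r : W -> 'M[K]_d.   (* r w = X(T_w) *)

Definition Xof (h : hecke n) : 'M[K]_d := \sum_w h w *: r w.

Definition is_rep : Prop :=
  r 1%g = 1%:M /\ forall x y, Xof (hmul (Tb x) (Tb y)) = r x *m r y.

Definition is_irr : Prop :=
  (0 < d)%N /\
  forall U : 'M[K]_d, (forall w, stablemx U (r w)) -> (U == (0 : 'M[K]_d))%MS || row_full U.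

Definition orthogonal_rep : Prop :=
  exists P : 'M[K]_d,
    is_diag_mx P /\ P \in unitmx /\
    (forall i, exists p : {poly Real}, p.[0] = 1 /\ P i i = tofrac p) /\
    forall w, r (w^-1)%g = invmx P *m (r w)^T *m P.

(* c = c^{ij}_{w,lambda}: v^{a(lambda)} X^{ij}(T_w) lies in O and has constant
   term eps_w c *)
Definition ltc (l : part) (w : W) (i j : 'I_d) (c : Real) : Prop :=
  constTerm (vK ^+ len (wlong l) * r w i j) ((-1) ^+ len w * c).

Definition integral_ltc (l : part) : Prop :=
  forall w i j, exists z : int, ltc l w i j z%:~R.

Definition isW (l : part) (i j : 'I_d) (w : W) : Prop :=
  exists c : Real, ltc l w i j c /\ c != 0.

Definition normalized (l : part) : Prop :=
  forall i0 : 'I_d, val i0 = 0%N -> isW l i0 i0 (wlong l).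

End Rep.

(* character of the module induced from the sign representation
   T_u |-> eps_u v^{-l(u)} of H(S_lambda), computed in the basis T_x (x) 1,
   x in X_lambda (using T_{xu} = T_x T_u for x in X_lambda, u in S_lambda) *)
Definition indchar (l : part) (h : hecke n) : K :=
  \sum_(x | inX l x) \sum_(u in young l)
     hmul h (Tb x) (wmul x u) * eps u * vK ^- len u.

Definition labelling (d : part -> nat) (rho : forall l : part, W -> 'M[K]_(d l)) : Prop :=
  forall l : part, exists m : part -> nat,
    (forall mu, m mu <> 0%N -> sdomlt l mu) /\
    forall w, indchar l (Tb w) = \tr (rho l w) + \sum_mu (m mu)%:R * \tr (rho mu w).

Definition inRcell (d : part -> nat) (rho : forall l : part, W -> 'M[K]_(d l))
  (l : part) (w : W) : Prop :=
  exists i j : 'I_(d l), isW (rho l) l i j w.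

(* Z_w for w = w_lambda(i,j), given x_i, x_j *)
Definition Zw (C : W -> hecke n) (l : part) (xi xj : W) : hecke n :=
  hscale ((Plam l)^-1 * eps (wlong l) * vK ^+ len (wlong l))
    (hmul (C (wmul xi (wlong l))) (C (wmul (wlong l) (xj^-1)%g))).

End Hecke.

(* Main.v *)
(* Since v^a(l) X_l(C_w) has constant term +-c_w and, by the Schur relations, every leading
   coefficient c^{ij}_l is nonzero at exactly one w, an A-combination of the C_y over a set of
   cells is determined by the v-adic expansion of its images in the corresponding
   representations.  The element Z_w is integral, bar-invariant and killed by X_m unless l is
   dominated by m; hence it is +-C_w plus an A-combination of elements C_y in strictly larger
   cells, and, by induction on dominance, X_m(C_w) = 0 unless l is dominated by m.  The same
   v-adic argument shows that an integral element killed by X_m for all m outside an upset of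
   partitions lies in the A-span of the C_w of the cells of that upset.  This applies to the
   Murphy-type elements, because the Gale-Ryser condition forces X_m(C_{w_l}) = 0 unless l is
   dominated by m.  Conversely a Garnir straightening writes the two factors of Z_w through
   standard tableaux, up to integral elements supported on larger partitions. *)
Require Import Defs.
From HB Require Import structures.
From mathcomp Require Import all_boot all_order all_algebra all_fingroup fraction.
From mathcomp Require Import Rstruct generic_quotient.
From mathcomp Require Import zify ring.
From Stdlib Require Import ClassicalEpsilon.
Set Implicit Arguments. Unset Strict Implicit. Unset Printing Implicit Defensive.
Import Order.TTheory GRing.Theory Num.Theory.

(** * Length function *)

(** The Schur relations have to be extracted from the bare definitions, and positivity is what makes
    this possible. [K] is formally real, and the trace of [star h * h] on the ideal generated by
    [e_ l] is, up to a nonzero factor, a sum of squares; hence an element killed by all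
    representations is 0. The second tool is the product of the column symmetrizer [E_ l], an
    arbitrary element and the row antisymmetrizer [e_ m]: it vanishes unless [m] is dominated by
    [l], and for [m = l] it ranges over a line. This yields pairwise non-isomorphism, absolute
    irreducibility and the rank one of [e_ l] in [X l]. Reading off the coefficient of 1 in the
    idempotent of [e_ l] then gives norm 1 to the vectors of leading coefficients, because larger
    partitions have a larger [a]; an integer vector of norm 1 has a single nonzero entry, equal to 1
    or -1. Two denominators obstruct integrality: [P_l] in [Z_w], cancelled since [C_{x w_l}] is an
    integral multiple of [C_{w_l}], and the Poincare polynomial in the Garnir relation, for which
    vanishing in [X l] is proved over [K] and integrality separately. *)

Section Length.
Variable n : nat.
Implicit Types (w x y z s t u : 'S_n) (i j k a b : 'I_n).
Local Infix "**" := (@wmul n) (at level 40, left associativity).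

Lemma wmulE x y k : (x ** y) k = x (y k).
Proof. by rewrite permM. Qed.
Lemma wmulA x y z : x ** (y ** z) = x ** y ** z.
Proof. by rewrite /wmul mulgA. Qed.
Lemma wmul1 x : x ** 1%g = x. Proof. by rewrite /wmul mul1g. Qed.
Lemma w1mul x : 1%g ** x = x. Proof. by rewrite /wmul mulg1. Qed.
Lemma wmulVK x y : x^-1%g ** (x ** y) = y.
Proof. by rewrite /wmul -mulgA mulgV mulg1. Qed.
Lemma wmulKV x y : x ** (x^-1%g ** y) = y.
Proof. by rewrite /wmul -mulgA mulVg mulg1. Qed.
Lemma wmulK x y : y ** x ** x^-1%g = y.
Proof. by rewrite /wmul mulgA mulVg mul1g. Qed.
Lemma wmulVr x y : y ** x^-1%g ** x = y.
Proof. by rewrite /wmul mulgA mulgV mul1g. Qed.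
Lemma wmulV x y : (x ** y)^-1%g = y^-1%g ** x^-1%g.
Proof. by rewrite /wmul invMg. Qed.
Lemma wmulI x : injective (wmul x).
Proof. by move=> y z /(congr1 (wmul x^-1%g)); rewrite !wmulVK. Qed.
Lemma wmulIr x : injective (fun y => y ** x).
Proof. by move=> y z /(congr1 (fun y => y ** x^-1%g)); rewrite !wmulK. Qed.

Definition adj i j := val j == (val i).+1.

Lemma gensP s : reflect (exists i j, adj i j /\ s = tperm i j) (s \in gens n).
Proof.
rewrite inE; apply: (iffP existsP) => [[i /existsP[j /andP[h /eqP->]]]|[i [j [h ->]]]].
  by exists i, j.
by exists i; apply/existsP; exists j; apply/andP.
Qed.

Lemma gensV s : s \in gens n -> s^-1%g = s.
Proof. by case/gensP=> i [j [_ ->]]; rewrite tpermV. Qed.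
Lemma gensKl s x : s \in gens n -> s ** (s ** x) = x.
Proof. by move=> hs; rewrite -{1}(gensV hs) wmulVK. Qed.
Lemma gensKr s x : s \in gens n -> x ** s ** s = x.
Proof. by move=> hs; rewrite -{2}(gensV hs) wmulK. Qed.

Lemma adj_tperm_lt i j a b : adj i j -> (a < b)%N -> (a, b) != (i, j) ->
  (tperm i j a < tperm i j b)%N.
Proof.
move=> /eqP hij hab; rewrite xpair_eqE negb_and -!val_eqE /= => hn.
case: tpermP => [ea|ea|/eqP + /eqP +]; case: tpermP => [eb|eb|/eqP + /eqP +];
  move: hij hab hn; rewrite ?ea ?eb -?(inj_eq val_inj) /=; try lia; rewrite -!val_eqE /=; lia.
Qed.

Definition invset w : {set 'I_n * 'I_n} :=
  [set p : 'I_n * 'I_n | (p.1 < p.2)%N && (w p.2 < w p.1)%N].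
Definition inv w : nat := #|invset w|.

(** Exchanging two adjacent positions keeps the order of every pair except [(i, j)], so the
    inversion set is relabelled by [f] and gains exactly that pair. *)
Lemma inv_mulr_up w i j : adj i j -> (w i < w j)%N ->
  inv (w ** tperm i j) = (inv w).+1.
Proof.
move=> hij hw; pose f (p : 'I_n * 'I_n) := (tperm i j p.1, tperm i j p.2).
have fK : involutive f by move=> [a b]; rewrite /f /= !tpermK.
have -> : inv (w ** tperm i j) = #|(i, j) |: f @: invset w|.
  congr #|pred_of_set _|; apply/setP => -[a b]; rewrite !inE /= !wmulE.
  have -> : ((a, b) \in f @: invset w) = (f (a, b) \in invset w).
    by rewrite -{1}(fK (a, b)) (mem_imset _ _ (inv_inj fK)).
  rewrite /f inE /=; case: eqVneq => [[-> ->]|hne] /=.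
    by rewrite tpermL tpermR hw (eqP hij) ltnSn.
  case: (boolP (w (tperm i j b) < w (tperm i j a))%N); rewrite ?andbT ?andbF // => hinv.
  apply/idP/idP => [h|h]; first exact: adj_tperm_lt.
  have := @adj_tperm_lt i j _ _ hij h; rewrite !tpermK; apply.
  apply/negP => /eqP[ha hb]; move: hinv; rewrite ha hb; lia.
rewrite cardsU1 card_imset; last exact: inv_inj fK.
suff -> : (i, j) \notin f @: invset w by [].
apply/negP => /imsetP[[a b]]; rewrite inE /= => /andP[hab _] [ha hb].
move: hab; have -> : a = j by rewrite -[a](tpermK i j) -ha tpermL.
have -> : b = i by rewrite -[b](tpermK i j) -hb tpermR.
by move: hij; rewrite /adj => /eqP /= ->; lia.
Qed.

Lemma adj_neq i j : adj i j -> i != j.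
Proof. by move=> /eqP h; apply/eqP => e; move: h; rewrite e /=; lia. Qed.

Lemma perm_ltNge w i j : i != j -> (w i < w j)%N = ~~ (w j < w i)%N.
Proof.
move=> hij; have : val (w i) != val (w j) by rewrite val_eqE (inj_eq perm_inj).
by move=> /=; lia.
Qed.

Lemma inv_mulr_dn w i j : adj i j -> (w j < w i)%N ->
  (inv (w ** tperm i j)).+1 = inv w.
Proof.
move=> hij hw; rewrite -(@inv_mulr_up _ i j) //; last by rewrite !wmulE tpermL tpermR.
by rewrite gensKr //; apply/gensP; exists i, j.
Qed.

Lemma inv1 : inv 1%g = 0.
Proof.
apply/eqP; rewrite cards_eq0; apply/eqP/setP => -[a b]; rewrite !inE /= !perm1; lia.
Qed.

(** [hm] makes [w] grow by at least the distance between two points; measured from the first point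
    to [a] and from [a] to the last one, this leaves no room, so [w a = a]. *)
Lemma mono_perm1 w : (forall i j, adj i j -> (w i < w j)%N) -> w = 1%g.
Proof.
move=> h; have hm : forall m (a b : 'I_n), (b = a + m :> nat)%N -> (w a + m <= w b)%N.
  elim=> [|m IH] a b hab.
    by rewrite addn0; have -> : a = b by apply: val_inj => /=; lia.
  have hc : (a + m < n)%N by have := ltn_ord b; lia.
  have := IH a (Ordinal hc) erefl; have := h (Ordinal hc) b.
  by rewrite /adj /= hab addnS eqxx => /(_ isT); lia.
apply/permP => a; rewrite perm1; apply: val_inj => /=.
have n0 : (0 < n)%N by have := ltn_ord a; lia.
have n1 : (n.-1 < n)%N by lia.
have := hm a (Ordinal n0) a; have := hm (n.-1 - a)%N a (Ordinal n1).
have := ltn_ord (w (Ordinal n1)); have := ltn_ord a => /= *; lia.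
Qed.

Lemma exists_descent w : w != 1%g -> exists i j, adj i j /\ (w j < w i)%N.
Proof.
move=> h; suff /existsP[i /existsP[j /andP[h1 h2]]] : 
  [exists i, exists j, adj i j && (w j < w i)%N] by exists i, j.
apply: contraNT h => h; move: h; rewrite negb_exists => /forallP h.
apply/eqP; apply: mono_perm1 => i j hij; have := h i; rewrite negb_exists => /forallP /(_ j).
by rewrite hij /= (perm_ltNge w (adj_neq hij)).
Qed.

Lemma len_leP w (k : nat) : reflect (exists t : seq 'S_n,
  [/\ size t = k, {subset t <= gens n} & word_prod t = w]) (len_le w k).
Proof.
apply: (iffP existsP) => [[t /andP[/allP h /eqP h2]]|[t [<- h h2]]].
  by exists t; rewrite size_tuple.
by exists (in_tuple t); rewrite h2 eqxx andbT; apply/allP.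
Qed.

Lemma wordprod_rcons (t : seq 'S_n) s : word_prod (rcons t s) = word_prod t ** s :> 'S_n.
Proof. by elim: t => [|x t IH] /=; rewrite ?wmul1 ?w1mul // IH wmulA. Qed.

Lemma inv_word (t : seq 'S_n) : {subset t <= gens n} -> (inv (word_prod t) <= size t)%N.
Proof.
elim/last_ind: t => [|t s IH] h; first by rewrite /= inv1.
rewrite wordprod_rcons size_rcons.
have /gensP[i [j [hij ->]]] : s \in gens n by apply: h; rewrite mem_rcons inE eqxx.
have {}IH : (inv (word_prod t) <= size t)%N.
  by apply: IH => x hx; apply: h; rewrite mem_rcons inE hx orbT.
case: (boolP (word_prod t j < word_prod t i)%N) => hw.
  have := inv_mulr_dn hij hw; lia.
by rewrite (inv_mulr_up hij) ?ltnS // (perm_ltNge _ (adj_neq hij)).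
Qed.

Lemma exists_word w : exists t : seq 'S_n, [/\ size t = inv w, {subset t <= gens n} & word_prod t = w].
Proof.
elim: {w}(inv w) {-2}w (erefl (inv w)) => [|m IH] w hw.
  have -> : w = 1%g.
    apply/eqP; case: eqVneq => // /exists_descent[i [j [hij h]]].
    by have := inv_mulr_dn hij h; rewrite hw.
  by exists [::]; rewrite inv1.
have : w != 1%g by apply/eqP => e; move: hw; rewrite e inv1.
move=> /exists_descent[i [j [hij h]]].
have [|t [h1 h2 h3]] := IH (w ** tperm i j).
  by have := inv_mulr_dn hij h; lia.
have hs : tperm i j \in gens n by apply/gensP; exists i, j.
exists (rcons t (tperm i j)); rewrite size_rcons h1 wordprod_rcons h3 gensKr //; split=> //.
  exact: inv_mulr_dn.
by move=> x; rewrite mem_rcons inE => /orP[/eqP->|/h2].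
Qed.

(** Each letter of a word changes the number of inversions by one, and sorting by descents attains
    that number. Since it is at most [n * n], the search in [len] succeeds and [find] does not run
    off the end of its list. *)
Lemma lenE w : len w = inv w.
Proof.
have hn : (inv w <= n * n)%N.
  apply: leq_trans (max_card _) _; by rewrite card_prod card_ord.
have h1 : len_le w (inv w) by apply/len_leP; exact: exists_word.
have h0 : nth 0%N (iota 0 (n * n).+1) (inv w) = inv w by rewrite nth_iota.
have hh : has (len_le w) (iota 0 (n * n).+1).
  by apply/hasP; exists (inv w) => //; rewrite mem_iota; lia.
rewrite /len; set m := find _ _.
have hm : (m < (n * n).+1)%N by move: hh; rewrite has_find size_iota.
have hlm : len_le w m by have := nth_find 0%N hh; rewrite nth_iota.
apply/eqP; rewrite eqn_leq; apply/andP; split.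
  rewrite leqNgt; apply/negP => hlt; have := before_find 0%N hlt.
  by rewrite h0 h1.
by case/len_leP: hlm => t [<- h <-]; exact: inv_word.
Qed.

Lemma len_mulr_up w i j : adj i j -> (w i < w j)%N -> len (w ** tperm i j) = (len w).+1.
Proof. by rewrite !lenE; apply: inv_mulr_up. Qed.

Lemma len_mulr_dn w i j : adj i j -> (w j < w i)%N -> (len (w ** tperm i j)).+1 = len w.
Proof. by rewrite !lenE; apply: inv_mulr_dn. Qed.

Lemma len_desc w i j : adj i j -> (len (w ** tperm i j) < len w)%N = (w j < w i)%N.
Proof.
move=> hij; case: (boolP (w j < w i)%N) => h.
  by have := len_mulr_dn hij h; lia.
by have := @len_mulr_up w i j hij; rewrite (perm_ltNge _ (adj_neq hij)) // => /(_ h) ->; lia.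
Qed.

Lemma len1 : len (1%g : 'S_n) = 0%N. Proof. by rewrite lenE inv1. Qed.
Lemma len_eq0 w : (len w == 0)%N = (w == 1%g).
Proof.
apply/eqP/eqP => [h|->]; last exact: len1.
apply/eqP; case: eqVneq => // /exists_descent[i [j [hij /(len_mulr_dn hij)]]].
by rewrite h.
Qed.

Lemma lenV w : len w^-1%g = len w.
Proof.
rewrite !lenE; pose f (p : 'I_n * 'I_n) := (w^-1%g p.2, w^-1%g p.1).
have fi : injective f by move=> [a b] [c d] [] /perm_inj -> /perm_inj ->.
rewrite /inv -(card_imset _ fi); congr #|pred_of_set _|; apply/setP => -[a b].
have -> : (a, b) = f (w b, w a) by rewrite /f /= !permK.
by rewrite (mem_imset _ _ fi) !inE /= !permK andbC.
Qed.

Lemma len_genr w s : s \in gens n ->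
  len (w ** s) = if (len (w ** s) < len w)%N then (len w).-1 else (len w).+1.
Proof.
move=> /gensP[i [j [hij ->]]]; rewrite len_desc //; case: ifP => h.
  by rewrite -(len_mulr_dn hij h).
by rewrite (len_mulr_up hij) // (perm_ltNge _ (adj_neq hij)) // h.
Qed.

Lemma len_genl w s : s \in gens n ->
  len (s ** w) = if (len (s ** w) < len w)%N then (len w).-1 else (len w).+1.
Proof.
by move=> hs; rewrite -lenV wmulV (gensV hs) -(lenV w); exact: len_genr.
Qed.

Lemma len_descl w i j : adj i j ->
  (len (tperm i j ** w) < len w)%N = (w^-1%g j < w^-1%g i)%N.
Proof.
by move=> hij; rewrite -lenV wmulV tpermV -(lenV w); exact: len_desc.
Qed.

Lemma len_gtr w s : s \in gens n -> (len w < len (w ** s))%N = ~~ (len (w ** s) < len w)%N.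
Proof. by move=> hs; rewrite (len_genr w hs); case: ifP => h /=; lia. Qed.
Lemma len_gtl w s : s \in gens n -> (len w < len (s ** w))%N = ~~ (len (s ** w) < len w)%N.
Proof. by move=> hs; rewrite (len_genl w hs); case: ifP => h /=; lia. Qed.

Lemma descl_exists w : w != 1%g -> exists2 s, s \in gens n & (len (s ** w) < len w)%N.
Proof.
move=> h; have : w^-1%g != 1%g by rewrite -(inj_eq invg_inj) invgK invg1.
move=> /exists_descent[i [j [hij hd]]]; exists (tperm i j).
  by apply/gensP; exists i, j.
by rewrite len_descl.
Qed.

Lemma len_ind (P : 'S_n -> Prop) : P 1%g ->
  (forall s w, s \in gens n -> (len w < len (s ** w))%N -> P w -> P (s ** w)) ->
  forall w, P w.
Proof.
move=> h1 hs w; elim: {w}(len w) {-2}w (erefl (len w)) => [|m IH] w hw.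
  by have /eqP : len w == 0%N by [rewrite hw]; move/eqP; rewrite len_eq0 => /eqP->.
have /descl_exists[s hg hd] : w != 1%g by rewrite -len_eq0 hw.
rewrite -(gensKl w hg); apply: hs => //; first by rewrite gensKl.
by apply: IH; rewrite len_genl // hd hw.
Qed.

Lemma len_indr (P : 'S_n -> Prop) : P 1%g ->
  (forall s w, s \in gens n -> (len w < len (w ** s))%N -> P w -> P (w ** s)) ->
  forall w, P w.
Proof.
move=> h1 hs w; rewrite -[w]invgK; elim/len_ind: w^-1%g => [|s x hg hl h].
  by rewrite invg1.
by rewrite wmulV (gensV hg); apply: hs; rewrite // -(gensV hg) -wmulV !lenV.
Qed.

(* The exchange phenomenon behind [T_s (h T_t) = (T_s h) T_t]. *)
Lemma desc_lr s t w : s \in gens n -> t \in gens n -> s ** w <> w ** t ->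
  (len (s ** w ** t) < len (s ** w))%N = (len (w ** t) < len w)%N.
Proof.
move=> /gensP[i [j [hij ->]]] /gensP[a [b [hab ->]]] hne.
rewrite !len_desc // !wmulE.
have hne' : (w a, w b) <> (i, j) /\ (w b, w a) <> (i, j).
  split=> -[h1 h2]; apply: hne; apply/permP => c; rewrite !wmulE.
    by rewrite -h1 -h2 -(inj_tperm _ _ _ perm_inj).
  by rewrite -h1 -h2 tpermC -(inj_tperm _ _ _ perm_inj).
case: (boolP (w b < w a)%N) => h.
  by apply: adj_tperm_lt => //; apply/eqP; case: hne'.
rewrite -(perm_ltNge _ (adj_neq hab)) in h.
by apply/negbTE; rewrite -leqNgt ltnW //; apply: adj_tperm_lt => //; apply/eqP; case: hne'.
Qed.

End Length.

Local Open Scope ring_scope.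

(** * The field of rational functions *)

Lemma tofrac_inj : injective (@tofrac {poly Real}).
Proof. by move=> p q /eqP; rewrite tofrac_eq => /eqP. Qed.

Lemma fracE (x : K) : exists p q : {poly Real}, q != 0 /\ x = tofrac p / tofrac q.
Proof.
elim/quotW: x => x; exists (frac x).1, (frac x).2; split; first exact: denom_ratioP.
have hd := denom_ratioP x.
apply: (mulIf (_ : tofrac (frac x).2 != 0)); first by rewrite tofrac_eq0.
rewrite divfK ?tofrac_eq0 //; unlock tofrac.
rewrite -[LHS]FracField.pi_mul; apply/eqmodP => /=.
by rewrite FracField.equivfE /FracField.mulf !numden_Ratio ?mulr1 ?oner_eq0 //= mulrC.
Qed.

Lemma vK_neq0 : vK != 0. Proof. by rewrite tofrac_eq0 polyX_eq0. Qed.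

(* [f] lies in the local ring of [Real(v)] at [v = x0] and has residue [c]. *)
Section LocTerm.
Variable x0 : Real.

Definition locTerm (f : K) (c : Real) : Prop :=
  exists p q : {poly Real},
    q.[x0] != 0 /\ f = tofrac p / tofrac q /\ c = p.[x0] / q.[x0].

Lemma horner_neq0 (q : {poly Real}) : q.[x0] != 0 -> tofrac q != 0 :> K.
Proof. by rewrite tofrac_eq0; apply: contra => /eqP->; rewrite horner0. Qed.

Lemma loc_uniq f c c' : locTerm f c -> locTerm f c' -> c = c'.
Proof.
move=> [p [q [hq [-> ->]]]] [p' [q' [hq' [+ ->]]]].
move/eqP; rewrite eqr_div ?horner_neq0 // -!tofracM tofrac_eq => /eqP h.
apply/eqP; rewrite eqr_div // -!hornerM h; exact: eqxx.
Qed.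

Lemma loc_poly p : locTerm (tofrac p) p.[x0].
Proof. by exists p, 1; rewrite hornerC tofrac1 !divr1 oner_neq0. Qed.

Lemma loc0 : locTerm 0 0.
Proof. by have := loc_poly 0; rewrite tofrac0 horner0. Qed.
Lemma loc1 : locTerm 1 1.
Proof. by have := loc_poly 1; rewrite tofrac1 hornerC. Qed.

Lemma locD f g c d : locTerm f c -> locTerm g d -> locTerm (f + g) (c + d).
Proof.
move=> [p [q [hq [-> ->]]]] [p' [q' [hq' [-> ->]]]].
exists (p * q' + p' * q), (q * q'); rewrite hornerM mulf_neq0 //; split=> //.
by rewrite !hornerE !tofracD !tofracM !addf_div ?horner_neq0.
Qed.

Lemma locM f g c d : locTerm f c -> locTerm g d -> locTerm (f * g) (c * d).
Proof.
move=> [p [q [hq [-> ->]]]] [p' [q' [hq' [-> ->]]]].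
exists (p * p'), (q * q'); rewrite !hornerM mulf_neq0 //; split=> //.
by rewrite !tofracM !mulf_div.
Qed.

Lemma locN f c : locTerm f c -> locTerm (- f) (- c).
Proof.
move=> [p [q [hq [-> ->]]]]; exists (- p), q; split=> //.
by rewrite tofracN hornerN !mulNr.
Qed.

Lemma locB f g c d : locTerm f c -> locTerm g d -> locTerm (f - g) (c - d).
Proof. by move=> hf hg; apply: locD => //; apply: locN. Qed.

Lemma locV f c : c != 0 -> locTerm f c -> locTerm f^-1 c^-1.
Proof.
move=> hc [p [q [hq [-> e]]]]; exists q, p; rewrite !invf_div e invf_div; split=> //.
by apply: contra_neq hc => h; rewrite e h mul0r.
Qed.

Lemma locX f c k : locTerm f c -> locTerm (f ^+ k) (c ^+ k).
Proof.
move=> h; elim: k => [|k IH]; first exact: loc1.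
by rewrite !exprS; apply: locM.
Qed.

Lemma loc_sum (I : Type) (r : seq I) (P : pred I) f (c : I -> Real) :
  (forall i, P i -> locTerm (f i) (c i)) ->
  locTerm (\sum_(i <- r | P i) f i) (\sum_(i <- r | P i) c i).
Proof.
move=> h; apply: (big_rec2 (fun x y => locTerm x y)); first exact: loc0.
by move=> i x y /h hi hx; apply: locD.
Qed.

Lemma locMn f c k : locTerm f c -> locTerm (f *+ k) (c *+ k).
Proof.
move=> h; elim: k => [|k IH]; first by rewrite !mulr0n; exact: loc0.
by rewrite !mulrS; apply: locD.
Qed.

Lemma loc_nat k : locTerm k%:R k%:R.
Proof. by apply: locMn; exact: loc1. Qed.

Lemma loc_int (z : int) : locTerm z%:~R z%:~R.
Proof.
case: z => k; first exact: loc_nat.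
by rewrite NegzE !mulrNz; apply: locN; exact: loc_nat.
Qed.

Lemma loc_v : locTerm vK x0.
Proof. by have := loc_poly 'X; rewrite hornerX. Qed.

Lemma loc_neq0 f c : c != 0 -> locTerm f c -> f != 0.
Proof. by move=> hc h; apply: contra_neq hc => e; rewrite e in h; apply: loc_uniq h loc0. Qed.

Lemma loc_eq f c c' : c = c' -> locTerm f c -> locTerm f c'. Proof. by move->. Qed.
End LocTerm.

Section EvZ.

Lemma evZ0 x : evZ 0 x = 0. Proof. by rewrite /evZ map_poly0 horner0. Qed.
Lemma evZC (z : int) x : evZ z%:P x = z%:~R. Proof. by rewrite /evZ map_polyC hornerC. Qed.
Lemma evZ1 x : evZ 1 x = 1. Proof. by rewrite -polyC1 evZC. Qed.
Lemma evZX x : evZ 'X x = x. Proof. by rewrite /evZ map_polyX hornerX. Qed.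
Lemma evZD p q x : evZ (p + q) x = evZ p x + evZ q x.
Proof. by rewrite /evZ rmorphD hornerD. Qed.
Lemma evZN p x : evZ (- p) x = - evZ p x.
Proof. by rewrite /evZ rmorphN hornerN. Qed.
Lemma evZM p q x : evZ (p * q) x = evZ p x * evZ q x.
Proof. by rewrite /evZ rmorphM hornerM. Qed.
Lemma evZXn k x : evZ ('X^k) x = x ^+ k.
Proof. by rewrite /evZ map_polyXn hornerXn. Qed.
Lemma evZE p x : evZ p x = \sum_(i < size p) (p`_i)%:~R * x ^+ i.
Proof.
rewrite /evZ (horner_coef_wide _ (size_poly _ _)).
by apply: eq_bigr => i _; rewrite coef_map.
Qed.

Definition polyR (p : {poly int}) : {poly Real} := map_poly intr p.
Lemma evZv p : evZ p vK = tofrac (polyR p).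
Proof.
elim/poly_ind: p => [|p c IH]; first by rewrite evZ0 /polyR map_poly0 tofrac0.
rewrite evZD evZM evZX evZC IH /polyR rmorphD rmorphM /= map_polyX map_polyC /=.
by rewrite tofracD tofracM !rmorph_int.
Qed.

Lemma loc_evZ p : locTerm 0 (evZ p vK) (p`_0)%:~R.
Proof.
by rewrite evZv; apply: loc_eq (loc_poly 0 _); rewrite horner_coef0 coef_map.
Qed.
End EvZ.

Section InA.

Lemma inA_evZ p : inA (evZ p vK).
Proof. by exists p, 0%N; rewrite expr0 divr1. Qed.
Lemma inA0 : inA 0. Proof. by rewrite -(evZ0 vK); exact: inA_evZ. Qed.
Lemma inA1 : inA 1. Proof. by rewrite -(evZ1 vK); exact: inA_evZ. Qed.
Lemma inAv : inA vK. Proof. by rewrite -(evZX vK); exact: inA_evZ. Qed.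
Lemma inAvV : inA vK^-1. Proof. by exists 1, 1%N; rewrite evZ1 expr1 mul1r. Qed.
Lemma inAD a b : inA a -> inA b -> inA (a + b).
Proof.
move=> [p [k ->]] [q [m ->]]; exists (p * 'X^m + q * 'X^k), (k + m)%N.
by rewrite evZD !evZM !evZXn exprD addf_div ?expf_neq0 ?vK_neq0.
Qed.
Lemma inAM a b : inA a -> inA b -> inA (a * b).
Proof.
move=> [p [k ->]] [q [m ->]]; exists (p * q), (k + m)%N.
by rewrite evZM exprD mulf_div.
Qed.
Lemma inAN a : inA a -> inA (- a).
Proof. by move=> [p [k ->]]; exists (- p), k; rewrite evZN mulNr. Qed.
Lemma inAB a b : inA a -> inA b -> inA (a - b).
Proof. by move=> ha hb; apply: inAD => //; apply: inAN. Qed.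
Lemma inAX a k : inA a -> inA (a ^+ k).
Proof.
by move=> h; elim: k => [|k IH]; rewrite ?expr0 ?exprS; [exact: inA1 | apply: inAM].
Qed.
Lemma inA_nat k : inA k%:R.
Proof. by elim: k => [|k IH]; rewrite ?mulr0n ?mulrS; [exact: inA0 | apply: inAD => //; exact: inA1]. Qed.

Lemma common_denA (I : finType) (a : I -> K) : (forall i, inA (a i)) ->
  exists (k : nat) (p : I -> {poly int}), forall i, a i = evZ (p i) vK / vK ^+ k.
Proof.
move=> h; have /fin_all_exists[pk hpk] : forall i, exists pk : {poly int} * nat,
    a i = evZ pk.1 vK / vK ^+ pk.2.
  by move=> i; have [p [k e]] := h i; exists (p, k).
exists (\sum_i (pk i).2)%N, (fun i => (pk i).1 * 'X^(\sum_(j | j != i) (pk j).2)) => i.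
rewrite [X in _ = _ / _ ^+ X](bigD1 i) //= exprD evZM evZXn hpk -mulf_div divff ?mulr1 //.
by rewrite expf_neq0 ?vK_neq0.
Qed.
End InA.

Lemma common_den (I : finType) (f : I -> K) :
  exists (q : {poly Real}) (p : I -> {poly Real}), q != 0 /\
    forall i, f i = tofrac (p i) / tofrac q.
Proof.
have /fin_all_exists[pq hpq] : forall i, exists pq : {poly Real} * {poly Real},
    pq.2 != 0 /\ f i = tofrac pq.1 / tofrac pq.2.
  by move=> i; have [p [q e]] := fracE (f i); exists (p, q).
exists (\prod_i (pq i).2), (fun i => (pq i).1 * \prod_(j | j != i) (pq j).2).
have hn (P : pred I) : \prod_(j | P j) (pq j).2 != 0.
  by apply/prodf_neq0 => j _; case: (hpq j).
split=> [|i]; first exact: (hn xpredT).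
case: (hpq i) => h0 ->.
rewrite [X in _ = _ / tofrac X](bigD1 i) //= !tofracM -mulf_div divff ?mulr1 //.
by rewrite tofrac_eq0.
Qed.

(** After clearing denominators the numerators satisfy the same relation at every real point, and a
    polynomial with too many roots is zero. This positivity is the source of the faithfulness of the
    family of representations. *)
Lemma sumsq_eq0 (I : finType) (f : I -> K) : \sum_i f i ^+ 2 = 0 -> forall i, f i = 0.
Proof.
have [q [p [hq hp]]] := common_den f => h i.
have {}h : \sum_i p i ^+ 2 = 0.
  apply/tofrac_inj; rewrite rmorph_sum tofrac0.
  transitivity (tofrac q ^+ 2 * \sum_i f i ^+ 2); last by rewrite h mulr0.
  rewrite mulr_sumr; apply: eq_bigr => j _.
  by rewrite hp expr_div_n mulrC divfK ?expf_neq0 ?tofrac_eq0 //= tofracXn.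
suff -> : f i = tofrac 0 by rewrite tofrac0.
suff e : p i = 0 by rewrite hp e tofrac0 mul0r.
have hx (x : Real) : (p i).[x] = 0.
  have := congr1 (horner^~ x) h; rewrite /= horner_sum horner0.
  under eq_bigr => j _ do rewrite horner_exp.
  move/eqP; rewrite psumr_eq0 => [|j _]; last exact: sqr_ge0.
  by move=> /allP /(_ i); rewrite mem_index_enum sqrf_eq0 => /(_ isT) /eqP.
apply: (@roots_geq_poly_eq0 _ _ [seq k%:R | k <- iota 0 (size (p i))]).
- by apply/allP => x _; apply/rootP.
- by rewrite map_inj_uniq ?iota_uniq //; exact: mulrIn (oner_neq0 _).
- by rewrite size_map size_iota.
Qed.

(** * The bar involution on rational functions *)

Section Bar.

Definition cfrac (c : Real) : K := tofrac c%:P.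

Fact cfrac_is_zmod_morphism : zmod_morphism cfrac.
Proof. by move=> a b; rewrite /cfrac polyCB tofracB. Qed.
Fact cfrac_is_monoid_morphism : monoid_morphism cfrac.
Proof. by split=> [|a b]; rewrite /cfrac ?polyC1 ?tofrac1 // polyCM tofracM. Qed.
HB.instance Definition _ := GRing.isZmodMorphism.Build Real K cfrac cfrac_is_zmod_morphism.
HB.instance Definition _ := GRing.isMonoidMorphism.Build Real K cfrac cfrac_is_monoid_morphism.

Definition evV (p : {poly Real}) : K := (map_poly cfrac p).[vK^-1].

Lemma evVD p q : evV (p + q) = evV p + evV q.
Proof. by rewrite /evV rmorphD hornerD. Qed.
Lemma evVN p : evV (- p) = - evV p.
Proof. by rewrite /evV rmorphN hornerN. Qed.
Lemma evVM p q : evV (p * q) = evV p * evV q.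
Proof. by rewrite /evV rmorphM hornerM. Qed.
Lemma evV1 : evV 1 = 1.
Proof. by rewrite /evV rmorph1 hornerC. Qed.
Lemma evVX : evV 'X = vK^-1.
Proof. by rewrite /evV map_polyX hornerX. Qed.

Lemma evV_eq0 p : (evV p == 0) = (p == 0).
Proof.
apply/eqP/eqP => [h|->]; last by rewrite /evV map_poly0 horner0.
(* The reversed polynomial: multiplying [p(v^-1)] by [v ^ size p] gives a genuine polynomial in
   which every coefficient of [p] can still be read off. *)
pose q : {poly Real} := \sum_(i < size p) p`_i *: 'X^(size p - i).
have : tofrac q = vK ^+ (size p) * evV p :> K.
  rewrite /q rmorph_sum /evV (horner_coef_wide _ (size_poly _ _)).
  rewrite mulr_sumr; apply: eq_bigr => i _.
  rewrite coef_map /= -mul_polyC tofracM mulrCA; congr (_ * _).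
  by rewrite tofracXn exprVn expfB // vK_neq0.
rewrite h mulr0 => /eqP; rewrite tofrac_eq0 => /eqP q0.
apply/polyP => i; rewrite coef0; case: (ltnP i (size p)) => hi; last exact: nth_default.
have := congr1 (fun r : {poly Real} => r`_(size p - i)) q0; rewrite coef0 coef_sum.
rewrite (bigD1 (Ordinal hi)) //= coefZ coefXn eqxx mulr1 big1 ?addr0 // => j.
rewrite -val_eqE /= => hj; rewrite coefZ coefXn; case: eqP => [e|_]; last by rewrite mulr0.
by case/eqP: hj; have := ltn_ord j; lia.
Qed.

Fact frac_rep_ex (x : K) : exists pq : {poly Real} * {poly Real},
  (pq.2 != 0) && (x == tofrac pq.1 / tofrac pq.2).
Proof. by have [p [q [hq ->]]] := fracE x; exists (p, q); rewrite hq eqxx. Qed.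

Fact bar_key : unit. Proof. by []. Qed.
(** [barRel] only relates elements of [A]; a field automorphism of all of [K] can also be applied to
    scalars such as the inverse of [P_l]. The value is read off a chosen fraction, and [bar_frac]
    shows that the choice is immaterial. *)
Definition bar : K -> K := locked_with bar_key (fun x =>
  evV (xchoose (frac_rep_ex x)).1 / evV (xchoose (frac_rep_ex x)).2).

Lemma bar_frac p q : q != 0 -> bar (tofrac p / tofrac q) = evV p / evV q.
Proof.
move=> hq; rewrite /bar unlock; case/andP: (xchooseP (frac_rep_ex (tofrac p / tofrac q))).
move: (xchoose _) => [p' q'] /= hq'.
rewrite eqr_div ?tofrac_eq0 // -!tofracM tofrac_eq => /eqP h.
by apply/eqP; rewrite eqr_div ?evV_eq0 // -!evVM h.
Qed.

Fact bar_is_zmod_morphism : zmod_morphism bar.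
Proof.
move=> x y; have [p [q [hq ->]]] := fracE x; have [p' [q' [hq' ->]]] := fracE y.
rewrite -mulNr addf_div ?tofrac_eq0 // -tofracN -!tofracM -tofracD !bar_frac ?mulf_neq0 //.
by rewrite evVD !evVM evVN -[- (evV p' / _)]mulNr addf_div ?evV_eq0.
Qed.

Fact bar_is_monoid_morphism : monoid_morphism bar.
Proof.
split=> [|x y].
  by have := bar_frac 1 (oner_neq0 _); rewrite evV1 tofrac1 !divr1.
have [p [q [hq ->]]] := fracE x; have [p' [q' [hq' ->]]] := fracE y.
by rewrite mulf_div -!tofracM !bar_frac ?mulf_neq0 // !evVM mulf_div.
Qed.

HB.instance Definition _ := GRing.isZmodMorphism.Build K K bar bar_is_zmod_morphism.
HB.instance Definition _ := GRing.isMonoidMorphism.Build K K bar bar_is_monoid_morphism.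

Lemma barD x y : bar (x + y) = bar x + bar y. Proof. exact: rmorphD. Qed.
Lemma barB x y : bar (x - y) = bar x - bar y. Proof. exact: rmorphB. Qed.
Lemma barN x : bar (- x) = - bar x. Proof. exact: rmorphN. Qed.
Lemma barM x y : bar (x * y) = bar x * bar y. Proof. exact: rmorphM. Qed.
Lemma barX x k : bar (x ^+ k) = bar x ^+ k. Proof. exact: rmorphXn. Qed.
Lemma barV x : bar x^-1 = (bar x)^-1. Proof. exact: fmorphV. Qed.
Lemma bar0 : bar 0 = 0. Proof. exact: rmorph0. Qed.
Lemma bar1 : bar 1 = 1. Proof. exact: rmorph1. Qed.

Lemma bar_v : bar vK = vK^-1.
Proof.
by have := bar_frac 'X (oner_neq0 _); rewrite evVX evV1 tofrac1 !divr1.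
Qed.

Lemma bar_evZ p : bar (evZ p vK) = evZ p vK^-1.
Proof.
rewrite !evZE rmorph_sum; apply: eq_bigr => i _.
by rewrite rmorphM rmorphXn rmorph_int /= bar_v.
Qed.

Lemma barRelE a b : barRel a b -> b = bar a.
Proof.
move=> [p [k [-> ->]]]; rewrite rmorphM fmorphV rmorphXn /= bar_v bar_evZ.
by rewrite exprVn invrK.
Qed.

(** Multiplied by [v] to the degree, [p(v^-1)] has the leading coefficient of [p] as constant term,
    whereas [p(v)] acquires the constant term 0 as soon as the degree is positive. *)
Lemma bar_inv_const (p : {poly int}) : bar (evZ p vK) = evZ p vK -> evZ p vK = (p`_0)%:~R.
Proof.
case: (leqP (size p) 1) => [h|h].
  by rewrite {3}(size1_polyC h) evZC {1}(size1_polyC h) ?coefC.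
rewrite bar_evZ => e; exfalso.
have hs : size p = (size p).-1.+1 by lia.
have e1 : locTerm 0 (vK ^+ (size p).-1 * evZ p vK^-1) (lead_coef p)%:~R.
  rewrite evZE hs big_ord_recr /= mulrDr -[(lead_coef p)%:~R]add0r; apply: locD.
    rewrite mulr_sumr; apply: (@loc_eq _ _ (\sum_(i < (size p).-1) 0)); first by rewrite big1.
    apply: loc_sum => i _.
    have -> : vK ^+ (size p).-1 * ((p`_i)%:~R * vK^-1 ^+ i) =
       (p`_i)%:~R * (vK * vK ^+ ((size p).-1 - i).-1).
      rewrite -exprS prednK ?subn_gt0 // mulrCA exprVn; congr (_ * _).
      by rewrite -expfB // vK_neq0.
    apply: loc_eq (locM (loc_int _ _) (locM (loc_v _) (locX _ (loc_v _)))).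
    by rewrite mul0r mulr0.
  rewrite mulrCA exprVn mulfV ?expf_neq0 ?vK_neq0 // mulr1; exact: loc_int.
have e2 : locTerm 0 (vK ^+ (size p).-1 * evZ p vK) 0.
  apply: loc_eq (locM (locX _ (loc_v _)) (loc_evZ _)).
  by rewrite -[(size p).-1]prednK ?exprS ?mul0r //; lia.
rewrite e in e1; have /eqP := loc_uniq e1 e2.
by rewrite intr_eq0 lead_coef_eq0 => /eqP p0; rewrite p0 size_poly0 in h.
Qed.

End Bar.

(** * The Hecke algebra *)

(* A copy of [hecke n]: [{ffun 'S_n -> K}] already carries the pointwise product. *)
Definition heck (n : nat) := {ffun 'S_n -> K}.
HB.instance Definition _ n := Choice.on (heck n).

(* The operations are locked: unfolding them makes unification in [K] very slow. *)
Section HeckModule.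
Variable n : nat.
Implicit Types (h g f : heck n) (a b : K).
Fact heck_key : unit. Proof. by []. Qed.
Definition hadd : heck n -> heck n -> heck n :=
  locked_with heck_key (fun h g => [ffun y => h y + g y]).
Definition hopp : heck n -> heck n := locked_with heck_key (fun h => [ffun y => - h y]).
Definition hzero : heck n := locked_with heck_key [ffun _ => 0].
Definition hscal : K -> heck n -> heck n :=
  locked_with heck_key (fun a h => [ffun y => a * h y]).
Lemma haddE h g y : hadd h g y = h y + g y. Proof. by rewrite /hadd unlock ffunE. Qed.
Lemma hoppE h y : hopp h y = - h y. Proof. by rewrite /hopp unlock ffunE. Qed.
Lemma hzeroE y : hzero y = 0. Proof. by rewrite /hzero unlock ffunE. Qed.
Lemma hscalE a h y : hscal a h y = a * h y. Proof. by rewrite /hscal unlock ffunE. Qed.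
Lemma haddA : associative hadd.
Proof. by move=> h g f; apply/ffunP => y; rewrite !haddE addrA. Qed.
Lemma haddC : commutative hadd.
Proof. by move=> h g; apply/ffunP => y; rewrite !haddE addrC. Qed.
Lemma hadd0 : left_id hzero hadd.
Proof. by move=> h; apply/ffunP => y; rewrite !haddE hzeroE add0r. Qed.
Lemma haddN : left_inverse hzero hopp hadd.
Proof. by move=> h; apply/ffunP => y; rewrite !haddE hzeroE hoppE addNr. Qed.
Lemma hscalA a b h : hscal a (hscal b h) = hscal (a * b) h.
Proof. by apply/ffunP => y; rewrite !hscalE mulrA. Qed.
Lemma hscal1 : left_id 1 hscal.
Proof. by move=> h; apply/ffunP => y; rewrite hscalE mul1r. Qed.
Lemma hscalDr : right_distributive hscal hadd.
Proof. by move=> a h g; apply/ffunP => y; rewrite !(hscalE, haddE) mulrDr. Qed.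
Lemma hscalDl h : {morph hscal^~ h : a b / a + b >-> hadd a b}.
Proof. by move=> a b; apply/ffunP => y; rewrite !(hscalE, haddE) mulrDl. Qed.
End HeckModule.
HB.instance Definition _ n := GRing.isZmodule.Build (heck n)
  (@haddA n) (@haddC n) (@hadd0 n) (@haddN n).
HB.instance Definition _ n := GRing.Zmodule_isLmodule.Build K (heck n)
  (@hscalA n) (@hscal1 n) (@hscalDr n) (@hscalDl n).

Notation qK := (vK - vK^-1).

Section HeckeAlg.
Variable n : nat.
Local Notation W := 'S_n.
Local Notation H := (heck n).
Local Infix "**" := (@wmul n) (at level 40, left associativity).
Implicit Types (w x y z s t u : 'S_n) (h g : heck n) (a : K).

Lemma heckP h g : (forall y, h y = g y) -> h = g.
Proof. by move=> e; apply/ffunP. Qed.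
Lemma hE_add h g y : (h + g) y = h y + g y. Proof. exact: haddE. Qed.
Lemma hE_opp h y : (- h) y = - h y. Proof. exact: hoppE. Qed.
Lemma hE_zero y : (0 : H) y = 0. Proof. exact: hzeroE. Qed.
Lemma hE_scale a h y : (a *: h) y = a * h y. Proof. exact: hscalE. Qed.
Lemma hE_sum (I : Type) (r : seq I) (P : pred I) (f : I -> H) y :
  (\sum_(i <- r | P i) f i) y = \sum_(i <- r | P i) f i y.
Proof. by elim/big_rec2: _ => [|i a h _ <-]; rewrite ?hE_zero ?hE_add. Qed.

Lemma hscaleE a h : hscale a h = a *: h.
Proof. by apply: heckP => y; rewrite ffunE hE_scale. Qed.

Definition T : W -> H := locked_with heck_key (@Tb n).
Lemma TbE w : Tb w = T w. Proof. by rewrite /T unlock. Qed.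
Lemma TE w y : T w y = (y == w)%:R. Proof. by rewrite -TbE ffunE. Qed.

Lemma heck_sum h : h = \sum_w h w *: T w.
Proof.
apply: heckP => y; rewrite hE_sum (bigD1 y) //= hE_scale TE eqxx mulr1 big1 ?addr0 // => w hw.
by rewrite hE_scale TE eq_sym (negbTE hw) mulr0.
Qed.

Definition Rsm : W -> H -> H := locked_with heck_key (fun t h =>
  [ffun y => h (y ** t) + (if (len (y ** t) < len y)%N then qK * h y else 0)]).
Definition Lsm : W -> H -> H := locked_with heck_key (@Tsmul n).
Lemma Lsm_Tsmul s h : Lsm s h = Tsmul s h. Proof. by rewrite /Lsm unlock. Qed.

Lemma LsmE s h y : Lsm s h y = h (s ** y) + (if (len (s ** y) < len y)%N then qK * h y else 0).
Proof. by rewrite Lsm_Tsmul ffunE. Qed.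
Lemma RsmE s h y : Rsm s h y = h (y ** s) + (if (len (y ** s) < len y)%N then qK * h y else 0).
Proof. by rewrite /Rsm unlock ffunE. Qed.

Fact Lsm_linear s : linear (Lsm s).
Proof.
move=> a h g; apply: heckP => y; rewrite !(LsmE, hE_add, hE_scale); case: ifP => _; ring.
Qed.
Fact Rsm_linear s : linear (Rsm s).
Proof.
move=> a h g; apply: heckP => y; rewrite !(RsmE, hE_add, hE_scale); case: ifP => _; ring.
Qed.
HB.instance Definition _ s := GRing.isLinear.Build K H H *:%R (Lsm s) (Lsm_linear s).
HB.instance Definition _ s := GRing.isLinear.Build K H H *:%R (Rsm s) (Rsm_linear s).

Lemma Lsm_Rsm s t h : s \in gens n -> t \in gens n -> Lsm s (Rsm t h) = Rsm t (Lsm s h).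
Proof.
move=> hs ht; apply: heckP => y; rewrite LsmE !RsmE !LsmE !wmulA.
case: (eqVneq (s ** y) (y ** t)) => e.
  (* The left and the right neighbour of [y] coincide here, so the two descent conditions are the
     same and both sides agree term by term. *)
  have e2 : s ** y ** t = y by rewrite e gensKr.
  by rewrite -e e2; case: ifP => h1; case: ifP => h2 //=; ring.
have hne : s ** y <> y ** t by apply/eqP.
have -> : (len (s ** y ** t) < len (s ** y))%N = (len (y ** t) < len y)%N.
  exact: desc_lr.
have -> : (len (s ** y ** t) < len (y ** t))%N = (len (s ** y) < len y)%N.
  rewrite -(lenV (s ** y ** t)) -(lenV (y ** t)) -(lenV (s ** y)) -(lenV y).
  rewrite !wmulV wmulA; apply: desc_lr; rewrite ?groupV ?(gensV hs) ?(gensV ht) //.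
  by move=> e3; apply: hne; apply: invg_inj; rewrite !wmulV (gensV hs) (gensV ht).
case: ifP => h1; case: ifP => h2; ring.
Qed.

Lemma Lsm_up s w : s \in gens n -> (len w < len (s ** w))%N -> Lsm s (T w) = T (s ** w).
Proof.
move=> hs hw; apply: heckP => y; rewrite LsmE !TE.
have -> : (s ** y == w) = (y == s ** w).
  by apply/eqP/eqP => [<-|->]; rewrite gensKl.
case: (eqVneq y w) => [->|_]; last by rewrite mulr0 if_same addr0.
by rewrite ltnNge (ltnW hw) addr0.
Qed.

Lemma Rsm_up s w : s \in gens n -> (len w < len (w ** s))%N -> Rsm s (T w) = T (w ** s).
Proof.
move=> hs hw; apply: heckP => y; rewrite RsmE !TE.
have -> : (y ** s == w) = (y == w ** s).
  by apply/eqP/eqP => [<-|->]; rewrite gensKr.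
case: (eqVneq y w) => [->|_]; last by rewrite mulr0 if_same addr0.
by rewrite ltnNge (ltnW hw) addr0.
Qed.

Definition Act : W -> H -> H := locked_with heck_key (@Tact n).
Lemma ActE x h : Act x h = Tact x h. Proof. by rewrite /Act unlock. Qed.

Lemma Act1 h : Act 1%g h = h. Proof. by rewrite ActE /Tact len1. Qed.

Lemma Act_cases x : x = 1%g \/ exists s,
  [/\ s \in gens n, (len (s ** x) < len x)%N & forall h, Act x h = Lsm s (Act (s ** x) h)].
Proof.
case: (eqVneq x 1%g) => [|hx]; [by left | right].
have [s0 hs0 hl0] := descl_exists hx.
suff [s [hs hl e]] : exists s, [/\ s \in gens n, (len (s ** x) < len x)%N &
    forall h, Tact x h = Tsmul s (Tact (s ** x) h)].
  by exists s; split=> // h; rewrite !ActE Lsm_Tsmul; exact: e.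
rewrite /Tact; case E: (len x) => [|k].
  by move/eqP: E; rewrite len_eq0 (negbTE hx).
rewrite /=; case: pickP => [s /andP[hs hl]|/(_ s0)]; last by rewrite hs0 hl0.
exists s; split=> //; first by rewrite -E.
move=> h; congr (Tsmul _ _).
by have := len_genl x hs; rewrite hl E /= => ->.
Qed.

Lemma Act_ind (P : W -> (H -> H) -> Prop) :
  (forall x (f g : H -> H), f =1 g -> P x f -> P x g) ->
  P 1%g id ->
  (forall s x (f : H -> H), s \in gens n -> (len x < len (s ** x))%N -> P x f ->
     P (s ** x) (fun h => Lsm s (f h))) ->
  forall x, P x (Act x).
Proof.
move=> hext h1 hs x; elim: {x}(len x) {-2}x (leqnn (len x)) => [|m IH] x hx.
  have -> : x = 1%g by apply/eqP; rewrite -len_eq0 -leqn0.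
  by apply: hext h1 => h; rewrite Act1.
case: (Act_cases x) => [->|[s [hg hl e]]]; first by apply: hext h1 => h; rewrite Act1.
rewrite -(gensKl x hg); apply: hext (hs s (s ** x) _ hg _ (IH _ _)).
- by move=> h /=; rewrite gensKl // e.
- by rewrite gensKl.
- by rewrite -ltnS; apply: leq_trans hl _.
Qed.

Fact Act_linear x : linear (Act x).
Proof.
apply: (@Act_ind (fun _ f => linear f)) => [{}x f g e hf a h h'| a h h' //| s {}x f _ _ hf a h h'].
  by rewrite -!e hf.
by rewrite hf linearP.
Qed.
HB.instance Definition _ x := GRing.isLinear.Build K H H *:%R (Act x) (Act_linear x).

Lemma Act_T1 x : Act x (T 1%g) = T x.
Proof.
apply: (@Act_ind (fun x f => f (T 1%g) = T x)) => [{}x f g <- //| //| s {}x f hs hl ->].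
exact: Lsm_up.
Qed.

Lemma Act_Rsm x t h : t \in gens n -> Act x (Rsm t h) = Rsm t (Act x h).
Proof.
move=> ht; move: h.
apply: (@Act_ind (fun _ f => forall h, f (Rsm t h) = Rsm t (f h))) => [{}x f g e hf h| // | s {}x f hs _ hf h].
  by rewrite -!e.
by rewrite hf Lsm_Rsm.
Qed.

Definition hm : H -> H -> H := locked_with heck_key (@hmul n).
Lemma hm_hmul h g : hm h g = hmul h g.
Proof. by rewrite /hm unlock. Qed.
Lemma hmE h g : hm h g = \sum_x h x *: Act x g.
Proof.
rewrite hm_hmul; apply: heckP => y; rewrite hE_sum sum_ffunE; apply: eq_bigr => x _.
by rewrite hE_scale ActE ffunE.
Qed.

Lemma hm_addl h h' g : hm (h + h') g = hm h g + hm h' g.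
Proof.
by rewrite !hmE -big_split; apply: eq_bigr => x _; rewrite hE_add scalerDl.
Qed.
Lemma hm_addr h g g' : hm h (g + g') = hm h g + hm h g'.
Proof.
by rewrite !hmE -big_split; apply: eq_bigr => x _; rewrite linearD scalerDr.
Qed.
Lemma hm_scalel a h g : hm (a *: h) g = a *: hm h g.
Proof.
by rewrite !hmE scaler_sumr; apply: eq_bigr => x _; rewrite hE_scale scalerA.
Qed.
Lemma hm_scaler a h g : hm h (a *: g) = a *: hm h g.
Proof.
rewrite !hmE scaler_sumr; apply: eq_bigr => x _.
by rewrite linearZ /= !scalerA mulrC.
Qed.

(** The product is defined through arbitrarily chosen descents. Instead of comparing choices, right
    multiplication by [T y] is identified with any linear operator that commutes with every [Act x]
    and sends [T 1] to [T y]; composites of the operators [Rsm] have this property, and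
    associativity follows. *)
Definition Rrep y (R : H -> H) := [/\ linear R, R (T 1%g) = T y &
  forall x h, Act x (R h) = R (Act x h)].

Lemma linear_sumf (R : H -> H) : linear R -> forall (c : W -> K) (f : W -> H),
  R (\sum_x c x *: f x) = \sum_x c x *: R (f x).
Proof.
move=> hR c f; pose R' := GRing.isLinear.Build K H H *:%R R hR.
pose RL : {linear H -> H} := HB.pack R R'.
rewrite -[R]/(RL : _ -> _) linear_sum; apply: eq_bigr => i _.
by rewrite linearZ.
Qed.

Lemma hm_Rrep y R h : Rrep y R -> hm h (T y) = R h.
Proof.
move=> [hl h1 hc]; rewrite hmE {2}(heck_sum h) linear_sumf //.
by apply: eq_bigr => x _; rewrite -h1 hc Act_T1.
Qed.

Lemma Rrep_gen t : t \in gens n -> Rrep t (Rsm t).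
Proof.
move=> ht; split; [exact: Rsm_linear | | by move=> x h; exact: Act_Rsm].
rewrite Rsm_up // ?w1mul // len1 lt0n len_eq0.
by case/gensP: ht => i [j [/adj_neq hij ->]]; apply: contra_neq hij => /permP /(_ i); rewrite tpermL perm1.
Qed.

Lemma Rrep_ex y : exists R, Rrep y R.
Proof.
elim/len_indr: y => [|s y hs hl [R [h1 h2 h3]]]; first by exists id; split.
exists (Rsm s \o R); split => /=.
- by move=> a h g /=; rewrite h1 linearP.
- by rewrite h2 Rsm_up.
- by move=> x h; rewrite Act_Rsm // h3.
Qed.

Lemma hmA_T (a b : H) y : hm (hm a b) (T y) = hm a (hm b (T y)).
Proof.
have [R hR] := Rrep_ex y; rewrite !(hm_Rrep _ hR).
case: hR => hl _ hc; rewrite !hmE linear_sumf //.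
by apply: eq_bigr => x _; rewrite hc.
Qed.

Lemma hm_sumr (I : Type) (r : seq I) (P : pred I) h (f : I -> H) :
  hm h (\sum_(i <- r | P i) f i) = \sum_(i <- r | P i) hm h (f i).
Proof.
elim/big_rec2: _ => [|i x y _ <-]; last by rewrite hm_addr.
by have := hm_scaler 0 h 0; rewrite !scale0r.
Qed.

Lemma hmA : associative hm.
Proof.
move=> a b c; rewrite (heck_sum c) !hm_sumr; apply: eq_bigr => y _.
by rewrite !hm_scaler hmA_T.
Qed.

Lemma hm1 : left_id (T 1%g) hm.
Proof.
move=> h; rewrite hmE (bigD1 1%g) //= big1 ?addr0 => [|x hx]; rewrite TE.
  by rewrite eqxx scale1r Act1.
by rewrite (negbTE hx) scale0r.
Qed.

Lemma hmr1 : right_id (T 1%g) hm.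
Proof. by move=> h; rewrite (@hm_Rrep 1%g id) //; split=> // ? ? ?. Qed.

Fact T1_neq0 : T 1%g != 0.
Proof. by apply/eqP => /(congr1 (fun h : H => h 1%g)); rewrite hE_zero TE eqxx => /eqP; rewrite oner_eq0. Qed.

End HeckeAlg.

HB.instance Definition _ n := GRing.Zmodule_isNzRing.Build (heck n)
  (@hmA n) (@hm1 n) (@hmr1 n) (fun a b c => @hm_addl n a b c)
  (fun a b c => @hm_addr n a b c) (@T1_neq0 n).
HB.instance Definition _ n := GRing.Lmodule_isLalgebra.Build K (heck n)
  (fun a x y => esym (@hm_scalel n a x y)).
HB.instance Definition _ n := GRing.Lalgebra_isAlgebra.Build K (heck n)
  (fun a x y => esym (@hm_scaler n a x y)).

(** * Anti-involution, invariant form and bar involution of the Hecke algebra *)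

Section HeckeRing.
Variable n : nat.
Local Notation W := 'S_n.
Local Notation H := (heck n).
Local Notation T := (@T n).
Local Infix "**" := (@wmul n) (at level 40, left associativity).
Implicit Types (w x y z s t u : 'S_n) (h g : heck n) (a : K).

Lemma hmulE (h g : hecke n) : hmul h g = (h : H) * (g : H).
Proof. by rewrite -hm_hmul. Qed.
Lemma T1 : T 1%g = 1. Proof. by []. Qed.
Lemma honeE : hone n = (1 : H). Proof. by rewrite /hone TbE. Qed.

Lemma gens_sq s : s \in gens n -> s ** s = 1%g.
Proof. by move=> hs; rewrite -{2}(gensV hs) /wmul mulVg. Qed.

Lemma gens_neq1 s : s \in gens n -> s != 1%g.
Proof.
by case/gensP=> i [j [/adj_neq hij ->]]; apply: contra_neq hij => /permP /(_ i); rewrite tpermL perm1.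
Qed.

Lemma TsM s h : s \in gens n -> T s * h = Lsm s h.
Proof.
move=> hs; have hs1 := gens_neq1 hs.
have ls : len s = 1%N.
  by have := len_genr 1%g hs; rewrite w1mul len1 ltn0.
rewrite -[T s * h]/(hm _ _) hmE (bigD1 s) //= big1 ?addr0 => [|x hx]; rewrite TE; last first.
  by rewrite (negbTE hx) scale0r.
rewrite eqxx scale1r; case: (Act_cases s) => [e|[t [ht hl ->]]].
  by rewrite e eqxx in hs1.
move: hl; rewrite ls ltnS leqn0 len_eq0 => /eqP e.
have -> : t = s by rewrite -[s](gensKl _ ht) e wmul1.
by rewrite gens_sq // Act1.
Qed.

Lemma MTs s h : s \in gens n -> h * T s = Rsm s h.
Proof. by move=> hs; rewrite -[h * T s]/(hm _ _) (hm_Rrep _ (Rrep_gen hs)). Qed.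

Lemma TsT_up s w : s \in gens n -> (len w < len (s ** w))%N -> T s * T w = T (s ** w).
Proof. by move=> hs hl; rewrite TsM // Lsm_up. Qed.
Lemma TTs_up s w : s \in gens n -> (len w < len (w ** s))%N -> T w * T s = T (w ** s).
Proof. by move=> hs hl; rewrite MTs // Rsm_up. Qed.

Lemma Ts_sq s : s \in gens n -> T s * T s = 1 + qK *: T s.
Proof.
move=> hs; rewrite TsM //; apply: heckP => y; rewrite LsmE hE_add hE_scale -T1 !TE.
have -> : (s ** y == s) = (y == 1%g).
  by apply/eqP/eqP => [e|->]; [apply: (@wmulI _ s); rewrite e wmul1 | rewrite wmul1].
case: (eqVneq y s) => [->|_]; last by rewrite !mulr0 if_same.
by rewrite gens_sq // len1 lt0n len_eq0 gens_neq1 // !mulr1.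
Qed.

Lemma len_genS s w : s \in gens n -> (len w < len (s ** w))%N -> len (s ** w) = (len w).+1.
Proof. by move=> hs hl; have := len_genl w hs; rewrite ltnNge (ltnW hl). Qed.
Lemma len_genSr s w : s \in gens n -> (len w < len (w ** s))%N -> len (w ** s) = (len w).+1.
Proof. by move=> hs hl; have := len_genr w hs; rewrite ltnNge (ltnW hl). Qed.

Lemma len_leq_add x y : (len (x ** y) <= len x + len y)%N.
Proof.
elim/len_ind: x => [|s x hs hl IH]; first by rewrite w1mul len1.
rewrite -wmulA (len_genS hs hl); have := len_genl (x ** y) hs; case: ifP => _ ->; lia.
Qed.

Lemma TT_add x y : len (x ** y) = (len x + len y)%N -> T x * T y = T (x ** y).
Proof.
elim/len_ind: x => [|s x hs hl IH] e; first by rewrite w1mul T1 mul1r.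
have ls := len_genS hs hl; have hxy := len_leq_add x y.
have := len_genl (x ** y) hs; move: e; rewrite -wmulA ls => e; case: ifP => hd e2; first by lia.
have exy : len (x ** y) = (len x + len y)%N by lia.
by rewrite -(TsT_up hs hl) -mulrA IH // TsT_up //; lia.
Qed.

Definition star : H -> H := locked_with heck_key (fun h => [ffun y => h y^-1%g]).
Lemma starE h y : star h y = h y^-1%g. Proof. by rewrite /star unlock ffunE. Qed.
Lemma starK : involutive star. Proof. by move=> h; apply: heckP => y; rewrite !starE invgK. Qed.
Fact star_linear : linear star.
Proof. by move=> a h g; apply: heckP => y; rewrite starE !hE_add !hE_scale !starE. Qed.
HB.instance Definition _ := GRing.isLinear.Build K H H *:%R star star_linear.

Lemma starT w : star (T w) = T w^-1%g.
Proof. by apply: heckP => y; rewrite starE !TE -(inj_eq invg_inj) invgK. Qed.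

Lemma star_Ts s h : s \in gens n -> star (T s * h) = star h * T s.
Proof.
move=> hs; rewrite TsM // MTs //; apply: heckP => y; rewrite starE LsmE RsmE !starE.
rewrite wmulV (gensV hs) -(lenV (s ** _)) -(lenV y^-1%g) wmulV (gensV hs) invgK.
by [].
Qed.

Lemma star1 : star 1 = 1. Proof. by rewrite -T1 starT invg1. Qed.

Lemma starM h g : star (h * g) = star g * star h.
Proof.
have hT x : star (T x * g) = star g * T x^-1%g.
  elim/len_ind: x => [|s x hs hl IH]; first by rewrite invg1 T1 mulr1 mul1r.
  rewrite -(TsT_up hs hl) -mulrA star_Ts // IH -mulrA wmulV (gensV hs) TTs_up //.
  by rewrite lenV -(gensV hs) -wmulV lenV.
rewrite (heck_sum h) mulr_suml !linear_sum mulr_sumr; apply: eq_bigr => x _.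
by rewrite -scalerAl !linearZ /= hT -scalerAr starT.
Qed.

Definition ip h g : K := \sum_y h y * g y.
Lemma ipC h g : ip h g = ip g h.
Proof. by apply: eq_bigr => y _; rewrite mulrC. Qed.

Lemma ip_Ts s h g : s \in gens n -> ip (T s * h) g = ip h (T s * g).
Proof.
move=> hs; rewrite /ip !TsM //.
under eq_bigr => y _ do rewrite LsmE mulrDl.
under [RHS]eq_bigr => y _ do rewrite LsmE mulrDr.
rewrite !big_split /=; congr (_ + _).
  rewrite (reindex_inj (@wmulI _ s)) /=; apply: eq_bigr => y _.
  by rewrite gensKl.
by apply: eq_bigr => y _; case: ifP => _; rewrite ?mulr0 ?mul0r // mulrCA mulrA.
Qed.

Lemma ipDl h h' g : ip (h + h') g = ip h g + ip h' g.
Proof. by rewrite /ip -big_split; apply: eq_bigr => y _; rewrite hE_add mulrDl. Qed.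
Lemma ipZl a h g : ip (a *: h) g = a * ip h g.
Proof. by rewrite /ip mulr_sumr; apply: eq_bigr => y _; rewrite hE_scale mulrA. Qed.
Lemma ipZr a h g : ip h (a *: g) = a * ip h g.
Proof. by rewrite ipC ipZl ipC. Qed.
Lemma ip_suml (I : Type) (r : seq I) (P : pred I) (f : I -> H) g :
  ip (\sum_(i <- r | P i) f i) g = \sum_(i <- r | P i) ip (f i) g.
Proof.
elim/big_rec2: _ => [|i x y _ <-]; last by rewrite ipDl.
by rewrite /ip big1 // => y _; rewrite hE_zero mul0r.
Qed.
Lemma ip_sumr (I : Type) (r : seq I) (P : pred I) (f : I -> H) g :
  ip g (\sum_(i <- r | P i) f i) = \sum_(i <- r | P i) ip g (f i).
Proof. by rewrite ipC ip_suml; apply: eq_bigr => i _; rewrite ipC. Qed.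

(** The operator of a generator is symmetric in the orthonormal basis [T], and words are reversed
    under adjunction, which is what [star] does. *)
Lemma ip_adj h g f : ip (h * g) f = ip g (star h * f).
Proof.
have hT x e : ip (T x * g) e = ip g (T x^-1%g * e).
  elim/len_ind: x e => [|s x hs hl IH] e; first by rewrite invg1 T1 !mul1r.
  rewrite -(TsT_up hs hl) -mulrA ip_Ts // IH mulrA wmulV (gensV hs) TTs_up //.
  by rewrite lenV -(gensV hs) -wmulV lenV.
rewrite (heck_sum h) mulr_suml linear_sum mulr_suml ip_suml ip_sumr.
by apply: eq_bigr => x _; rewrite -scalerAl ipZl hT linearZ /= -scalerAl ipZr starT.
Qed.

Lemma ip_T h w : ip h (T w) = h w.
Proof.
rewrite /ip (bigD1 w) //= big1 => [|y hy]; rewrite TE; first by rewrite eqxx mulr1 addr0.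
by rewrite (negbTE hy) mulr0.
Qed.

Lemma tauC h g : (h * g) 1%g = (g * h) 1%g.
Proof.
rewrite -!ip_T !ip_adj !T1 !mulr1 /ip (reindex_inj invg_inj) /=.
by apply: eq_bigr => y _; rewrite !starE invgK mulrC.
Qed.

Lemma tau_TT x y : (T x * T y^-1%g) 1%g = (x == y)%:R.
Proof.
by rewrite tauC -ip_T ip_adj T1 mulr1 starT invgK ip_T TE eq_sym.
Qed.

Lemma T_ind_lin (P : H -> Prop) : P 0 -> (forall h g, P h -> P g -> P (h + g)) ->
  (forall a w, P (a *: T w)) -> forall h, P h.
Proof.
move=> h0 hD hT h; rewrite (heck_sum h).
by elim/big_ind: _ => // w _; exact: hT.
Qed.

Lemma Ts_inv s : s \in gens n -> T s * (T s - qK%:A) = 1.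
Proof. by move=> hs; rewrite mulrBr Ts_sq // -scalerAr mulr1 addrK. Qed.
Lemma Ts_invl s : s \in gens n -> (T s - qK%:A) * T s = 1.
Proof. by move=> hs; rewrite mulrBl Ts_sq // -scalerAl mul1r addrK. Qed.

Lemma Tinv_ex w : exists h, (T w * h == 1) && (h * T w == 1).
Proof.
elim/len_ind: w => [|s w hs hl [h /andP[/eqP h1 /eqP h2]]].
  by exists 1; rewrite T1 mulr1 eqxx.
exists (h * (T s - qK%:A)); rewrite -(TsT_up hs hl).
by rewrite mulrA -(mulrA (T s)) h1 mulr1 Ts_inv // mulrA -(mulrA h) Ts_invl // mulr1 h2 !eqxx.
Qed.

Definition Tinv : W -> H := locked_with heck_key (fun w => xchoose (Tinv_ex w)).
Lemma TinvP w : T w * Tinv w = 1 /\ Tinv w * T w = 1.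
Proof. by rewrite /Tinv unlock; have /andP[/eqP-> /eqP->] := xchooseP (Tinv_ex w). Qed.

Lemma Tinv_uniq w h : h * T w = 1 -> h = Tinv w.
Proof. by move=> e; rewrite -[RHS]mul1r -e -mulrA (proj1 (TinvP w)) mulr1. Qed.

Definition hbar : H -> H :=
  locked_with heck_key (fun h => \sum_y bar (h y) *: Tinv y^-1%g).
Lemma hbarE h : hbar h = \sum_y bar (h y) *: Tinv y^-1%g.
Proof. by rewrite /hbar unlock. Qed.

Lemma hbarD h g : hbar (h + g) = hbar h + hbar g.
Proof. by rewrite !hbarE -big_split; apply: eq_bigr => y _; rewrite hE_add barD scalerDl. Qed.
Lemma hbarZ a h : hbar (a *: h) = bar a *: hbar h.
Proof. by rewrite !hbarE scaler_sumr; apply: eq_bigr => y _; rewrite hE_scale barM scalerA. Qed.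
Lemma hbar_sum (I : Type) (r : seq I) (P : pred I) (f : I -> H) :
  hbar (\sum_(i <- r | P i) f i) = \sum_(i <- r | P i) hbar (f i).
Proof.
elim/big_rec2: _ => [|i x y _ <-]; last by rewrite hbarD.
by rewrite hbarE big1 // => y _; rewrite hE_zero bar0 scale0r.
Qed.
Lemma hbarT w : hbar (T w) = Tinv w^-1%g.
Proof.
rewrite hbarE (bigD1 w) //= big1 => [|y hy]; rewrite TE.
  by rewrite eqxx bar1 scale1r addr0.
by rewrite (negbTE hy) bar0 scale0r.
Qed.
Lemma hbar1 : hbar 1 = 1.
Proof. by rewrite -T1 hbarT invg1; apply/esym/Tinv_uniq; rewrite T1 mulr1. Qed.

Lemma Tinv_up s w : s \in gens n -> (len w < len (s ** w))%N ->
  Tinv (s ** w)^-1%g = (T s - qK%:A) * Tinv w^-1%g.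
Proof.
move=> hs hl; apply/esym/Tinv_uniq.
rewrite wmulV (gensV hs) -(TTs_up (w := w^-1%g) hs); last first.
  by rewrite lenV -(gensV hs) -wmulV lenV.
by rewrite mulrA -(mulrA _ _ (T w^-1%g)) (proj2 (TinvP _)) mulr1 Ts_invl.
Qed.

Lemma bar_q : bar qK = - qK.
Proof. by rewrite barB barV bar_v invrK opprB. Qed.

Lemma hbar_TsM s h : s \in gens n -> hbar (T s * h) = (T s - qK%:A) * hbar h.
Proof.
move=> hs; elim/T_ind_lin: h => [|h g IH1 IH2|a w].
- by rewrite mulr0 hbarE big1 ?mulr0 // => y _; rewrite hE_zero bar0 scale0r.
- by rewrite mulrDr !hbarD mulrDr IH1 IH2.
rewrite -scalerAr !hbarZ -scalerAr; congr (_ *: _).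
case: (boolP (len w < len (s ** w))%N) => hl.
  by rewrite TsT_up // !hbarT Tinv_up.
have hl2 : (len (s ** w) < len (s ** (s ** w)))%N by move: hl; rewrite gensKl // len_gtl // negbK.
have ew : T w = T s * T (s ** w) by rewrite TsT_up // gensKl.
have eb : hbar (T w) = (T s - qK%:A) * hbar (T (s ** w)).
  by rewrite !hbarT -(Tinv_up hs hl2) gensKl.
rewrite {1}ew mulrA Ts_sq // mulrDl mul1r -scalerAl -ew hbarD hbarZ bar_q.
have -> : hbar (T (s ** w)) = T s * hbar (T w) by rewrite eb mulrA Ts_inv // mul1r.
by rewrite mulrBl -scalerAl mul1r scaleNr.
Qed.

Lemma hbarM h g : hbar (h * g) = hbar h * hbar g.
Proof.
elim/T_ind_lin: h => [|h h' IH1 IH2|a w].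
- by rewrite mul0r hbarE big1 ?mul0r // => y _; rewrite hE_zero bar0 scale0r.
- by rewrite mulrDl !hbarD mulrDl IH1 IH2.
rewrite -scalerAl !hbarZ -scalerAl; congr (_ *: _).
elim/len_ind: w => [|s w hs hl IH]; first by rewrite T1 hbar1 !mul1r.
by rewrite -(TsT_up hs hl) -mulrA !(hbar_TsM _ hs) IH mulrA.
Qed.

(** Multiplication by [T s - q] moves a point of the support only to itself or to its left
    neighbour, so lengths stay below that of [w] and the top coefficient stays 1. *)
Lemma hbarT_supp w : (forall y, hbar (T w) y != 0 -> y = w \/ (len y < len w)%N) /\
  hbar (T w) w = 1.
Proof.
elim/len_ind: w => [|s w hs hl [IH1 IH2]].
  rewrite T1 hbar1 -T1; split=> [y|]; rewrite TE ?eqxx //.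
  by case: (eqVneq y 1%g) => [->|_]; [left | case/eqP].
have ls := len_genS hs hl.
have e y : hbar (T (s ** w)) y = hbar (T w) (s ** y) +
    (if (len (s ** y) < len y)%N then 0 else - qK * hbar (T w) y).
  rewrite -(TsT_up hs hl) hbar_TsM // mulrBl -scalerAl mul1r TsM // hE_add hE_opp hE_scale LsmE.
  by case: ifP => _; ring.
split=> [y|].
  rewrite e => h; have : hbar (T w) (s ** y) != 0 \/ hbar (T w) y != 0.
    case: (eqVneq (hbar (T w) (s ** y)) 0) => [e1|h1]; last by left.
    by right; apply/eqP => e2; case/eqP: h; rewrite e1 e2 mulr0 if_same addr0.
  case=> /IH1 [e1|h1].
  - by left; rewrite -e1 gensKl.
  - by right; have := len_genl y hs; case: ifP => _ e2; lia.
  - by right; rewrite e1; lia.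
  - by right; lia.
by rewrite e gensKl // IH2 hl addr0.
Qed.

(* Specialisation at [v = 1] turns the product into that of the group algebra. *)
Definition at1 h (c : W -> Real) := forall y, locTerm 1 (h y) (c y).

Lemma loc1_q : locTerm 1 qK 0.
Proof.
apply: (@loc_eq _ _ (1 - 1^-1)); first by rewrite invr1 subrr.
by apply: locB; [exact: loc_v | apply: locV; [exact: oner_neq0 | exact: loc_v]].
Qed.

Lemma at1_TsM s h c : s \in gens n -> at1 h c -> at1 (T s * h) (fun y => c (s ** y)).
Proof.
move=> hs hc y; rewrite TsM // LsmE -[c _]addr0; apply: locD; first exact: hc.
case: ifP => _; last exact: loc0.
by rewrite -[0](mul0r (c y)); apply: locM; [exact: loc1_q | exact: hc].
Qed.

Lemma at1_TM x h c : at1 h c -> at1 (T x * h) (fun y => c (x^-1%g ** y)).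
Proof.
elim/len_ind: x => [|s x hs hl IH] hc.
  by rewrite T1 mul1r => y; rewrite invg1 w1mul.
rewrite -(TsT_up hs hl) -mulrA => y; rewrite wmulV (gensV hs) -wmulA.
exact: (at1_TsM hs (IH hc) y).
Qed.

End HeckeRing.

(** * Parabolic subgroups and their eigenvectors *)

(* Parabolic subgroups, given by a monotone function [b] whose fibres are the blocks. *)
Section Blocks.
Variable n : nat.
Local Notation W := 'S_n.
Local Notation H := (heck n).
Local Notation T := (@T n).
Local Infix "**" := (@wmul n) (at level 40, left associativity).
Implicit Types (w x y z s t u : 'S_n) (h g : heck n) (a : K) (i j : 'I_n).

Lemma mono_mid (f : 'I_n -> nat) (i j k : 'I_n) :
  (forall i j : 'I_n, (i <= j)%N -> (f i <= f j)%N) ->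
  (i <= k)%N -> (k <= j)%N -> f i = f j -> f i = f k.
Proof. by move=> hf /hf h1 /hf h2 e; apply/eqP; rewrite eqn_leq h1 e h2. Qed.

Section OneBlock.
Variable b : 'I_n -> nat.
Hypothesis bmono : forall i j, (i <= j)%N -> (b i <= b j)%N.

Definition Wb u : bool := [forall i, b (u i) == b i].
Lemma WbP u : reflect (forall i, b (u i) = b i) (Wb u).
Proof. exact: 'forall_eqP. Qed.

Definition binc x : bool :=
  [forall i, forall j, (adj i j && (b i == b j)) ==> (x i < x j)%N].
Lemma bincP x : reflect (forall i j, adj i j -> b i = b j -> (x i < x j)%N) (binc x).
Proof.
apply: (iffP 'forall_forallP) => h i j.
  by move=> hij e; have := h i j; rewrite hij e eqxx.
by apply/implyP => /andP[hij /eqP e]; exact: h.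
Qed.

Lemma binc_lt x i j : binc x -> b i = b j -> (i < j)%N -> (x i < x j)%N.
Proof.
move=> /bincP hx; elim: {j}(j - i)%N {-2}j (erefl (j - i)%N) => [|m IH] j hm hb hij; first by lia.
have hk : (j.-1 < n)%N by have := ltn_ord j; lia.
pose k := Ordinal hk; have kj : adj k j by apply/eqP => /=; lia.
have hbk : b i = b k.
  by apply/eqP; rewrite eqn_leq bmono ?hb ?bmono //=; lia.
case: (ltnP i k) => hik; last first.
  have -> : i = k by apply/val_inj => /=; move: hik => /=; lia.
  by apply: hx => //; rewrite -hbk.
apply: leq_trans (IH k _ hbk hik) _; first by rewrite /=; lia.
by apply/ltnW/hx => //; rewrite -hbk.
Qed.

Lemma nbinc_ex x : ~~ binc x -> exists i j, [/\ adj i j, b i = b j & (x j < x i)%N].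
Proof.
rewrite negb_forall => /existsP[i]; rewrite negb_forall => /existsP[j].
rewrite negb_imply => /andP[/andP[hij /eqP e] h]; exists i, j; split=> //.
by rewrite (perm_ltNge x (_ : j != i)) // eq_sym adj_neq.
Qed.

Lemma Wb1 : Wb 1%g. Proof. by apply/WbP => i; rewrite perm1. Qed.
Lemma WbM u x : Wb u -> Wb x -> Wb (u ** x).
Proof. by move=> /WbP hu /WbP hx; apply/WbP => i; rewrite wmulE hu hx. Qed.
Lemma WbV u : Wb u -> Wb u^-1%g.
Proof. by move=> /WbP hu; apply/WbP => i; rewrite -{2}(permKV u i) hu. Qed.
Lemma WbVE u : Wb u^-1%g = Wb u.
Proof. by apply/idP/idP => /WbV //; rewrite invgK. Qed.
Lemma Wb_tperm i j : b i = b j -> Wb (tperm i j).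
Proof. by move=> e; apply/WbP => k; case: tpermP => [->|->|]. Qed.
Lemma WbMr u x : Wb u -> Wb (u ** x) = Wb x.
Proof.
move=> hu; apply/idP/idP => [h|]; last exact: WbM.
by rewrite -(wmulVK u x); apply: WbM => //; apply: WbV.
Qed.

Lemma binc_Wb1 u : binc u -> Wb u -> u = 1%g.
Proof.
move=> /bincP hu /WbP hb; apply: mono_perm1 => i j hij.
case: (eqVneq (b i) (b j)) => e; first exact: hu.
have hlt : (b i < b j)%N.
  by rewrite ltn_neqAle e bmono //; move/eqP: hij => /= ->.
by rewrite ltnNge; apply/negP => /bmono; rewrite !hb; lia.
Qed.

Lemma binc1 : binc 1%g.
Proof. by apply/bincP => i j /eqP hij _; rewrite !perm1; move: hij => /= ->. Qed.

Lemma Wb_ind (P : W -> Prop) : P 1%g ->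
  (forall u i j, Wb u -> adj i j -> b i = b j -> (len u < len (u ** tperm i j))%N ->
     P u -> P (u ** tperm i j)) ->
  forall u, Wb u -> P u.
Proof.
move=> h1 hs u; elim: {u}(len u) {-2}u (leqnn (len u)) => [|m IH] u hm hu.
  by have -> : u = 1%g by apply/eqP; rewrite -len_eq0 -leqn0.
case: (boolP (binc u)) => [hi|/nbinc_ex[i [j [hij e hlt]]]]; first by rewrite (binc_Wb1 hi hu).
have hl := len_mulr_dn hij hlt.
have hg : tperm i j \in gens n by apply/gensP; exists i, j.
have hu' : Wb (u ** tperm i j) by apply: WbM => //; apply: Wb_tperm.
rewrite -(gensKr u hg); apply: hs => //; first by rewrite gensKr // -hl.
by apply: IH => //; lia.
Qed.

Lemma len_binc_add x u : binc x -> Wb u -> len (x ** u) = (len x + len u)%N.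
Proof.
move=> hx; move: u; apply: Wb_ind => [|u i j hu hij e hl IH]; first by rewrite wmul1 len1 addn0.
have hg : tperm i j \in gens n by apply/gensP; exists i, j.
have hlt : (u i < u j)%N.
  by move: hl; rewrite len_gtr // len_desc // -(perm_ltNge _ (adj_neq hij)).
rewrite wmulA len_mulr_up // ?IH ?(len_mulr_up hij hlt) ?addnS // !wmulE.
by apply: binc_lt => //; rewrite !(WbP _ hu).
Qed.

Lemma block_dec y : exists x u, [/\ y = x ** u, binc x & Wb u].
Proof.
elim: {y}(len y) {-2}y (leqnn (len y)) => [|m IH] y hm.
  have -> : y = 1%g by apply/eqP; rewrite -len_eq0 -leqn0.
  by exists 1%g, 1%g; split; rewrite ?wmul1 ?Wb1 ?binc1.
case: (boolP (binc y)) => [hi|/nbinc_ex[i [j [hij e hlt]]]].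
  by exists y, 1%g; split; rewrite ?wmul1 ?Wb1.
have hl := len_mulr_dn hij hlt.
have hg : tperm i j \in gens n by apply/gensP; exists i, j.
have [|x [u [ey hx hu]]] := IH (y ** tperm i j); first by lia.
exists x, (u ** tperm i j); split=> //; first by rewrite wmulA -ey gensKr.
by apply: WbM => //; apply: Wb_tperm.
Qed.

(** With [w = u ** u'^-1], [x'] is [x] times [w] and [x] is [x'] times its inverse, and both
    products add lengths; so [w] has length 0. *)
Lemma block_uniq x x' u u' : binc x -> binc x' -> Wb u -> Wb u' ->
  x ** u = x' ** u' -> x = x' /\ u = u'.
Proof.
move=> hx hx' hu hu' e.
suff ex : x = x' by split=> //; apply: (@wmulI _ x); rewrite e ex.
have e1 : x' = x ** (u ** u'^-1%g) by rewrite wmulA e wmulK.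
have hw : Wb (u ** u'^-1%g) by rewrite WbM ?WbV.
have l1 := len_binc_add hx hw.
have l2 := len_binc_add hx' (WbV hw); rewrite e1 wmulK -e1 lenV in l2.
have /eqP : len (u ** u'^-1%g) = 0%N by move: l1 l2; rewrite -e1; lia.
by rewrite len_eq0 => /eqP w1; rewrite e1 w1 wmul1.
Qed.

Section Idem.
Variable zeta : K.
Hypothesis z0 : zeta != 0.
Hypothesis zq : zeta - zeta^-1 = qK.

(** The scalars with [zeta - zeta^-1 = v - v^-1] are [v] and [-v^-1], the two eigenvalues of [T s]:
    the element is an unnormalized symmetrizer for the first and an antisymmetrizer for the
    second. *)
Definition eb : H := locked_with heck_key (\sum_(u | Wb u) zeta ^+ len u *: T u).
Lemma eb_sum : eb = \sum_(u | Wb u) zeta ^+ len u *: T u.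
Proof. by rewrite /eb unlock. Qed.

Lemma ebE y : eb y = if Wb y then zeta ^+ len y else 0.
Proof.
rewrite eb_sum hE_sum (eq_bigr (fun u => if u == y then zeta ^+ len y else 0)) => [|u _].
  by rewrite -big_mkcondr /=; case: ifP => hy; [rewrite (big_pred1 y) // => u | rewrite big_pred0 // => u];
    rewrite /= andbC; case: eqP => // ->.
by rewrite hE_scale TE eq_sym; case: eqP => [->|_]; rewrite ?mulr1 ?mulr0.
Qed.

Lemma star_eb : star eb = eb.
Proof. by apply: heckP => y; rewrite starE !ebE WbVE lenV. Qed.

Lemma Ts_eb i j : adj i j -> b i = b j -> T (tperm i j) * eb = zeta *: eb.
Proof.
move=> hij e; have hg : tperm i j \in gens n by apply/gensP; exists i, j.
apply: heckP => y; rewrite TsM // LsmE hE_scale !ebE WbMr ?Wb_tperm //.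
case: (boolP (Wb y)) => hy; last by rewrite !mulr0 if_same addr0.
have := len_genl y hg; case: ifP => hl el; last by rewrite el addr0 exprS.
have -> : len y = (len (tperm i j ** y)).+1 by lia.
by rewrite exprS -zq mulrBl (mulrA zeta^-1) mulVf // mul1r addrC subrK.
Qed.

Lemma eb_Ts i j : adj i j -> b i = b j -> eb * T (tperm i j) = zeta *: eb.
Proof.
move=> hij e; have := congr1 (@star n) (Ts_eb hij e).
by rewrite starM linearZ /= star_eb starT tpermV.
Qed.

Lemma Tu_eb u : Wb u -> T u * eb = zeta ^+ len u *: eb.
Proof.
move: u; apply: Wb_ind => [|u i j hu hij e hl IH]; first by rewrite T1 mul1r len1 scale1r.
have hg : tperm i j \in gens n by apply/gensP; exists i, j.
rewrite -(TTs_up hg hl) -mulrA (Ts_eb hij e) -scalerAr IH scalerA.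
by rewrite (len_genSr hg hl) exprS.
Qed.

Definition Pb : K := \sum_(u | Wb u) zeta ^+ (2 * len u).

Lemma eb_sq : eb * eb = Pb *: eb.
Proof.
rewrite {1}eb_sum mulr_suml /Pb scaler_suml; apply: eq_bigr => u hu.
by rewrite -scalerAl Tu_eb // scalerA -exprD addnn mul2n.
Qed.

Lemma Tx_ebE x y : binc x -> (T x * eb) y = if Wb (x^-1%g ** y) then zeta ^+ len (x^-1%g ** y) else 0.
Proof.
move=> hx; rewrite eb_sum mulr_sumr hE_sum.
rewrite (eq_bigr (fun u => if u == x^-1%g ** y then zeta ^+ len (x^-1%g ** y) else 0)) => [|u hu].
  by rewrite -big_mkcondr /=; case: ifP => hy;
   [rewrite (big_pred1 (x^-1%g ** y)) // => u | rewrite big_pred0 // => u];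
    rewrite /= andbC; case: eqP => // ->.
rewrite -scalerAr hE_scale TT_add ?TE; last exact: len_binc_add.
have -> : (u == x^-1%g ** y) = (y == x ** u).
  by apply/eqP/eqP => [->|->]; rewrite ?wmulKV ?wmulVK.
by case: eqP => [->|_]; rewrite ?mulr1 ?mulr0 // wmulVK.
Qed.

Lemma right_eigen h : (forall i j, adj i j -> b i = b j -> h * T (tperm i j) = zeta *: h) ->
  forall x u, binc x -> Wb u -> h (x ** u) = zeta ^+ len u * h x.
Proof.
move=> hz x u hx; move: u; apply: Wb_ind => [|u i j hu hij e hl IH]; first by rewrite wmul1 len1 mul1r.
have hg : tperm i j \in gens n by apply/gensP; exists i, j.
rewrite (len_genSr hg hl) exprS -mulrA -IH.
have := congr1 (fun h : H => h (x ** u)) (hz i j hij e).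
rewrite MTs // RsmE hE_scale => <-; rewrite -!wmulA.
have hl2 : (len (x ** u) < len (x ** (u ** tperm i j)))%N.
  have hut : Wb (u ** tperm i j) by apply: WbM => //; apply: Wb_tperm.
  by rewrite !(len_binc_add hx) ?ltn_add2l.
by rewrite ltnNge (ltnW hl2) addr0.
Qed.

(** Along a coset an eigenvector is only multiplied by powers of [zeta], so its values on the
    minimal representatives determine it. *)
Lemma right_eigen_expand h : (forall i j, adj i j -> b i = b j -> h * T (tperm i j) = zeta *: h) ->
  h = \sum_(x | binc x) h x *: (T x * eb).
Proof.
move=> hz; apply: heckP => y; have [x [u [-> hx hu]]] := block_dec y.
rewrite hE_sum (bigD1 x) //= hE_scale Tx_ebE // wmulVK hu (right_eigen hz) // mulrC.
rewrite big1 ?addr0 // => x' /andP[hx' hne]; rewrite hE_scale Tx_ebE //.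
case: ifP => hw; last by rewrite mulr0.
have [e _] := block_uniq hx' hx hw hu (wmulKV x' (x ** u)).
by rewrite e eqxx in hne.
Qed.

End Idem.
End OneBlock.

Lemma vz0 : - vK^-1 != 0. Proof. by rewrite oppr_eq0 invr_eq0 vK_neq0. Qed.
Lemma vzq : - vK^-1 - (- vK^-1)^-1 = qK.
Proof. by rewrite invrN invrK opprK addrC. Qed.

(** * Products of a symmetrizer, a basis element and an antisymmetrizer *)

Section TwoBlocks.
Variables b kk : 'I_n -> nat.
Hypothesis bmono : forall i j, (i <= j)%N -> (b i <= b j)%N.
Hypothesis kmono : forall i j, (i <= j)%N -> (kk i <= kk j)%N.
Local Notation E := (eb kk vK).
Local Notation C := (eb b (- vK^-1)).

(** In the matrix counting how many points of a block of [b] are sent to a block of [kk], all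
    entries are at most 1: these are the 0-1 matrices of Gale and Ryser. *)
Definition good w := forall p q, b p = b q -> kk (w p) = kk (w q) -> p = q.

(** A descent of [w] inside a block of [b] is absorbed by the antisymmetrizer with factor [-v^-1], a
    descent of [w^-1] inside a block of [kk] by the symmetrizer with factor [v]; both shorten
    [w]. *)
Lemma sandwich_red w : exists w' c, [/\ E * T w * C = c *: (E * T w' * C),
  binc b w' & binc kk w'^-1%g].
Proof.
elim: {w}(len w) {-2}w (leqnn (len w)) => [|m IH] w hm.
  have -> : w = 1%g by apply/eqP; rewrite -len_eq0 -leqn0.
  by exists 1%g, 1; rewrite scale1r invg1 !binc1.
case: (boolP (binc b w)) => [hi|/nbinc_ex[i [j [hij e hlt]]]]; last first.
  have hl := len_mulr_dn hij hlt.
  have hg : tperm i j \in gens n by apply/gensP; exists i, j.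
  have [|w' [c [e1 e2 e3]]] := IH (w ** tperm i j); first by lia.
  exists w', (- vK^-1 * c); split=> //.
  rewrite -scalerA -e1 -{1}(gensKr w hg) -(TTs_up (w := w ** tperm i j) hg) ?gensKr -?hl //.
  by rewrite -!mulrA (Ts_eb vz0 vzq hij e) -!scalerAr.
case: (boolP (binc kk w^-1%g)) => [hk|/nbinc_ex[i [j [hij e hlt]]]].
  by exists w, 1; rewrite scale1r.
have hl := len_mulr_dn hij hlt.
have hg : tperm i j \in gens n by apply/gensP; exists i, j.
have el : len (tperm i j ** w) = len (w^-1%g ** tperm i j).
  by rewrite -lenV wmulV tpermV.
rewrite lenV in hl.
have [|w' [c [e1 e2 e3]]] := IH (tperm i j ** w); first by lia.
exists w', (vK * c); split=> //.
rewrite -{1}(gensKl w hg) -(TsT_up (w := tperm i j ** w) hg); last by rewrite gensKl // el -hl.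
by rewrite (mulrA E) (eb_Ts vK_neq0 _ hij e) // -!scalerAl e1 scalerA.
Qed.

Lemma v2_neq0 : vK + vK^-1 != 0.
Proof.
have : vK * (vK + vK^-1) != 0.
  apply: (@loc_neq0 0 _ 1); first exact: oner_neq0.
  rewrite mulrDr mulfV ?vK_neq0 // -[X in locTerm _ _ X]add0r; apply: locD; last exact: loc1.
  by apply: loc_eq (locM (loc_v 0) (loc_v 0)); rewrite mul0r.
by rewrite mulf_eq0 negb_or => /andP[].
Qed.

(** Two points of one block with images in one block force two adjacent such points with adjacent
    images. Then [w] times one reflection equals another reflection times [w], and absorbing it on
    the right or on the left multiplies the same element by [-v^-1] or by [v]. *)
Lemma sandwich_zero w : binc b w -> binc kk w^-1%g ->
  (exists p q : 'I_n, [/\ (p < q)%N, b p = b q & kk (w p) = kk (w q)]) -> E * T w * C = 0.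
Proof.
move=> hw hk [p [q [hpq ebq ekk]]].
have hp' : (p.+1 < n)%N by have := ltn_ord q; lia.
pose p' := Ordinal hp'; have pp' : adj p p' by exact/eqP.
have ebp : b p = b p' by apply: (@mono_mid b p q) => //=.
have hwp : (w p < w p')%N by apply: (binc_lt bmono hw) => //=.
have hwq : (w p' <= w q)%N.
  case: (ltnP p' q) => hq; first by apply/ltnW/(binc_lt bmono hw) => //; rewrite -ebp.
  by have -> : p' = q by apply/val_inj => /=; move: hq => /=; lia.
have ekp : kk (w p) = kk (w p') by apply: (@mono_mid kk _ (w q)); rewrite // ltnW.
(* A point strictly between the two images lies in the same block of [kk], so [w^-1] would send it
   strictly between the adjacent points [p] and [p']. *)
have cc' : adj (w p) (w p').
  apply/eqP; apply/eqP; rewrite eqn_leq hwp andbT leqNgt; apply/negP => hlt.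
  have hm : ((w p).+1 < n)%N by have := ltn_ord (w p'); lia.
  pose m := Ordinal hm.
  have ekm : kk (w p) = kk m by apply: (@mono_mid kk _ (w p')); rewrite //= ltnW.
  have h1 := binc_lt kmono hk ekm (ltnSn _).
  have h2 : (w^-1%g m < w^-1%g (w p'))%N.
    by apply: (binc_lt kmono hk) => //; rewrite -ekm.
  by move: h1 h2; rewrite !permK /=; lia.
have hg : tperm p p' \in gens n by apply/gensP; exists p, p'.
have hg' : tperm (w p) (w p') \in gens n by apply/gensP; exists (w p), (w p').
have ews : w ** tperm p p' = tperm (w p) (w p') ** w.
  by apply/permP => c; rewrite !wmulE (inj_tperm _ _ _ perm_inj).
have hl : (len w < len (w ** tperm p p'))%N by rewrite (len_mulr_up pp').
have e1 : E * T (w ** tperm p p') * C = - vK^-1 *: (E * T w * C).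
  by rewrite -(TTs_up hg hl) -!mulrA (Ts_eb vz0 vzq pp' ebp) -!scalerAr.
have e2 : E * T (w ** tperm p p') * C = vK *: (E * T w * C).
  rewrite ews -(TsT_up hg') -?ews // (mulrA E) (eb_Ts vK_neq0 _ cc' ekp) //.
  by rewrite -!scalerAl.
have /eqP : (vK + vK^-1) *: (E * T w * C) = 0.
  by rewrite scalerDl -e2 e1 scaleNr addNr.
by rewrite scaler_eq0 (negbTE v2_neq0) => /eqP.
Qed.

Lemma sandwich w : E * T w * C = 0 \/ exists w' c,
  [/\ E * T w * C = c *: (E * T w' * C), binc b w', binc kk w'^-1%g & good w'].
Proof.
have [w' [c [e h1 h2]]] := sandwich_red w.
case: (boolP [exists p : 'I_n, exists q : 'I_n, [&& (p < q)%N, b p == b q & kk (w' p) == kk (w' q)]]).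
  move=> /existsP[p /existsP[q /and3P[hpq /eqP e1 /eqP e2]]]; left.
  by rewrite e sandwich_zero ?scaler0 //; exists p, q.
move=> hn; right; exists w', c; split=> // p q e1 e2.
apply/eqP; apply: contraNT hn; rewrite -val_eqE neq_ltn => /orP[] hlt.
  by apply/existsP; exists p; apply/existsP; exists q; rewrite hlt e1 e2 !eqxx.
by apply/existsP; exists q; apply/existsP; exists p; rewrite hlt e1 e2 !eqxx.
Qed.

(** At [v = 1] the coefficient at [w] is a signed count of the elements of the [kk] subgroup that
    are conjugated by [w] into the [b] subgroup; goodness leaves only the identity, so the
    coefficient is 1. *)
Lemma sandwich_neq0 w : good w -> E * T w * C != 0.
Proof.
move=> hg; apply/eqP => e0.
have hC : at1 C (fun y => if Wb b y then (-1) ^+ len y else 0).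
  move=> y; rewrite ebE; case: ifP => _; last exact: loc0.
  by apply: locX; apply: loc_eq (locN (locV (oner_neq0 _) (loc_v 1))); rewrite invr1.
have hE : locTerm 1 ((E * T w * C) w)
   (\sum_(u | Wb kk u) (if Wb b (w^-1%g ** (u^-1%g ** w)) then (-1) ^+ len (w^-1%g ** (u^-1%g ** w)) else 0)).
  rewrite -mulrA (eb_sum kk) mulr_suml hE_sum; apply: loc_sum => u hu.
  rewrite -scalerAl hE_scale -[X in locTerm _ _ X]mul1r; apply: locM.
    by apply: loc_eq (locX _ (loc_v 1)); rewrite expr1n.
  by have := at1_TM u (at1_TM w hC) w.
have := loc_uniq hE; rewrite e0 hE_zero => /(_ 0 (loc0 _)) /eqP.
rewrite (bigD1 1%g) ?Wb1 //= big1 => [|u /andP[hu hne]].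
  by rewrite invg1 w1mul addr0 /wmul mulgV Wb1 len1 expr0 oner_eq0.
case: ifP => // /WbP hb; case/eqP: hne.
have hu' := WbP _ _ (WbV hu).
apply: invg_inj; rewrite invg1; apply/permP => c; rewrite perm1.
have hd := hb (w^-1%g c); rewrite !wmulE permKV in hd.
have := hg _ _ hd; rewrite !permKV hu' => /(_ erefl) /(congr1 w).
by rewrite !permKV.
Qed.

End TwoBlocks.
End Blocks.

Local Close Scope ring_scope.

(** * Longest elements of parabolic subgroups *)

Section LongestElement.
Variable n : nat.
Variable b : 'I_n -> nat.
Hypothesis bmono : forall i j : 'I_n, (i <= j)%N -> (b i <= b j)%N.
Local Infix "**" := (@wmul n) (at level 40, left associativity).
Implicit Types (u x : 'S_n).

Definition Nb : nat := #|[set p : 'I_n * 'I_n | (p.1 < p.2) && (b p.1 == b p.2)]|.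

Lemma len_Wb_le u : Wb b u -> (len u <= Nb)%N.
Proof.
move=> /WbP hu; rewrite lenE; apply: subset_leq_card; apply/subsetP => -[p q].
rewrite !inE /= => /andP[hpq hlt]; rewrite hpq /=.
rewrite eqn_leq (bmono (ltnW hpq)) /= -(hu q) -(hu p).
by apply: bmono; apply: ltnW.
Qed.

Definition longest u := Wb b u /\ forall x, Wb b x -> (len x <= len u)%N.

(** An ascent between adjacent points of a block could be reversed by their transposition, which
    would give a longer element of the subgroup. *)
Lemma longest_dec u (p q : 'I_n) : longest u -> (p < q)%N -> b p = b q -> (u q < u p)%N.
Proof.
move=> [hu hmax]; elim: {q}(q - p)%N {-2}q (erefl (q - p)%N) => [|m IH] q hm hpq e; first by lia.
have hk : (q.-1 < n)%N by have := ltn_ord q; lia.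
pose k := Ordinal hk; have kq : adj k q by apply/eqP => /=; lia.
have ek : b p = b k by apply: (@mono_mid _ b p q) => //=; lia.
have hkq : (u q < u k)%N.
  rewrite ltnNge; apply/negP => hle.
  have hlt : (u k < u q)%N.
    by rewrite ltn_neqAle hle andbT val_eqE (inj_eq perm_inj) adj_neq.
  have := hmax (u ** tperm k q); rewrite (len_mulr_up kq hlt) ltnn => h.
  by have := h (WbM hu (Wb_tperm (etrans (esym ek) e))).
case: (ltnP p k) => hik; last first.
  by have -> : p = k by apply/val_inj => /=; move: hik => /=; lia.
by apply: ltn_trans hkq _; apply: IH => //=; lia.
Qed.

Lemma longest_len u : longest u -> len u = Nb.
Proof.
move=> hu; apply/eqP; rewrite eqn_leq len_Wb_le; last by case: hu.
rewrite lenE; apply: subset_leq_card; apply/subsetP => -[p q].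
by rewrite !inE /= => /andP[hpq /eqP e]; rewrite hpq /=; apply: longest_dec.
Qed.

Lemma longest_uniq u x : longest u -> longest x -> u = x.
Proof.
move=> hu hx; apply: (@wmulI _ u^-1%g).
have hb v : longest v -> Wb b v by case.
have hw : Wb b (u^-1%g ** x) by apply: WbM; [apply: WbV; apply: hb | apply: hb].
rewrite (binc_Wb1 bmono _ hw); first by rewrite /wmul mulgV.
apply/bincP => i j hij e; rewrite !wmulE.
have hd : (x j < x i)%N by apply: longest_dec => //; move/eqP: hij => /= ->.
rewrite ltnNge leq_eqVlt negb_or; apply/andP; split.
  by rewrite val_eqE !(inj_eq perm_inj) eq_sym adj_neq.
apply/negP => hlt; have := longest_dec hu hlt; rewrite !permKV => /(_ _).
have /WbP hv := WbV (hb _ hu); have /WbP hx' := hb _ hx.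
by rewrite !hv !hx' e => /(_ erefl); lia.
Qed.

Lemma longestV u : longest u -> u^-1%g = u.
Proof.
move=> hu; apply: (longest_uniq _ hu); case: (hu) => hu' hm; split; first exact: WbV.
by move=> x hx; rewrite lenV; apply: hm.
Qed.

Lemma longest_of_len u x : longest u -> Wb b x -> len x = len u -> x = u.
Proof.
move=> hu hx e; apply: (longest_uniq _ hu); split=> // y hy.
by rewrite e; case: hu => _; apply.
Qed.
End LongestElement.

(** * Partitions *)

Section Partitions.
Variable n : nat.
Local Infix "**" := (@wmul n) (at level 40, left associativity).
Implicit Types (l m : part n) (u x w : 'S_n).

Lemma lamE l (i : 'I_n) : lam l i = tnth (val l) i.
Proof.
rewrite /lam (nth_map (tnth (val l) i)) ?size_tuple //.
by rewrite -tnth_nth.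
Qed.
Lemma lam_ge l k : (n <= k)%N -> lam l k = 0%N.
Proof. by move=> h; rewrite /lam nth_default // size_map size_tuple. Qed.

Lemma lam_anti l i j : (i <= j)%N -> (lam l j <= lam l i)%N.
Proof.
move=> hij; case: (ltnP j n) => hj; last by rewrite lam_ge.
have hi : (i < n)%N by apply: leq_ltn_trans hij hj.
have /andP[_ /forallP /(_ (Ordinal hi)) /forallP /(_ (Ordinal hj)) /implyP] := valP l.
by rewrite -!lamE; apply.
Qed.

Lemma partsum0 l : partsum l 0 = 0%N. Proof. by rewrite /partsum big_geq. Qed.
Lemma partsumS l i : partsum l i.+1 = (partsum l i + lam l i)%N.
Proof. by rewrite /partsum big_nat_recr. Qed.
Lemma partsum_n l : partsum l n = n.
Proof.
have /andP[/eqP h _] := valP l; rewrite -[RHS]h /partsum big_mkord.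
by apply: eq_bigr => i _; rewrite lamE.
Qed.
Lemma partsum_mono l i j : (i <= j)%N -> (partsum l i <= partsum l j)%N.
Proof.
move=> /subnKC <-; elim: (j - i)%N => [|k IH]; first by rewrite addn0.
by rewrite addnS partsumS; apply: leq_trans IH (leq_addr _ _).
Qed.
Lemma partsum_ge l i : (n <= i)%N -> partsum l i = n.
Proof.
move=> /subnKC <-; elim: (i - n)%N => [|k IH]; first by rewrite addn0 partsum_n.
by rewrite addnS partsumS IH lam_ge ?leq_addr // addn0.
Qed.
Lemma partsum_le l i : (partsum l i <= n)%N.
Proof.
case: (leqP i n) => h; last by rewrite partsum_ge // ltnW.
by rewrite -{2}(partsum_n l) partsum_mono.
Qed.

(** Row of the cell that carries [p] in the row reading of the diagram, all 0-based: the first row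
    whose end lies beyond [p]. *)
Definition prow l (p : 'I_n) : nat := find (fun i => p < partsum l i.+1)%N (iota 0 n).
Definition pcol l (p : 'I_n) : nat := (p - partsum l (prow l p))%N.

Lemma row_spec l p : [/\ (prow l p < n)%N, (partsum l (prow l p) <= p)%N &
  (p < partsum l (prow l p).+1)%N].
Proof.
have n0 : (0 < n)%N by apply: leq_ltn_trans (ltn_ord p).
have hh : has (fun i => p < partsum l i.+1)%N (iota 0 n).
  apply/hasP; exists n.-1; first by rewrite mem_iota; lia.
  by rewrite prednK // partsum_n.
have hr : (prow l p < n)%N by move: hh; rewrite has_find size_iota.
split=> //; last by have := nth_find 0%N hh; rewrite nth_iota.
case E: (prow l p) => [|r]; first by rewrite partsum0.
have hlt : (r < prow l p)%N by rewrite E.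
have := before_find 0%N hlt; rewrite nth_iota ?add0n; last by apply: ltn_trans hr.
by move=> h; rewrite leqNgt h.
Qed.

Lemma row_uniq l (p : 'I_n) i : (partsum l i <= p)%N -> (p < partsum l i.+1)%N -> prow l p = i.
Proof.
move=> h1 h2; have [_ h3 h4] := row_spec l p.
apply/eqP; rewrite eqn_leq; apply/andP; split; rewrite leqNgt; apply/negP => /(partsum_mono l); lia.
Qed.

Lemma row_lt l (p : 'I_n) i : (prow l p < i)%N = (p < partsum l i)%N.
Proof.
have [_ h3 h4] := row_spec l p; case: ltnP => h; apply/esym.
  by apply: leq_trans h4 (partsum_mono _ _).
by apply/negbTE; rewrite -leqNgt; apply: leq_trans h3; apply: partsum_mono.
Qed.

Lemma row_mono l (p q : 'I_n) : (p <= q)%N -> (prow l p <= prow l q)%N.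
Proof. by move=> h; rewrite -ltnS row_lt; apply: leq_ltn_trans h _; rewrite -row_lt. Qed.

Lemma rowcol l (p : 'I_n) : (p = partsum l (prow l p) + pcol l p :> nat)%N.
Proof. by have [_ h _] := row_spec l p; rewrite /pcol subnKC. Qed.
Lemma col_lt l (p : 'I_n) : (pcol l p < lam l (prow l p))%N.
Proof. by have [_ h1 h2] := row_spec l p; rewrite /pcol ltn_subLR // -partsumS. Qed.

Lemma cell_ex l i c : (c < lam l i)%N -> exists p : 'I_n,
  [/\ p = (partsum l i + c)%N :> nat, prow l p = i & pcol l p = c].
Proof.
move=> hc; have hp : (partsum l i + c < n)%N.
  by apply: leq_trans (partsum_le l i.+1); rewrite partsumS ltn_add2l.
exists (Ordinal hp).
have e : prow l (Ordinal hp) = i by apply: row_uniq; rewrite /= ?leq_addr // partsumS ltn_add2l.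
by split=> //; rewrite /pcol e /= addKn.
Qed.

Lemma cell_inj l (p q : 'I_n) : prow l p = prow l q -> pcol l p = pcol l q -> p = q.
Proof. by move=> e1 e2; apply/val_inj => /=; rewrite (rowcol l p) (rowcol l q) e1 e2. Qed.

(** Points are 0-based, so [i.+1] is the usual index of the generator exchanging [i] and [j]; it is
    a partial sum exactly when a row ends at [i]. *)
Lemma adj_row l (i j : 'I_n) : adj i j ->
  ((val i).+1 \notin [seq partsum l k | k <- iota 1 n]) = (prow l i == prow l j).
Proof.
move=> /eqP hij; have [r1 r2 r3] := row_spec l i; have [s1 s2 s3] := row_spec l j.
apply/idP/idP => [h|/eqP e].
  apply: contraNT h => hne; apply/mapP; exists (prow l i).+1.
    by rewrite mem_iota; lia.
  have hlt : (prow l i < prow l j)%N by rewrite ltn_neqAle hne row_mono // hij.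
  by have := partsum_mono l hlt; move: hij => /= hij; lia.
apply/mapP => -[k _ ek]; move: hij => /= hij; move: ek => /= ek.
case: (ltnP k (prow l j).+1) => hk; last by have := partsum_mono l hk; lia.
by rewrite ltnS -e in hk; have := partsum_mono l hk; lia.
Qed.

Lemma youngE l u : (u \in young l) = Wb (prow l) u.
Proof.
apply/idP/idP.
  have hg : group_set [set u | Wb (prow l) u].
    apply/group_setP; split; first by rewrite inE Wb1.
    by move=> x y; rewrite !inE => hx hy; apply: (WbM hy hx).
  suff h : young l \subset [set u | Wb (prow l) u] by move/(subsetP h); rewrite inE.
  rewrite (gen_subG _ (Group hg)); apply/subsetP => s; rewrite !inE.
  move=> /existsP[i /existsP[j /and3P[hij /eqP -> hn]]].
  by apply: Wb_tperm; apply/eqP; rewrite -(adj_row l hij).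
move: u; apply: Wb_ind => [||u i j hu hij e hl IH]; first exact: row_mono.
  exact: group1.
apply: groupM => //; apply: mem_gen; rewrite inE; apply/existsP; exists i; apply/existsP; exists j.
by rewrite [X in X && _]hij eqxx (adj_row l hij) e eqxx.
Qed.

Lemma inXE l x : inX l x = binc (prow l) x.
Proof.
apply/idP/idP => [/forallP h|h].
  apply/bincP => i j hij e; rewrite (perm_ltNge x (adj_neq hij)).
  apply/negP => hlt; have := h (tperm i j); rewrite youngE Wb_tperm //=.
  by have := len_mulr_dn hij hlt; lia.
apply/forallP => u; apply/implyP; rewrite youngE => hu.
by rewrite (len_binc_add (@row_mono l) h hu) leq_addr.
Qed.

Lemma wlongP l : longest (prow l) (wlong l).
Proof.
rewrite /wlong; case: arg_maxnP => [|u hu hm]; first exact: group1.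
by split=> [|x hx]; [rewrite -youngE | apply: hm; rewrite youngE].
Qed.

Lemma PlamE l : Plam l = Pb (prow l) vK.
Proof. by apply: eq_bigl => u; rewrite youngE. Qed.

Lemma card_ord_lt k : (k <= n)%N -> #|[set p : 'I_n | (p < k)%N]| = k.
Proof.
move=> hk; rewrite -sum1_card (eq_bigl (fun p : 'I_n => p < k)%N); last by move=> p; rewrite inE.
by rewrite (big_ord_narrow hk) /= sum1_card card_ord.
Qed.

Lemma card_row_lt l i : #|[set p | (prow l p < i)%N]| = partsum l i.
Proof.
rewrite -[RHS](card_ord_lt (partsum_le l i)); congr #|pred_of_set _|.
by apply/setP => p; rewrite !inE row_lt.
Qed.

Lemma card_row l i : #|[set p | prow l p == i]| = lam l i.
Proof.
have := card_row_lt l i.+1; rewrite partsumS -(card_row_lt l i) => h.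
suff : #|[set p | (prow l p < i.+1)%N]| =
  (#|[set p | (prow l p < i)%N]| + #|[set p | prow l p == i]|)%N by lia.
rewrite -cardsUI (_ : _ :&: _ = set0) ?cards0 ?addn0.
  by congr #|pred_of_set _|; apply/setP => p; rewrite !inE ltnS leq_eqVlt orbC.
by apply/setP => p; rewrite !inE; case: ltngtP.
Qed.

Lemma domle_refl l : domle l l. Proof. by apply/forallP. Qed.
Lemma domleP l m : reflect (forall i, partsum l i <= partsum m i)%N (domle l m).
Proof.
apply: (iffP forallP) => h i; last exact: h.
case: (ltnP i n.+1) => hi; first exact: (h (Ordinal hi)).
by rewrite !partsum_ge // ltnW.
Qed.
Lemma domle_trans l m k : domle l m -> domle m k -> domle l k.
Proof. by move=> /domleP h1 /domleP h2; apply/domleP => i; apply: leq_trans (h1 i) (h2 i). Qed.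
Lemma partsum_inj l m : (forall i, partsum l i = partsum m i) -> l = m.
Proof.
move=> h; apply/val_inj/eq_from_tnth => i; apply/val_inj; rewrite /= -!lamE.
by have := h i.+1; rewrite !partsumS h => /addnI.
Qed.
Lemma domle_anti l m : domle l m -> domle m l -> l = m.
Proof.
move=> /domleP h1 /domleP h2; apply: partsum_inj => i.
by apply/eqP; rewrite eqn_leq h1 h2.
Qed.
Lemma sdomlt_trans l m k : sdomlt l m -> sdomlt m k -> sdomlt l k.
Proof.
move=> /andP[h1 n1] /andP[h2 n2]; apply/andP; split; first exact: domle_trans h1 h2.
by apply: contra n1 => /eqP e; rewrite (domle_anti h1) // e.
Qed.
Lemma sdomlt_domle l m : sdomlt l m -> domle l m. Proof. by case/andP. Qed.

Lemma dom_ind (P : part n -> Prop) :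
  (forall l, (forall m, sdomlt l m -> P m) -> P l) -> forall l, P l.
Proof.
move=> h l; elim: {l}#|[set m | sdomlt l m]| {-2}l (leqnn #|[set m | sdomlt l m]|) => [|k IH] l hl.
  apply: h => m hm; move: hl; rewrite leqn0 cards_eq0 => /eqP/setP /(_ m).
  by rewrite !inE hm.
apply: h => m hm; apply: IH; rewrite -ltnS; apply: leq_trans hl; apply: proper_card.
apply/properP; split; first by apply/subsetP => x; rewrite !inE; exact: sdomlt_trans.
by exists m; rewrite inE // /sdomlt eqxx andbF.
Qed.

Lemma card_samerow l : #|[set p : 'I_n * 'I_n | prow l p.1 == prow l p.2]| =
  (\sum_(i < n) lam l i ^ 2)%N.
Proof.
rewrite -sum1_card (eq_bigl (fun p : 'I_n * 'I_n => true && (prow l p.1 == prow l p.2))).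
  rewrite -(pair_big_dep xpredT (fun p q => prow l p == prow l q) (fun _ _ => 1%N)) /=.
  rewrite (eq_bigr (fun p => lam l (prow l p))) => [|p _]; last first.
    rewrite -card_row -sum1_card; apply: eq_bigl => q; by rewrite in_set eq_sym.
  have hr p : (prow l p < n)%N by case: (row_spec l p).
  rewrite (partition_big (fun p => Ordinal (hr p)) xpredT) //=; apply: eq_bigr => i _.
  rewrite (eq_bigr (fun _ => lam l i)) => [|p /eqP <- //].
  rewrite sum_nat_const -mulnn; congr muln; rewrite -(card_row l i) cardsE.
  by apply: eq_card => p.
by move=> p; rewrite inE.
Qed.

(** Ordered pairs in a common row consist of the diagonal and two mirror copies of the increasing
    pairs. *)
Lemma Nb_sum l : (2 * Nb (prow l) + n = \sum_(i < n) lam l i ^ 2)%N.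
Proof.
rewrite -card_samerow /Nb.
pose A := [set p : 'I_n * 'I_n | (p.1 < p.2)%N && (prow l p.1 == prow l p.2)].
pose sw (p : 'I_n * 'I_n) := (p.2, p.1).
have swI : injective sw by move=> [? ?] [? ?] [-> ->].
pose D := [set (p, p) | p : 'I_n].
have hD : #|D| = n by rewrite card_imset ?card_ord // => p q [].
have -> : [set p : 'I_n * 'I_n | prow l p.1 == prow l p.2] = A :|: (sw @: A) :|: D.
  apply/setP => -[p q]; rewrite !inE /=.
  have -> : ((p, q) \in sw @: A) = ((q < p)%N && (prow l q == prow l p)).
    by rewrite (_ : (p, q) = sw (q, p)) // (mem_imset _ _ swI) inE.
  have -> : ((p, q) \in D) = (p == q).
    by apply/imsetP/eqP => [[r _ [-> ->]]|->] //; exists q.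
  rewrite (eq_sym (prow l q)) -(inj_eq val_inj) /=.
  by case: (ltngtP p q) => [h|h|/val_inj->]; rewrite ?eqxx ?orbT ?orbF.
have d1 : A :&: (sw @: A) = set0.
  apply/setP => -[p q]; rewrite !inE /=; rewrite (_ : (p, q) = sw (q, p)) // (mem_imset _ _ swI) inE /=.
  by case: ltngtP; rewrite ?andbF.
have d2 : (A :|: sw @: A) :&: D = set0.
  apply/setP => x; rewrite !inE; apply/negP => /andP[+ /imsetP[p _ ex]].
  rewrite ex (_ : (p, p) = sw (p, p)) // (mem_imset _ _ swI) !inE /=.
  by rewrite ltnn.
have := cardsUI (A :|: sw @: A) D; rewrite d2 cards0 addn0 hD => ->; congr addn.
have := cardsUI A (sw @: A); rewrite d1 cards0 addn0 card_imset // => ->.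
by rewrite mul2n addnn.
Qed.
End Partitions.

(** * Dominance order and the Gale-Ryser condition *)

Section Dominance.
Variable n : nat.
Local Infix "**" := (@wmul n) (at level 40, left associativity).
Implicit Types (l m : part n) (u x w : 'S_n).

(** Summation by parts for the sum of [l_i (m_i - l_i)], with boundary term [l_k] times the
    difference of the partial sums. Negative terms are moved across to stay within the natural
    numbers; the boundary vanishes at [k = n]. *)
Lemma abel_dom l m k : domle l m ->
  (\sum_(i < k) lam l i * lam l i + lam l k * partsum m k <=
   \sum_(i < k) lam l i * lam m i + lam l k * partsum l k)%N.
Proof.
move=> /domleP h; elim: k => [|k IH]; first by rewrite !big_ord0 !partsum0.
have hk1 := h k.+1; rewrite !partsumS in hk1; have ha := lam_anti l (leqnSn k).
rewrite !big_ord_recr /= !partsumS.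
set D := (partsum m k + lam m k - (partsum l k + lam l k))%N.
have e : (partsum m k + lam m k = partsum l k + lam l k + D)%N by rewrite subnKC.
have e1 : (lam l k * (partsum m k + lam m k) = lam l k * (partsum l k + lam l k + D))%N by rewrite e.
have e2 : (lam l k.+1 * D <= lam l k * D)%N by rewrite leq_mul2r ha orbT.
rewrite e mulnDr; rewrite !mulnDr in e1; clearbody D; move: IH e1 e2; clear.
move: (bigop _ _ _) (bigop _ _ _) (_ * D)%N (_ * D)%N (_ * partsum m k)%N (_ * lam m k)%N.
move: (_ * partsum l k)%N (_ * lam l k)%N (lam l k.+1 * _)%N; lia.
Qed.

(** For the scalar product of the sequences of parts, [l.l <= l.m] by [abel_dom], while
    [2 l.m < l.l + m.m] when the partitions differ. So the function [a] increases strictly along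
    dominance. *)
Lemma Nb_strict l m : sdomlt l m -> (Nb (prow l) < Nb (prow m))%N.
Proof.
case/andP=> h hne; suff : (\sum_(i < n) lam l i ^ 2 < \sum_(i < n) lam m i ^ 2)%N.
  by rewrite -!Nb_sum; lia.
have h1 := abel_dom n h; rewrite lam_ge // !mul0n !addn0 in h1.
have h2 := @leqif_sum 'I_n xpredT (fun i => lam l i == lam m i)
  (fun i => 2 * (lam l i * lam m i))%N (fun i => lam l i ^ 2 + lam m i ^ 2)%N
  (fun i _ => nat_Cauchy (lam l i) (lam m i)).
have h3 : ~~ [forall (i : 'I_n | true), lam l i == lam m i].
  apply: contra hne => /forall_inP hh; apply/eqP/partsum_inj; elim=> [|i IH].
    by rewrite !partsum0.
  rewrite !partsumS IH; congr addn; case: (ltnP i n) => hi; last by rewrite !lam_ge.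
  by apply/eqP/(hh (Ordinal hi)).
have h4 : (2 * (\sum_(i < n) lam l i * lam m i) <
    \sum_(i < n) lam l i ^ 2 + \sum_(i < n) lam m i ^ 2)%N.
  by rewrite big_distrr -big_split /= (ltn_leqif h2).
have e : (\sum_(i < n) lam l i * lam l i = \sum_(i < n) lam l i ^ 2)%N.
  by apply: eq_bigr => i _; rewrite mulnn.
rewrite e in h1; move: h1 h4; clear.
move: (bigop _ _ _) (bigop _ _ _) (bigop _ _ _); lia.
Qed.

(** The partition with all parts 1. Its antisymmetrizer is 1, which turns statements about [e_ l]
    into statements about the whole algebra. *)
Lemma ones_ex : exists l : part n, forall u, Wb (prow l) u -> u = 1%g.
Proof.
have hp : is_part [tuple of nseq n (inord 1 : 'I_n.+1)].
  have ht (i : 'I_n) : tnth [tuple of nseq n (inord 1 : 'I_n.+1)] i = 1%N :> nat.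
    rewrite (tnth_nth ord0) /= nth_nseq ltn_ord inordK //.
    by rewrite ltnS; apply: leq_ltn_trans (ltn_ord i).
  apply/andP; split.
    by rewrite (eq_bigr (fun _ => 1%N)) => [|i _]; rewrite ?ht // sum1_card card_ord.
  by apply/forallP => i; apply/forallP => j; rewrite !ht leqnn implybT.
pose l : part n := exist (fun t : n.-tuple 'I_n.+1 => is_part t) _ hp.
exists l => u /WbP hu.
have hl k : (k < n)%N -> lam l k = 1%N.
  move=> hk; rewrite (lamE l (Ordinal hk)) (tnth_nth ord0) /= nth_nseq hk inordK //; lia.
have hs k : (k <= n)%N -> partsum l k = k.
  by elim: k => [|k IH] hk; rewrite ?partsum0 // partsumS IH ?hl ?addn1 // ltnW.
have hr p : prow l p = p.
  by apply: row_uniq; rewrite hs // ltnW // ltn_ord.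
by apply/permP => p; rewrite perm1; apply/val_inj => /=; rewrite -!hr hu.
Qed.

(* [kk l] is the block function of the conjugate partition: the columns of the cells of [l],
   sorted. *)
Definition kseq l : seq nat := sort leq [seq pcol l p | p <- enum 'I_n].
Definition kk l (i : 'I_n) : nat := nth 0%N (kseq l) i.

Lemma size_kseq l : size (kseq l) = n.
Proof. by rewrite size_sort size_map size_enum_ord. Qed.

Lemma kk_mono l (i j : 'I_n) : (i <= j)%N -> (kk l i <= kk l j)%N.
Proof.
move=> h; have hs : sorted leq (kseq l) by apply: sort_sorted; exact: leq_total.
by apply: (sorted_leq_nth leq_trans leqnn) => //; rewrite inE size_kseq.
Qed.

Lemma kk_perm l : exists w, forall p, kk l (w p) = pcol l p.
Proof.
have hp : perm_eq [tuple pcol l p | p < n] [tuple kk l p | p < n].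
  have -> : tval [tuple kk l p | p < n] = kseq l.
    apply: (@eq_from_nth _ 0%N); first by rewrite size_tuple size_kseq.
    move=> i; rewrite size_tuple => hi; rewrite (nth_map (Ordinal hi)) ?size_enum_ord //.
    by rewrite /kk nth_enum_ord.
  by rewrite perm_sym /kseq perm_sort.
have [w hw] := tuple_permP hp; exists w => p.
have := congr1 (fun s => nth 0%N s p) hw.
by rewrite /= !nth_mktuple tnth_mktuple => ->.
Qed.

Definition mcol l c : nat := #|[set p : 'I_n | pcol l p == c]|.

Lemma card_kk l c : #|[set p : 'I_n | kk l p == c]| = mcol l c.
Proof.
have [w hw] := kk_perm l; rewrite /mcol -[RHS](card_imset _ (@perm_inj _ w)).
congr #|pred_of_set _|; apply/setP => q; rewrite inE -[q](permKV w).
by rewrite (mem_imset _ _ (@perm_inj _ w)) inE hw.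
Qed.

Lemma min_mcol l i c : (minn i (mcol l c) <= #|[set p : 'I_n | (prow l p < i) && (pcol l p == c)]|)%N.
Proof.
case: i => [|i]; first by rewrite min0n.
case: (ltnP c (lam l i)) => hc.
  apply: leq_trans (geq_minl _ _) _.
  have /fin_all_exists[f hf] : forall k : 'I_i.+1, exists p : 'I_n, prow l p = k /\ pcol l p = c.
    move=> k; have hk : (c < lam l k)%N by apply: leq_trans hc (lam_anti _ _); rewrite -ltnS.
    by have [p [_ e1 e2]] := cell_ex hk; exists p.
  have fi : injective f.
    by move=> k k' e; apply/val_inj => /=; rewrite -(proj1 (hf k)) -(proj1 (hf k')) e.
  rewrite -[X in (X <= _)%N](card_ord i.+1) -(card_imset _ fi).
  apply: subset_leq_card; apply/subsetP => p /imsetP[k _ ->].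
  by rewrite inE (proj1 (hf k)) (proj2 (hf k)) ltn_ord eqxx.
apply: leq_trans (geq_minr _ _) _; apply: subset_leq_card; apply/subsetP => p.
rewrite !inE => /eqP e; rewrite e eqxx andbT ltnNge; apply/negP => hlt.
have := col_lt l p; rewrite e; have := lam_anti l (ltnW hlt); lia.
Qed.

Lemma sum_rowcol l i : (\sum_(c < n) #|[set p : 'I_n | (prow l p < i) && (pcol l p == c)]| = partsum l i)%N.
Proof.
rewrite -card_row_lt -[RHS]sum1_card.
have hc (p : 'I_n) : (pcol l p < n)%N by apply: leq_ltn_trans (leq_subr _ _) (ltn_ord p).
rewrite [RHS](partition_big (fun p => Ordinal (hc p)) xpredT) //=; apply: eq_bigr => c _.
by rewrite -sum1_card; apply: eq_bigl => p; rewrite !inE; congr andb.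
Qed.

Lemma kk_lt l p : (kk l p < n)%N.
Proof.
have [w hw] := kk_perm l; rewrite -[p](permKV w) hw.
by apply: leq_ltn_trans (leq_subr _ _) (ltn_ord _).
Qed.

(* Pigeonhole behind the Gale-Ryser condition: each of the columns [c] meets [S] at most
   [min i (mcol l c)] times. *)
Lemma good_card l (b : 'I_n -> nat) w (S : {set 'I_n}) (B : seq nat) :
  good b (kk l) w -> {in S, forall p, b p \in B} -> (#|S| <= partsum l (size B))%N.
Proof.
move=> hg hB; rewrite -sum_rowcol -sum1_card.
rewrite (partition_big (fun p => Ordinal (kk_lt l (w p))) xpredT) //=.
apply: leq_sum => c _; apply: leq_trans (min_mcol _ _ _).
pose A := [set p in S | kk l (w p) == c].
have -> : (\sum_(p in S | Ordinal (kk_lt l (w p)) == c) 1 = #|A|)%N.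
  by rewrite -[RHS]sum1_card; apply: eq_bigl => p; rewrite !inE.
rewrite leq_min; apply/andP; split.
  have hu : uniq [seq b p | p <- enum A].
    rewrite map_inj_in_uniq ?enum_uniq // => p q; rewrite !mem_enum !inE.
    by move=> /andP[_ /eqP hp] /andP[_ /eqP hq] e; apply: (hg _ _ e); rewrite hp hq.
  rewrite cardE -(size_map b); apply: uniq_leq_size => // i /mapP[p].
  by rewrite mem_enum inE => /andP[hp _] ->; apply: hB.
rewrite -card_kk -(card_imset _ (@perm_inj _ w)); apply: subset_leq_card.
apply/subsetP => q /imsetP[p]; rewrite !inE => /andP[_ /eqP hp] ->.
by rewrite hp.
Qed.

(** Along a row the images lie in strictly increasing column blocks, so a cell of column [c] lands
    in a block at least [c]. Both sides have the same sum over all cells, which forces equality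
    everywhere. *)
Lemma good_min_kk l w : binc (prow l) w -> good (prow l) (kk l) w -> forall p, kk l (w p) = pcol l p.
Proof.
move=> hw hg.
have hle p : (pcol l p <= kk l (w p))%N.
  elim: {p}(pcol l p) {-2}p (erefl (pcol l p)) => [|c IH] p hc; first by rewrite hc.
  have hc' : (c < lam l (prow l p))%N by have := col_lt l p; lia.
  have [q [_ eq1 eq2]] := cell_ex hc'.
  have hpq : (q < p)%N by rewrite (rowcol l q) (rowcol l p) eq1 eq2 hc; lia.
  have hq := IH q eq2; rewrite eq2 in hq; rewrite hc; apply: leq_ltn_trans hq _.
  rewrite ltn_neqAle kk_mono; last first.
    by apply/ltnW/(binc_lt (@row_mono _ l) hw).
  rewrite andbT; apply/eqP => e.
  by have e2 := hg _ _ eq1 e; rewrite e2 ltnn in hpq.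
have hs : (\sum_p kk l (w p) = \sum_p pcol l p)%N.
  have [w0 hw0] := kk_perm l.
  have hr (w1 : 'S_n) : (\sum_p kk l (w1 p) = \sum_p kk l p)%N.
    by rewrite [RHS](reindex_inj (@perm_inj _ w1)).
  by rewrite hr -(hr w0); apply: eq_bigr.
move=> p; apply/esym/eqP; move: (hle p); rewrite leq_eqVlt => /orP[//|hlt].
have : (\sum_p pcol l p < \sum_p kk l (w p))%N.
  rewrite (bigD1 p) //= [X in (_ < X)%N](bigD1 p) //=.
  by apply: leq_trans (_ : _ <= kk l (w p) + \sum_(i | i != p) pcol l i)%N _;
    rewrite ?ltn_add2r // leq_add2l; apply: leq_sum.
by rewrite hs ltnn.
Qed.

Lemma good_min_uniq l w w' : binc (prow l) w -> binc (kk l) w^-1%g -> good (prow l) (kk l) w ->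
  binc (prow l) w' -> binc (kk l) w'^-1%g -> good (prow l) (kk l) w' -> w = w'.
Proof.
move=> h1 h2 h3 h1' h2' h3'.
have e := good_min_kk h1 h3; have e' := good_min_kk h1' h3'.
have hmono := @kk_mono l.
have hW : Wb (kk l) (w' ** w^-1%g).
  by apply/WbP => a; rewrite wmulE e' -e permKV.
suff : w' ** w^-1%g = 1%g.
  by move=> /(congr1 (fun x => x ** w)); rewrite wmulVr w1mul.
apply: (binc_Wb1 hmono) => //; apply/bincP => i j hij ekk; rewrite !wmulE.
have hlt : (w^-1%g i < w^-1%g j)%N by apply: (binc_lt hmono h2) => //; move/eqP: hij => /= ->.
rewrite ltnNge; apply/negP; rewrite leq_eqVlt val_eqE (inj_eq perm_inj) (inj_eq perm_inj).
rewrite eq_sym (negbTE (adj_neq hij)) /= => hgt.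
have := binc_lt hmono h2' _ hgt; rewrite !permK !e' -!e !permKV ekk => /(_ erefl); lia.
Qed.

Section Sandwich.
Local Open Scope ring_scope.
Local Notation E l := (eb (kk l) vK).
Local Notation C b := (eb b (- vK^-1)).

Lemma E_C_card l (b : 'I_n -> nat) w (S : {set 'I_n}) (B : seq nat) :
  (forall i j : 'I_n, (i <= j)%N -> (b i <= b j)%N) ->
  E l * T w * C b != 0 -> {in S, forall p, b p \in B} -> (#|S| <= partsum l (size B))%N.
Proof.
move=> hb hne; have [e|[w' [c [_ _ _ hg]]]] := sandwich hb (@kk_mono l) w.
  by rewrite e eqxx in hne.
exact: good_card hg.
Qed.

Lemma E_C_dom l m w : E l * T w * C (prow m) != 0 -> domle m l.
Proof.
move=> hne; apply/domleP => i; rewrite -(card_row_lt m i) -[X in partsum l X](size_iota 0 i).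
by apply: (E_C_card (@row_mono _ m) hne) => p; rewrite inE mem_iota.
Qed.

Lemma E_C_neq0 l : exists w, E l * T w * C (prow l) != 0.
Proof.
have [w hw] := kk_perm l; exists w; apply: sandwich_neq0 => p q e1.
by rewrite !hw => e2; apply: (cell_inj e1 e2).
Qed.

(** When the blocks are the rows of [l] itself, [good_min_uniq] leaves a single good minimal double
    coset representative. This multiplicity one gives absolute irreducibility in [commutant] and the
    rank of [e_ l] in [tr_eh]. *)
Lemma E_C_line l : exists B, B != 0 /\ forall h, exists c : K, E l * h * C (prow l) = c *: B.
Proof.
have hw := sandwich (@row_mono _ l) (@kk_mono l).
have [w0 hw0] := E_C_neq0 l.
have [e|[w1 [c1 [e1 a1 b1 g1]]]] := hw w0; first by rewrite e eqxx in hw0.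
exists (E l * T w1 * C (prow l)); split.
  by apply: contra_neq hw0 => e; rewrite e1 e scaler0.
have hT w : exists c : K, E l * T w * C (prow l) = c *: (E l * T w1 * C (prow l)).
  have [e|[w2 [c2 [e2 a2 b2 g2]]]] := hw w; first by exists 0; rewrite e scale0r.
  by exists c2; rewrite e2 (good_min_uniq a2 b2 g2 a1 b1 g1).
move=> h; elim/T_ind_lin: h => [|h g [c ec] [c' ec']|a w].
- by exists 0; rewrite mulr0 mul0r scale0r.
- by exists (c + c'); rewrite mulrDr mulrDl ec ec' scalerDl.
by have [c ec] := hT w; exists (a * c); rewrite -scalerAr -scalerAl ec scalerA.
Qed.
End Sandwich.
End Dominance.

Local Open Scope ring_scope.

(** * The Kazhdan-Lusztig basis *)

Section VZ.
Definition inZv (a : K) := exists p : {poly int}, a = evZ p vK.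

Lemma inZv_vZv a : in_vZv a -> inZv a. Proof. by move=> [p [_ ->]]; exists p. Qed.
Lemma inZv_inA a : inZv a -> inA a. Proof. by move=> [p ->]; exact: inA_evZ. Qed.
Lemma inZv_int (z : int) : inZv z%:~R. Proof. by exists z%:P; rewrite evZC. Qed.
Lemma inZvD a b : inZv a -> inZv b -> inZv (a + b).
Proof. by move=> [p ->] [q ->]; exists (p + q); rewrite evZD. Qed.
Lemma inZv_loc a : inZv a -> exists c, locTerm 0 a c.
Proof. by move=> [p ->]; exists (p`_0)%:~R; exact: loc_evZ. Qed.

Lemma vZvD a b : in_vZv a -> in_vZv b -> in_vZv (a + b).
Proof. by move=> [p [p0 ->]] [q [q0 ->]]; exists (p + q); rewrite coefD p0 q0 evZD addr0. Qed.
Lemma vZvN a : in_vZv a -> in_vZv (- a).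
Proof. by move=> [p [p0 ->]]; exists (- p); rewrite coefN p0 evZN oppr0. Qed.
Lemma vZvB a b : in_vZv a -> in_vZv b -> in_vZv (a - b).
Proof. by move=> ha hb; apply: vZvD => //; apply: vZvN. Qed.
Lemma vZv0 : in_vZv 0. Proof. by exists 0; rewrite coef0 evZ0. Qed.
Lemma vZv_mulr a b : inZv a -> in_vZv b -> in_vZv (a * b).
Proof. by move=> [p ->] [q [q0 ->]]; exists (p * q); rewrite coef0M q0 mulr0 evZM. Qed.
Lemma vZv_v : in_vZv vK. Proof. by exists 'X; rewrite coefX evZX. Qed.
Lemma vZv_sum (I : Type) (r : seq I) (P : pred I) f :
  (forall i, P i -> in_vZv (f i)) -> in_vZv (\sum_(i <- r | P i) f i).
Proof.
move=> h; apply: (big_rec in_vZv); first exact: vZv0.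
by move=> i x /h; apply: vZvD.
Qed.
Lemma vZv_loc a : in_vZv a -> locTerm 0 a 0.
Proof. by move=> [p [p0 ->]]; have := loc_evZ p; rewrite p0. Qed.
Lemma vZv_bar a : in_vZv a -> bar a = a -> a = 0.
Proof. by move=> [p [p0 ->]] /bar_inv_const ->; rewrite p0. Qed.
Lemma bar_int (z : int) : bar z%:~R = z%:~R.
Proof. exact: rmorph_int. Qed.
Lemma vZv_divv a : in_vZv a -> exists z : int, in_vZv (vK^-1 * a - z%:~R).
Proof.
move=> [p [p0 ->]]; pose q := \poly_(i < (size p).-1) p`_i.+1.
have ep : p = q * 'X.
  apply/polyP => i; rewrite coefMX; case: i => [|i] //=.
  rewrite coef_poly; case: ltnP => // h.
  by apply: nth_default; apply: leq_trans (leqSpred _) _.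
exists q`_0, (q - (q`_0)%:P); rewrite coefB coefC eqxx subrr; split=> //.
by rewrite ep evZM evZX evZD evZN evZC mulrCA mulVf ?mulr1 ?vK_neq0.
Qed.
End VZ.

Section ASpan.
Variable n : nat.
Local Notation H := (heck n).

Definition Aspn (I : finType) (P : I -> Prop) (f : I -> H) (h : H) : Prop :=
  exists a : I -> K, (forall i, inA (a i)) /\ (forall i, ~ P i -> a i = 0) /\
    h = \sum_i a i *: f i.

Lemma Aspan_Aspn (I : finType) (P : I -> Prop) (f : I -> hecke n) (h : hecke n) :
  Aspan P f h <-> Aspn P (f : I -> H) h.
Proof.
have e (a : I -> K) : \sum_i hscale (a i) (f i) = \sum_i a i *: (f i : H) :> {ffun _ -> _}.
  apply/ffunP => y; rewrite sum_ffunE; have := hE_sum (index_enum I) xpredT (fun i => a i *: (f i : H)) y.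
  by move=> ->; apply: eq_bigr => i _; rewrite hscaleE.
by split=> -[a [h1 [h2 h3]]]; exists a; split=> //; split=> //; rewrite h3 e.
Qed.

Variables (I : finType) (P : I -> Prop) (f : I -> H).
Lemma Aspn0 : Aspn P f 0.
Proof.
exists (fun _ => 0); split; first by move=> _; exact: inA0.
by split=> //; rewrite big1 // => i _; rewrite scale0r.
Qed.
Lemma AspnD h g : Aspn P f h -> Aspn P f g -> Aspn P f (h + g).
Proof.
move=> [a [a1 [a2 ->]]] [b [b1 [b2 ->]]]; exists (fun i => a i + b i); split.
  by move=> i; apply: inAD.
split; first by move=> i hi; rewrite a2 // b2 // addr0.
by rewrite -big_split; apply: eq_bigr => i _; rewrite scalerDl.
Qed.
Lemma AspnZ c h : inA c -> Aspn P f h -> Aspn P f (c *: h).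
Proof.
move=> hc [a [a1 [a2 ->]]]; exists (fun i => c * a i); split.
  by move=> i; apply: inAM.
split; first by move=> i hi; rewrite a2 // mulr0.
by rewrite scaler_sumr; apply: eq_bigr => i _; rewrite scalerA.
Qed.
Lemma AspnN h : Aspn P f h -> Aspn P f (- h).
Proof. by move=> hh; rewrite -scaleN1r; apply: AspnZ => //; apply/inAN/inA1. Qed.
Lemma AspnB h g : Aspn P f h -> Aspn P f g -> Aspn P f (h - g).
Proof. by move=> hh hg; apply: AspnD => //; apply: AspnN. Qed.
Lemma Aspn_mem i : P i -> Aspn P f (f i).
Proof.
move=> hi; exists (fun j => (j == i)%:R); split; first by move=> j; exact: inA_nat.
split; first by move=> j hj; case: eqP => // e; case: hj; rewrite e.
rewrite (bigD1 i) //= eqxx scale1r big1 ?addr0 // => j /negbTE ->.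
by rewrite scale0r.
Qed.
Lemma Aspn_sum (J : Type) (r : seq J) (Q : pred J) (g : J -> H) :
  (forall j, Q j -> Aspn P f (g j)) -> Aspn P f (\sum_(j <- r | Q j) g j).
Proof.
move=> h; apply: (big_rec (Aspn P f)); first exact: Aspn0.
by move=> j x /h; apply: AspnD.
Qed.
End ASpan.

(** [P] is a bare proposition, so membership of an index with nonzero coefficient is recovered
    classically from the vanishing of coefficients outside [P]. *)
Lemma Aspn_trans n (I J : finType) (P : I -> Prop) (Q : J -> Prop) f g (h : heck n) :
  (forall i, P i -> Aspn Q g (f i)) -> Aspn P f h -> Aspn Q g h.
Proof.
move=> hh [a [a1 [a2 ->]]]; apply: Aspn_sum => i _.
case: (eqVneq (a i) 0) => [->|hne]; first by rewrite scale0r; exact: Aspn0.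
apply: AspnZ => //; apply: hh; apply: Classical_Prop.NNPP => hP.
by rewrite a2 ?eqxx in hne.
Qed.

Section KL.
Variable n : nat.
Local Notation W := 'S_n.
Local Notation H := (heck n).
Local Notation T := (@T n).
Local Infix "**" := (@wmul n) (at level 40, left associativity).
Implicit Types (w x y z s t u : 'S_n) (h g : heck n).

(** By [hbarT_supp] no other point of the support contributes at a point of maximal length, so bar
    acts there on the coefficient alone. *)
Lemma hbar_top h y : hbar h = h -> (forall z, h z != 0 -> (len z <= len y)%N) -> bar (h y) = h y.
Proof.
move=> hb hy; rewrite -{2}hb hbarE hE_sum (bigD1 y) //= big1 => [|z hz]; rewrite hE_scale -hbarT.
  by rewrite (proj2 (hbarT_supp y)) mulr1 addr0.
case: (eqVneq (h z) 0) => [->|h0]; first by rewrite bar0 mul0r.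
case: (eqVneq (hbar (T z) y) 0) => [->|h1]; first by rewrite mulr0.
have [e|hlt] := proj1 (hbarT_supp z) y h1; first by rewrite e eqxx in hz.
by have := hy z h0; lia.
Qed.

Lemma max_supp h : h != 0 -> exists y, h y != 0 /\ (forall z, h z != 0 -> (len z <= len y)%N).
Proof.
move=> h0; have [y0 hy0] : exists y0, h y0 != 0.
  apply/existsP; apply: contraNT h0 => hn; apply/eqP/heckP => y; rewrite hE_zero.
  by apply/eqP; apply: contraNT hn => hne; apply/existsP; exists y.
have [y hy hm] := @arg_maxnP _ y0 (fun y => h y != 0) (fun y => len y) hy0.
by exists y.
Qed.

Lemma kl_uniq h : hbar h = h -> (forall y, in_vZv (h y)) -> h = 0.
Proof.
move=> hb hv; apply/eqP; apply: Classical_Prop.NNPP => /negP h0.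
have [y [hy hm]] := max_supp h0; case/eqP: hy.
by apply: vZv_bar => //; apply: hbar_top.
Qed.

Lemma hbarN h : hbar (- h) = - hbar h.
Proof. by rewrite -scaleN1r hbarZ barN bar1 scaleN1r. Qed.
Lemma hbarB h g : hbar (h - g) = hbar h - hbar g.
Proof. by rewrite hbarD hbarN. Qed.

Lemma star_Tinv w : star (Tinv w) = Tinv w^-1%g.
Proof.
by apply: Tinv_uniq; rewrite -starT -starM (proj1 (TinvP w)) star1.
Qed.

Lemma hbar_star h : hbar (star h) = star (hbar h).
Proof.
rewrite (heck_sum h) hbar_sum !linear_sum hbar_sum; apply: eq_bigr => y _.
by rewrite linearZ /= !hbarZ linearZ /= starT !hbarT star_Tinv.
Qed.

Variable C : W -> hecke n.
Hypothesis HC : isKL C.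
Definition CC w : H := C w.

Lemma CC_vZv w y : in_vZv (CC w y - (y == w)%:R). Proof. by case: (HC w). Qed.

Lemma hbarC w : hbar (CC w) = CC w.
Proof.
have [_ /(_ (fun y => Tinv y))] := HC w; case=> [y|b [hb e]].
  by rewrite !hmulE TbE honeE; have [-> ->] := TinvP y.
rewrite hbarE {2}/CC e; apply: heckP => y; rewrite hE_sum sum_ffunE.
by apply: eq_bigr => z _; rewrite hscaleE (barRelE (hb z)).
Qed.

Lemma CC_Zv w y : inZv (CC w y).
Proof.
have -> : CC w y = (CC w y - (y == w)%:R) + (y == w)%:R by rewrite subrK.
by apply: inZvD; [apply: inZv_vZv; exact: CC_vZv | exact: (inZv_int (y == w))].
Qed.

Lemma CC_neq w y : y != w -> in_vZv (CC w y).
Proof. by move=> /negbTE h; have := CC_vZv w y; rewrite h subr0. Qed.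

Lemma CC_w_neq0 w : CC w w != 0.
Proof.
have := vZv_loc (CC_vZv w w); rewrite eqxx => h.
apply: (@loc_neq0 0 _ 1); first exact: oner_neq0.
by have := locD h (loc1 0); rewrite subrK add0r.
Qed.

(** At a support point of maximal length the coefficient is bar-invariant; away from [w] it also
    lies in [v Z[v]] and hence vanishes. So [w] is the only such point. *)
Lemma CC_supp w : (forall y, CC w y != 0 -> y = w \/ (len y < len w)%N) /\ CC w w = 1.
Proof.
have hmax y : CC w y != 0 -> (forall z, CC w z != 0 -> (len z <= len y)%N) -> y = w.
  move=> hy hm; apply/eqP; apply: contraNT hy => /CC_neq hv; apply/eqP.
  by apply: vZv_bar => //; apply: hbar_top => //; exact: hbarC.
have [|y [hy hm]] := @max_supp (CC w).
  by apply/eqP => e; have := CC_w_neq0 w; rewrite e hE_zero eqxx.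
have ey := hmax y hy hm; rewrite ey in hm; split.
  move=> z hz; have := hm z hz; rewrite leq_eqVlt => /orP[/eqP e|]; last by right.
  by left; apply: hmax => // z' hz'; rewrite e; apply: hm.
have hb := hbar_top (hbarC w) hm.
apply/eqP; rewrite -subr_eq0; apply/eqP; apply: vZv_bar.
  by have := CC_vZv w w; rewrite eqxx.
by rewrite barB bar1 hb.
Qed.

Lemma T_in_C w : Aspn (fun _ => True) CC (T w).
Proof.
elim: {w}(len w).+1 {-2}w (ltnSn (len w)) => [|m IH] w hm; first by [].
have -> : T w = CC w - \sum_(y | y != w) CC w y *: T y.
  rewrite {1}(heck_sum (CC w)) (bigD1 w) //= (proj2 (CC_supp w)) scale1r.
  by rewrite addrK.
apply: AspnB; first exact: Aspn_mem.
apply: Aspn_sum => y hy.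
case: (eqVneq (CC w y) 0) => [->|h0]; first by rewrite scale0r; exact: Aspn0.
apply: AspnZ; first exact: inZv_inA (CC_Zv w y).
have [e|hlt] := proj1 (CC_supp w) y h0; first by rewrite e eqxx in hy.
by apply: IH; rewrite -ltnS; apply: leq_trans hlt _; rewrite -ltnS.
Qed.

Definition inH h := forall y, inA (h y).

Lemma inH_C h : inH h -> exists a : W -> K, (forall w, inA (a w)) /\ h = \sum_w a w *: CC w.
Proof.
move=> hh; suff [a [a1 [_ a2]]] : Aspn (fun _ => True) CC h by exists a.
rewrite (heck_sum h); apply: Aspn_sum => w _; apply: AspnZ => //; exact: T_in_C.
Qed.

Lemma C_indep (a : W -> K) : \sum_w a w *: CC w = 0 -> forall w, a w = 0.
Proof.
move=> e; have /eqP : \sum_w a w *: T w = 0; last first.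
  move=> /eqP e2 w; have := congr1 (fun h : H => h w) e2.
  rewrite hE_sum hE_zero (bigD1 w) //= hE_scale TE eqxx mulr1 big1 ?addr0 // => y hy.
  by rewrite hE_scale TE eq_sym (negbTE hy) mulr0.
apply: Classical_Prop.NNPP => /eqP h0; have [y] := max_supp h0; have ha z : (\sum_w a w *: T w) z = a z.
  rewrite hE_sum (bigD1 z) //= hE_scale TE eqxx mulr1 big1 ?addr0 // => x hx.
  by rewrite hE_scale TE eq_sym (negbTE hx) mulr0.
rewrite ha => -[hy hm]; move/(congr1 (fun h : H => h y)): e.
rewrite hE_sum hE_zero (bigD1 y) //= hE_scale (proj2 (CC_supp y)) mulr1 big1 ?addr0 => [e|z hz].
  by rewrite e eqxx in hy.
rewrite hE_scale; case: (eqVneq (CC z y) 0) => [->|h1]; first by rewrite mulr0.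
have [e|hlt] := proj1 (CC_supp z) y h1; first by rewrite e eqxx in hz.
case: (eqVneq (a z) 0) => [->|h2]; first by rewrite mul0r.
by have := hm z; rewrite ha => /(_ h2); lia.
Qed.

Lemma starC w : star (CC w) = CC w^-1%g.
Proof.
apply/eqP; rewrite -subr_eq0; apply/eqP; apply: kl_uniq => [|y].
  by rewrite hbarB hbar_star !hbarC.
rewrite hE_add hE_opp starE.
have -> : CC w y^-1%g - CC w^-1%g y = (CC w y^-1%g - (y^-1%g == w)%:R) - (CC w^-1%g y - (y == w^-1%g)%:R).
  by rewrite -(inj_eq invg_inj) invgK; ring.
by apply: vZvB; exact: CC_vZv.
Qed.

(** The inductive construction of the basis: with [w] now standing for [s ** w'], the element [D],
    equal to [T s - v] times [CC w], is bar-invariant and an eigenvector. By [kl_uniq], [CC w']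
    differs from [D] by integer multiples of [CC y] for [y] shorter than [w] with left descent [s],
    which are eigenvectors by induction. *)
Lemma TsC s w : s \in gens n -> (len (s ** w) < len w)%N -> T s * CC w = - vK^-1 *: CC w.
Proof.
elim: {w}(len w).+1 {-2}w (ltnSn (len w)) s => [|m IH] w' hm s hs hl; first by [].
pose w := s ** w'; have ew : w' = s ** w by rewrite /w gensKl.
pose D := T s * CC w - vK *: CC w.
have hD : T s * D = - vK^-1 *: D.
  rewrite /D mulrBr mulrA Ts_sq // mulrDl mul1r -!scalerAl -scalerAr scalerBr !scalerA.
  rewrite scalerBl mulNr mulVf ?vK_neq0 // scaleN1r opprK scaleNr.
  by rewrite [vK *: _ - _]addrC addrA addrK addrC.
have hDb : hbar D = D.
  rewrite /D hbarB hbarZ hbar_TsM // !hbarC bar_v.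
  by rewrite mulrBl -scalerAl mul1r scalerBl opprB addrA addrAC addrK.
have hDy y : D y = CC w (s ** y) - (if (len (s ** y) < len y)%N then vK^-1 else vK) * CC w y.
  by rewrite /D TsM // hE_add hE_opp hE_scale LsmE; case: ifP => _; ring.
(* [mu y] is the coefficient of [v] in the [y]-coordinate of [CC w]. Division by [v] in [D y] turns
   it into an unwanted constant term, and this division occurs only when [s] is a left descent of
   [y]. *)
have /fin_all_exists[mu hmu] : forall y, exists z : int, ((len (s ** y) < len y)%N ->
    in_vZv (vK^-1 * CC w y - z%:~R) /\ (z != 0 -> (len y < len w)%N)) /\
    (~~ (len (s ** y) < len y)%N -> z = 0).
  move=> y; case: (boolP (len (s ** y) < len y)%N) => hy; last by exists 0.
  have hyw : y != w by apply/eqP => e; move: hy hl; rewrite e -ew -/w; lia.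
  case: (eqVneq (CC w y) 0) => [e|hne].
    by exists 0; split=> // _; split; rewrite ?eqxx // e mulr0 subr0; exact: vZv0.
  have [z hz] := vZv_divv (CC_neq hyw); exists z; split=> // _; split=> // _.
  by have [e|//] := proj1 (CC_supp w) y hne; rewrite e eqxx in hyw.
pose E := D - CC w' + \sum_y (mu y)%:~R *: CC y.
have hE0 : E = 0.
  apply: kl_uniq => [|y].
    rewrite /E hbarD hbarB hDb hbarC hbar_sum; congr (_ + _).
    by apply: eq_bigr => y _; rewrite hbarZ bar_int hbarC.
  have hsum : in_vZv ((\sum_z (mu z)%:~R *: CC z) y - (mu y)%:~R).
    rewrite hE_sum (bigD1 y) //= hE_scale addrAC -[X in _ - X + _]mulr1 -mulrBr; apply: vZvD.
      by apply: vZv_mulr (inZv_int _) _; have := CC_vZv y y; rewrite eqxx.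
    by apply: vZv_sum => z hz; rewrite hE_scale; apply: vZv_mulr (inZv_int _) (CC_neq _); rewrite eq_sym.
  have -> : E y = (D y - (y == w')%:R + (mu y)%:~R) - (CC w' y - (y == w')%:R) +
      ((\sum_z (mu z)%:~R *: CC z) y - (mu y)%:~R).
    by rewrite /E hE_add (hE_add D) hE_opp; ring.
  apply: vZvD => //; apply: vZvB; last exact: CC_vZv.
  have e1 : (y == w') = (s ** y == w).
    by apply/eqP/eqP => [->|h]; rewrite // ew -h gensKl.
  have [h1 h2] := hmu y; rewrite hDy e1; case: ifP => hy.
    have -> : CC w (s ** y) - vK^-1 * CC w y - (s ** y == w)%:R + (mu y)%:~R =
      (CC w (s ** y) - (s ** y == w)%:R) - (vK^-1 * CC w y - (mu y)%:~R) by ring.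
    by apply: vZvB; [exact: CC_vZv | case: (h1 hy)].
  rewrite h2 ?hy // addr0 addrAC; apply: vZvB; first exact: CC_vZv.
  by rewrite mulrC; apply: vZv_mulr; [exact: CC_Zv | exact: vZv_v].
have eC : CC w' = D + \sum_y (mu y)%:~R *: CC y.
  by apply/eqP; rewrite eq_sym -subr_eq0 addrAC; apply/eqP.
clearbody D; rewrite eC mulrDr hD scalerDr mulr_sumr scaler_sumr; congr (_ + _).
apply: eq_bigr => y _; rewrite -scalerAr scalerA mulrC -scalerA.
have [h1 h2] := hmu y; case: (boolP (len (s ** y) < len y)%N) => hy; last by rewrite h2 // !scale0r.
case: (eqVneq (mu y) 0) => [->|h0]; first by rewrite !scale0r.
have [_ /(_ h0) hlt] := h1 hy; rewrite IH //.
by move: hlt hm hl; rewrite -/w; lia.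
Qed.

Lemma CTs s w : s \in gens n -> (len (w ** s) < len w)%N -> CC w * T s = - vK^-1 *: CC w.
Proof.
move=> hs hl; have h : (len (s ** w^-1%g) < len w^-1%g)%N.
  by rewrite -lenV wmulV invgK (gensV hs) lenV.
have := congr1 (@star n) (TsC hs h); rewrite starM linearZ /= starC starT invgK.
by rewrite (gensV hs).
Qed.

Section Lambda.
Variable l : part n.
Local Notation b := (prow l).
Local Notation e := (eb (prow l) (- vK^-1)).
Local Notation wl := (wlong l).
Let bmono := @row_mono n l.

Lemma CC_xwl_eigen x : binc b x -> forall i j, adj i j -> b i = b j ->
  CC (x ** wl) * T (tperm i j) = - vK^-1 *: CC (x ** wl).
Proof.
move=> hx i j hij ee; apply: CTs; first by apply/gensP; exists i, j.
rewrite len_desc // !wmulE; have hwl := wlongP l.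
have hb := WbP _ _ (proj1 hwl).
apply: (binc_lt bmono hx); first by rewrite !hb.
by apply: (longest_dec bmono hwl) => //; move/eqP: hij => /= ->.
Qed.

(** As an eigenvector, [CC wl] is a combination of the [T x * e]; the coefficient at [x] is a
    multiple of the one at [x ** wl], which is too long for the support unless [x = 1]. *)
Lemma CC_wl : CC wl = (- vK) ^+ len wl *: e.
Proof.
have hw := wlongP l; have hWb := proj1 hw.
have hz := CC_xwl_eigen (binc1 b); rewrite w1mul in hz.
have hxy := right_eigen bmono hz.
have hc x : binc b x -> CC wl x = (- vK) ^+ len wl * CC wl (x ** wl).
  move=> hx; rewrite (hxy x wl) // mulrA -exprMn mulrNN mulfV ?vK_neq0 //.
  by rewrite expr1n mul1r.
rewrite {1}(right_eigen_expand bmono hz) (bigD1 1%g) ?binc1 //= big1 => [|x /andP[hx hne]].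
  by rewrite hc ?binc1 // w1mul (proj2 (CC_supp wl)) mulr1 T1 mul1r addr0.
rewrite hc //; suff -> : CC wl (x ** wl) = 0 by rewrite mulr0 scale0r.
apply/eqP; apply: contraNT hne => /(proj1 (CC_supp wl)) [h|].
  by apply/eqP; apply: (@wmulIr _ wl); rewrite h w1mul.
by rewrite (len_binc_add bmono hx hWb); lia.
Qed.

Lemma CC_xwl x : binc b x -> CC (x ** wl) = \sum_(y | binc b y) CC (x ** wl) (y ** wl) *: (T y * CC wl).
Proof.
move=> hx; have hz := CC_xwl_eigen hx; have hw := proj1 (wlongP l).
rewrite {1}(right_eigen_expand bmono hz); apply: eq_bigr => y hy.
rewrite (right_eigen bmono hz hy hw) CC_wl -scalerAr scalerA mulrAC -exprMn.
by rewrite mulrNN mulVf ?vK_neq0 // expr1n mul1r.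
Qed.

End Lambda.
End KL.

(** * Representations and leading coefficients *)

Section HeckeExtra.
Variable n : nat.
Local Notation W := 'S_n.
Local Notation H := (heck n).
Local Notation T := (@T n).
Local Infix "**" := (@wmul n) (at level 40, left associativity).
Implicit Types (w x y z s t u : 'S_n) (h g : heck n).

Lemma TsTw s w : s \in gens n ->
  T s * T w = T (s ** w) + (if (len (s ** w) < len w)%N then qK else 0) *: T w.
Proof.
move=> hs; case: ifP => hl.
  have h2 : (len (s ** w) < len (s ** (s ** w)))%N by rewrite gensKl.
  have e : T w = T s * T (s ** w) by rewrite TsT_up // gensKl.
  by rewrite {1}e mulrA Ts_sq // mulrDl mul1r -scalerAl -e.
by rewrite scale0r addr0 TsT_up // len_gtl // hl.
Qed.

Lemma TwTs s w : s \in gens n ->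
  T w * T s = T (w ** s) + (if (len (w ** s) < len w)%N then qK else 0) *: T w.
Proof.
move=> hs; have := congr1 (@star n) (TsTw w^-1%g hs).
rewrite starM linearD linearZ /= !starT wmulV !invgK (gensV hs) => ->.
by rewrite -(lenV (s ** _)) wmulV invgK (gensV hs) lenV.
Qed.

Lemma ip_tau h g : ip h g = (star g * h) 1%g.
Proof. by rewrite -ip_T ip_adj starK T1 mulr1. Qed.

Lemma ip_adjr h g f : ip (h * g) f = ip h (f * star g).
Proof. by rewrite !ip_tau starM starK mulrA tauC !mulrA. Qed.
End HeckeExtra.

Section OneRep.
Variables (n d : nat) (r : 'S_n -> 'M[K]_d).
Local Notation W := 'S_n.
Local Notation H := (heck n).
Local Notation T := (@T n).
Local Infix "**" := (@wmul n) (at level 40, left associativity).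
Hypothesis Hr : is_rep r.
Hypothesis Hi : is_irr r.

Definition X : H -> 'M[K]_d := locked_with heck_key (Xof r).
Lemma XE h : X h = \sum_w h w *: r w. Proof. by rewrite /X unlock. Qed.
Lemma XEij h i j : X h i j = \sum_w h w * r w i j.
Proof. by rewrite XE summxE; apply: eq_bigr => w _; rewrite mxE. Qed.
Fact X_linear : linear X.
Proof.
move=> a h g; apply/matrixP => i j; rewrite 2!mxE !XEij mulr_sumr -big_split /=.
by apply: eq_bigr => w _; rewrite hE_add hE_scale mulrDl mulrA.
Qed.
HB.instance Definition _ := GRing.isLinear.Build K H 'M[K]_d *:%R X X_linear.

Lemma XT w : X (T w) = r w.
Proof.
apply/matrixP => i j; rewrite XEij (bigD1 w) //= TE eqxx mul1r big1 ?addr0 // => y hy.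
by rewrite TE (negbTE hy) mul0r.
Qed.
Lemma X1 : X 1 = 1%:M. Proof. by rewrite -T1 XT; case: Hr. Qed.
Lemma XM h g : X (h * g) = X h *m X g.
Proof.
have hT x y : X (T x * T y) = r x *m r y.
  by case: Hr => _ <-; rewrite /X unlock hmulE !TbE.
rewrite {1}(heck_sum h) {1}(heck_sum g) mulr_suml linear_sum XE mulmx_suml.
apply: eq_bigr => x _; rewrite mulr_sumr linear_sum XE mulmx_sumr.
by apply: eq_bigr => y _; rewrite -scalerAl -scalerAr !linearZ /= hT -scalemxAl !scalerA mulrC.
Qed.

Lemma stable_full m (A : 'M[K]_(m, d)) : A != 0 ->
  (forall w, (A *m r w <= A)%MS) -> row_full A.
Proof.
move=> hA hs; case: Hi => _ /(_ <<A>>%MS); rewrite /row_full (genmxE A) => h.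
have hst w : stablemx <<A>>%MS (r w).
  by rewrite (eqmxMr _ (genmxE A)) genmxE.
have /orP[/andP[h0 _]|] := h hst.
  by rewrite submx0 (negbTE hA) in h0.
by rewrite (genmxE A).
Qed.

Definition orbmx m (A : 'M[K]_(m, d)) : 'M[K]_d := (\sum_w <<A *m r w>>)%MS.

Lemma orbmx_stable m (A : 'M[K]_(m, d)) w : (orbmx A *m r w <= orbmx A)%MS.
Proof.
rewrite /orbmx sumsmxMr; apply/sumsmx_subP => x _.
rewrite (eqmxMr _ (genmxE _)) -mulmxA -XT -XT -XM (heck_sum (T x * T w)).
rewrite linear_sum mulmx_sumr; apply: summx_sub => y _.
rewrite linearZ /= XT -scalemxAr; apply: scalemx_sub.
by apply: submx_trans (sumsmx_sup y _ (submx_refl _)); rewrite ?genmxE.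
Qed.

Lemma orbmx_full m (A : 'M[K]_(m, d)) : A != 0 -> row_full (orbmx A).
Proof.
move=> hA; apply: stable_full; last exact: orbmx_stable.
apply: contra_neq hA => e; apply/eqP; rewrite -submx0 -e.
apply: submx_trans (sumsmx_sup 1%g _ (submx_refl _)); rewrite // genmxE.
by rewrite -XT T1 X1 mulmx1.
Qed.

Lemma irr_gen (u v : 'rV[K]_d) : u != 0 -> exists h, v = u *m X h.
Proof.
move=> hu; have /sub_sumsmxP[c ->] : (v <= orbmx u)%MS by apply: submx_full; exact: orbmx_full.
have hc w : exists a : K, c w *m <<u *m r w>>%MS = a *: (u *m r w).
  by apply/sub_rVP; apply: submx_trans (submxMl _ _) _; rewrite genmxE.
have /fin_all_exists[a ha] := hc.
exists (\sum_w a w *: T w); rewrite linear_sum mulmx_sumr; apply: eq_bigr => w _.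
by rewrite ha linearZ /= XT -scalemxAr.
Qed.

(** If all these products vanished, [B] would kill the submodule generated by the rows of [A], which
    is the whole space. *)
Lemma irr_prod (A B : 'M[K]_d) : A != 0 -> B != 0 -> exists w, A *m r w *m B != 0.
Proof.
move=> hA hB; apply/existsP; apply: contraNT hB; rewrite negb_exists => /forallP h.
have hf := orbmx_full hA; rewrite -sub1mx in hf.
have /sub_sumsmxP[c e1] := hf.
rewrite -[B]mul1mx e1 mulmx_suml big1 // => w _.
apply/eqP; rewrite -submx0; have /negPn/eqP <- := h w.
rewrite -[X in (X <= _)%MS]mulmxA; apply: submx_trans (submxMl _ _) _.
by rewrite (eqmxMr B (genmxE (A *m r w))).
Qed.

End OneRep.

Section TwoReps.
Variables (n d1 d2 : nat) (r1 : 'S_n -> 'M[K]_d1) (r2 : 'S_n -> 'M[K]_d2).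
Local Notation T := (@T n).
Local Infix "**" := (@wmul n) (at level 40, left associativity).
Hypotheses (H1 : is_rep r1) (H2 : is_rep r2) (I1 : is_irr r1) (I2 : is_irr r2).

Lemma intertw (M : 'M[K]_(d1, d2)) : (forall w, r1 w *m M = M *m r2 w) ->
  M = 0 \/ (row_free M /\ row_full M).
Proof.
move=> hM; case: (eqVneq M 0) => [|M0]; [by left | right; split].
  rewrite -kermx_eq0; apply: contraT => hk.
  have /(stable_full I1 hk) : forall w, (kermx M *m r1 w <= kermx M)%MS.
    by move=> w; apply/sub_kermxP; rewrite -mulmxA hM mulmxA mulmx_ker mul0mx.
  rewrite -sub1mx => /sub_kermxP; rewrite mul1mx => e; by rewrite e eqxx in M0.
by apply: (stable_full I2 M0) => w; rewrite -hM submxMl.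
Qed.

Lemma intertw_X (M : 'M[K]_(d1, d2)) : (forall w, r1 w *m M = M *m r2 w) ->
  forall h, X r1 h *m M = M *m X r2 h.
Proof.
move=> hM h; rewrite !XE mulmx_suml mulmx_sumr; apply: eq_bigr => w _.
by rewrite -scalemxAl hM scalemxAr.
Qed.

(** For a generator, the substitution of [s ** w] for [w] matches left multiplication on the first
    factor with right multiplication on the second; the terms with [v - v^-1] agree because
    inversion preserves length. *)
Lemma casimir (E : 'M[K]_(d1, d2)) x :
  r1 x *m (\sum_w r1 w *m E *m r2 w^-1%g) = (\sum_w r1 w *m E *m r2 w^-1%g) *m r2 x.
Proof.
have hs s : s \in gens n ->
    r1 s *m (\sum_w r1 w *m E *m r2 w^-1%g) = (\sum_w r1 w *m E *m r2 w^-1%g) *m r2 s.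
  move=> hs; rewrite mulmx_sumr mulmx_suml.
  under eq_bigr => w _ do rewrite !mulmxA -(XT r1) -(XT r1 w) -XM // TsTw // linearD linearZ /= !XT mulmxDl mulmxDl.
  under [RHS]eq_bigr => w _ do rewrite -!mulmxA -(XT r2) -(XT r2 s) -XM // TwTs // linearD linearZ /= !XT !mulmxDr.
  rewrite !big_split /=; congr (_ + _).
    rewrite (reindex_inj (@wmulI _ s)) /=; apply: eq_bigr => w _.
    by rewrite gensKl // wmulV (gensV hs) mulmxA.
  apply: eq_bigr => w _; rewrite -!scalemxAl -!scalemxAr mulmxA; congr (_ *: _).
  by rewrite -(lenV (s ** w)) wmulV (gensV hs) lenV.
elim/len_ind: x => [|s x hg hl IH].
  by rewrite -(XT r1) -(XT r2) T1 !X1 // mul1mx mulmx1.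
rewrite -(XT r1) -(XT r2 (s ** x)) -(TsT_up hg hl) !XM // !XT.
by rewrite -mulmxA IH !mulmxA hs.
Qed.
End TwoReps.

(** * Positivity of the characters induced from sign representations *)

Section InducedCharacter.
Variable n : nat.
Local Notation W := 'S_n.
Local Notation H := (heck n).
Local Notation T := (@T n).
Local Infix "**" := (@wmul n) (at level 40, left associativity).
Implicit Types (w x y z s t u : 'S_n) (h g : heck n) (l m : part n).

Notation e_ l := (eb (prow l) (- vK^-1)).
Notation E_ l := (eb (kk l) vK).

Lemma e_sq l : e_ l * e_ l = Pb (prow l) (- vK^-1) *: e_ l.
Proof. exact: (eb_sq (@row_mono n l) vz0 vzq). Qed.

(** The trace of [h] on the left ideal generated by [e_ l], in the basis [T x * e_ l]. Right
    multiplication by [e_ l] is self-adjoint for [ip], which turns the inner sum into one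
    coordinate. *)
Lemma indcharE l h : indchar l h = \sum_(x | binc (prow l) x) (h * T x * e_ l) x.
Proof.
rewrite /indchar (eq_bigl (fun x => binc (prow l) x)) => [|x]; last exact: inXE.
apply: eq_bigr => x hx.
have -> : (h * T x * e_ l) x = ip (h * T x) (T x * e_ l) by rewrite -ip_T ip_adjr star_eb.
rewrite eb_sum mulr_sumr ip_sumr (eq_bigl (fun u => Wb (prow l) u)) => [|u]; last exact: youngE.
apply: eq_bigr => u hu; rewrite -scalerAr ipZr TT_add ?(len_binc_add (@row_mono n l)) //.
rewrite ip_T hmulE TbE /eps -[- vK^-1]mulN1r exprMn exprVn.
by rewrite -mulrA mulrC.
Qed.

(** [e_ l] is fixed by [star] and is a multiple of an idempotent, so the trace of [star h * h]
    becomes a sum of squared norms. *)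
Lemma Pb_indchar l h : Pb (prow l) (- vK^-1) * indchar l (star h * h) =
  \sum_(x | binc (prow l) x) ip (h * T x * e_ l) (h * T x * e_ l).
Proof.
rewrite indcharE mulr_sumr; apply: eq_bigr => x hx.
rewrite -ip_T -ipZl scalerAr -e_sq.
have -> : star h * h * T x * (e_ l * e_ l) = star h * (h * T x * e_ l) * e_ l by rewrite !mulrA.
by rewrite ip_adjr star_eb ip_adj starK !mulrA.
Qed.

Lemma indchar_kill l h : indchar l (star h * h) = 0 -> forall g, h * g * e_ l = 0.
Proof.
move=> h0; have hx x : binc (prow l) x -> h * T x * e_ l = 0.
  move=> hx; apply: heckP => y; rewrite hE_zero.
  have := Pb_indchar l h; rewrite h0 mulr0 /ip pair_big_dep /= => /esym hs.
  pose f (p : W * W) : K := if binc (prow l) p.1 then (h * T p.1 * e_ l) p.2 else 0.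
  have := @sumsq_eq0 _ f; rewrite -[X in X = 0 -> _](_ : \sum_(p | binc (prow l) p.1 && true) 
     (h * T p.1 * e_ l) p.2 * (h * T p.1 * e_ l) p.2 = _).
    by move=> /(_ hs (x, y)); rewrite /f /= hx.
  rewrite big_mkcond; apply: eq_bigr => p _; rewrite /f andbT.
  by case: ifP => _; rewrite ?expr2 // mulr0.
move=> g; elim/T_ind_lin: g => [|g g' e1 e2|a w].
- by rewrite mulr0 mul0r.
- by rewrite mulrDr mulrDl e1 e2 addr0.
have [x [u [-> hx' hu]]] := block_dec (prow l) w.
rewrite -TT_add ?(len_binc_add (@row_mono n l)) //.
rewrite -scalerAr -scalerAl -!mulrA (Tu_eb (@row_mono n l) vz0 vzq hu).
by rewrite -!scalerAr mulrA hx // !scaler0.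
Qed.
End InducedCharacter.
Notation e_ l := (eb (prow l) (- vK^-1)).
Notation E_ l := (eb (kk l) vK).

(** * Schur relations and leading coefficients *)

Section Family.
Variables (n : nat) (d : part n -> nat) (rho : forall l : part n, 'S_n -> 'M[K]_(d l)).
Variable C : 'S_n -> hecke n.
Hypotheses (HC : isKL C) (Hrep : forall l, is_rep (rho l)) (Hirr : forall l, is_irr (rho l))
  (Hlab : labelling rho) (Horth : forall l, orthogonal_rep (rho l))
  (Hint : forall l, integral_ltc (rho l) l) (Hnorm : forall l, normalized (rho l) l).
Local Notation W := 'S_n.
Local Notation H := (heck n).
Local Notation T := (@T n).
Local Notation C' := (CC C).
Local Infix "**" := (@wmul n) (at level 40, left associativity).
Implicit Types (w x y z s t u : 'S_n) (h g : heck n) (l m : part n).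

Local Notation X l := (@X n (d l) (rho l)).
Local Notation a l := (len (wlong l)).

(** By the labelling, the character induced for [l] involves only representations [X m] with [m]
    dominating [l]; it therefore vanishes on [star h * h], and positivity concludes. *)
Lemma kill_blocks l h : (forall m, domle l m -> X m h = 0) -> forall g, h * g * e_ l = 0.
Proof.
move=> h0; apply: indchar_kill.
have [mm [hm1 hm2]] := Hlab l.
have hlin g : indchar l g = \sum_w g w * indchar l (Tb w).
  rewrite indcharE; under [RHS]eq_bigr => w _ do rewrite indcharE mulr_sumr.
  rewrite exchange_big /=; apply: eq_bigr => x _.
  rewrite {1}(heck_sum g) !mulr_suml hE_sum; apply: eq_bigr => w _.
  by rewrite TbE -!scalerAl hE_scale.
have htr m g : \tr (X m g) = \sum_w g w * \tr (rho m w).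
  by rewrite XE linear_sum; apply: eq_bigr => w _; rewrite linearZ.
rewrite hlin; under eq_bigr => w _ do rewrite hm2 mulrDr.
rewrite big_split /= -htr.
have hz m : domle l m -> X m (star h * h) = 0.
  by move=> hm; rewrite XM // h0 // mulmx0.
rewrite hz ?domle_refl // mxtrace0 add0r.
under eq_bigr => w _ do rewrite mulr_sumr.
rewrite exchange_big /= big1 // => m _.
case: (eqVneq (mm m) 0%N) => [->|hne].
  by rewrite big1 // => w _; rewrite mul0r mulr0.
under eq_bigr => w _ do rewrite mulrCA.
rewrite -mulr_sumr -htr hz ?mxtrace0 ?mulr0 //.
by apply/sdomlt_domle/hm1/eqP.
Qed.

Lemma X_faithful h : (forall m, X m h = 0) -> h = 0.
Proof.
move=> h0; have [l hl] := ones_ex n.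
have := @kill_blocks l h (fun m _ => h0 m) 1; rewrite mulr1.
have -> : e_ l = 1; last by rewrite mulr1.
rewrite eb_sum (bigD1 1%g) ?Wb1 //= len1 scale1r big1 ?addr0 // => u /andP[/hl ->].
by rewrite eqxx.
Qed.

(* c^{ij}_{w,l} in the paper *)
Definition cc l w (i j : 'I_(d l)) : int :=
  proj1_sig (constructive_indefinite_description _ (@Hint l w i j)).
Arguments cc : clear implicits.
Lemma ccP l w i j :
  locTerm 0 (vK ^+ a l * rho l w i j) ((-1) ^+ len w * (cc l w i j)%:~R).
Proof. exact: (proj2_sig (constructive_indefinite_description _ (@Hint l w i j))). Qed.

Lemma isWE l i j w : isW (rho l) l i j w <-> cc l w i j != 0.
Proof.
have hs : (-1) ^+ len w != 0 :> Real by rewrite expf_neq0 // oppr_eq0 oner_neq0.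
split=> [[c [h1 h2]]|h].
  have := loc_uniq h1 (ccP w i j) => /(mulfI hs) e.
  by apply: contra_neq h2 => e0; rewrite e e0.
by exists (cc l w i j)%:~R; split; [exact: ccP | rewrite intr_eq0].
Qed.

(** Orthogonality makes the matrix of [T_{w^-1}] the transpose of that of [T_w] up to a diagonal
    matrix with entries of residue 1, which disappears in constant terms. *)
Lemma ccV l w i j : cc l w^-1%g i j = cc l w j i.
Proof.
have [P [hP [hPu [hP1 hPr]]]] := Horth l.
have e : P *m rho l w^-1%g = (rho l w)^T *m P by rewrite hPr !mulmxA mulmxV // mul1mx.
have hd i1 j1 : i1 != j1 -> P i1 j1 = 0.
  by move=> hne; apply/eqP; have /is_diag_mxP := hP => /(_ i1 j1) ->.
have := congr1 (fun M : 'M_(d l) => M i j) e; rewrite !mxE.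
rewrite (bigD1 i) //= big1 ?addr0 => [|k hk]; last by rewrite hd ?mul0r // eq_sym.
rewrite (bigD1 j) //= big1 ?addr0 => [|k hk]; last by rewrite (hd k j) ?mulr0.
rewrite mxE => e2.
have hl k : locTerm 0 (P k k) 1.
  by have [p [p1 ->]] := hP1 k; apply: loc_eq (loc_poly 0 p).
have h1 := locM (hl i) (ccP w^-1%g i j).
have h2 := locM (ccP w j i) (hl j).
rewrite mulrCA e2 mulrA in h1; have := loc_uniq h1 h2.
rewrite mul1r mulr1 lenV; have hs : (-1) ^+ len w != 0 :> Real.
  by rewrite expf_neq0 // oppr_eq0 oner_neq0.
by move=> /(mulfI hs) /intr_inj.
Qed.

(* Passing to constant terms turns [v^a X_l] into the matrix of leading coefficients. *)
Lemma loc_X l h (k : W -> Real) i j : (forall y, locTerm 0 (h y) (k y)) ->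
  locTerm 0 (vK ^+ a l * X l h i j) (\sum_y k y * ((-1) ^+ len y * (cc l y i j)%:~R)).
Proof.
move=> hk; rewrite XEij mulr_sumr; apply: loc_sum => y _.
by rewrite mulrCA; apply: locM; [exact: hk | exact: ccP].
Qed.

Lemma loc_X_delta l h w i j : (forall y, locTerm 0 (h y) (y == w)%:R) ->
  locTerm 0 (vK ^+ a l * X l h i j) ((-1) ^+ len w * (cc l w i j)%:~R).
Proof.
move=> hk; apply: loc_eq (loc_X i j hk).
rewrite (bigD1 w) //= eqxx mul1r big1 ?addr0 // => y /negbTE ->; by rewrite mul0r.
Qed.

Lemma loc_C l w i j : locTerm 0 (vK ^+ a l * X l (C' w) i j) ((-1) ^+ len w * (cc l w i j)%:~R).
Proof.
apply: loc_X_delta => y.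
have h1 := locD (vZv_loc (CC_vZv HC w y)) (loc_nat 0 (y == w)).
by rewrite subrK add0r in h1.
Qed.

Definition i0 l : 'I_(d l) := Ordinal (proj1 (Hirr l)).

Lemma cc_wl0 l : cc l (wlong l) (i0 l) (i0 l) != 0.
Proof. by apply/isWE; apply: Hnorm. Qed.

Lemma sgn_neq0 k : (-1) ^+ k != 0 :> Real.
Proof. by rewrite expf_neq0 // oppr_eq0 oner_neq0. Qed.

Lemma X_e_neq0 l : X l (e_ l) != 0.
Proof.
apply/eqP => e0; have := loc_C (wlong l) (i0 l) (i0 l).
rewrite CC_wl // linearZ /= e0 scaler0 mxE mulr0 => /(loc_uniq (loc0 0)) /esym/eqP.
by rewrite mulf_eq0 (negbTE (sgn_neq0 _)) intr_eq0 (negbTE (cc_wl0 l)).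
Qed.

(** If [m] dominates [l] and [X m] does not kill [E_ l], a nonzero product with [e_ m] forces [m] to
    be dominated by [l], so [m = l]. Were [E_ l] zero in [X l], all these representations would kill
    it, and [kill_blocks] would contradict [E_C_neq0]. *)
Lemma X_E_neq0 l : X l (E_ l) != 0.
Proof.
have [w hw] := E_C_neq0 l; apply: contraNN hw => /eqP hl.
apply/eqP; apply: kill_blocks => m hlm; apply/eqP; apply: Classical_Prop.NNPP => /negP hm.
have [w' hw'] := irr_prod (Hrep m) (Hirr m) hm (X_e_neq0 m).
have hml : domle m l.
  apply: (@E_C_dom n l m w'); apply: contra_neq hw' => e.
  by rewrite -XT -!XM // e linear0.
by move: hm; rewrite -(domle_anti hlm hml) hl eqxx.
Qed.

Lemma X_eb_sandwich l (b : 'I_n -> nat) : X l (eb b (- vK^-1)) != 0 ->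
  exists w, E_ l * T w * eb b (- vK^-1) != 0.
Proof.
move=> h; have [w hw] := irr_prod (Hrep l) (Hirr l) (X_E_neq0 l) h.
exists w; apply: contra_neq hw => e; by rewrite -XT -!XM // e linear0.
Qed.

Lemma X_e_dom l m : X l (e_ m) != 0 -> domle m l.
Proof. by move=> /X_eb_sandwich[w hw]; apply: E_C_dom hw. Qed.

(** An isomorphism transports the nonvanishing of [e_ l] in [X l] to [X m], and that of [e_ m] in
    [X m] to [X l]; so each partition dominates the other. *)
Lemma not_iso l m (M : 'M[K]_(d l, d m)) : (forall w, rho l w *m M = M *m rho m w) ->
  M != 0 -> l = m.
Proof.
move=> hM hM0; have [e|[hf hF]] := intertw (Hirr l) (Hirr m) hM; first by rewrite e eqxx in hM0.
have hX := intertw_X hM.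
have hlm : domle l m.
  apply: X_e_dom; apply: contra_neq (X_e_neq0 l) => e.
  by apply: (row_free_inj hf); rewrite hX e mulmx0 mul0mx.
have hml : domle m l.
  apply: X_e_dom; apply: contra_neq (X_e_neq0 m) => e.
  by apply: (row_full_inj hF); rewrite -hX e mulmx0 mul0mx.
exact: domle_anti.
Qed.

(* Absolute irreducibility: [e_l H E_l] is a line, on which any intertwiner acts by a scalar. *)
Lemma commutant l (M : 'M[K]_(d l)) : (forall w, rho l w *m M = M *m rho l w) ->
  exists c, M = c%:M.
Proof.
move=> hM; have [B [_ hB]] := E_C_line l.
have hB' h : exists c : K, e_ l * h * E_ l = c *: star B.
  have [c hc] := hB (star h); exists c; have := congr1 (@star n) hc.
  by rewrite !starM linearZ /= !star_eb starK mulrA.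
have [w hw] := irr_prod (Hrep l) (Hirr l) (X_e_neq0 l) (X_E_neq0 l).
have [i hi] : exists i, row i (X l (e_ l) *m rho l w *m X l (E_ l)) != 0.
  apply/existsP; apply: contraNT hw; rewrite negb_exists => /forallP h0.
  by apply/eqP/row_matrixP => i; rewrite row0; apply/eqP; have := h0 i; rewrite negbK.
pose u := row i (X l (e_ l)).
have ez : row i (X l (e_ l) *m rho l w *m X l (E_ l)) = u *m X l (T w * E_ l).
  by rewrite !row_mul XM // XT mulmxA.
have hu : u != 0 by apply: contra_neq hi => e; rewrite ez e mul0mx.
have [h hh] := irr_gen (Hrep l) (Hirr l) (u *m M) hu.
pose z := u *m X l (T w * E_ l).
have hz0 : z != 0 by rewrite /z -ez.
have hline g : exists c : K, u *m X l (g * E_ l) = c *: row i (X l (star B)).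
  have [c hc] := hB' g; exists c.
  by rewrite -row_mul -XM // mulrA hc linearZ /= linearZ.
have [c1 hc1] := hline (T w); have [c2 hc2] := hline (h * T w).
have hzM : z *m M = (c2 / c1) *: z.
  rewrite /z -mulmxA (intertw_X hM) mulmxA hh -mulmxA -XM // mulrA hc2 hc1 scalerA divfK //.
  by apply: contra_neq hz0 => e; rewrite /z hc1 e scale0r.
exists (c2 / c1); apply/eqP; rewrite -subr_eq0; apply/eqP.
pose N := M - (c2 / c1)%:M.
have hN w' : rho l w' *m N = N *m rho l w'.
  by rewrite mulmxBr mulmxBl hM scalar_mxC.
have [//|[hf _]] := intertw (Hirr l) (Hirr l) hN.
case/eqP: hz0; apply: (row_free_inj hf); rewrite mul0mx mulmxBr hzM mul_mx_scalar subrr //.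
Qed.

Lemma schur_neq l m i j k p : l != m ->
  \sum_w rho l w i j * rho m w^-1%g k p = 0.
Proof.
move=> hne; pose M := \sum_w rho l w *m delta_mx j k *m rho m w^-1%g.
have M0 : M = 0.
  apply/eqP; apply: contraNT hne => h; apply/eqP; apply: (@not_iso l m M) => // x.
  exact: casimir.
have := congr1 (fun A : 'M_(d l, d m) => A i p) M0; rewrite summxE mxE => e.
rewrite -[RHS]e; apply: eq_bigr => w _; rewrite mxE (bigD1 k) //= big1 ?addr0 => [|q hq]; rewrite mxE.
  rewrite (bigD1 j) //= big1 ?addr0 => [|q hq]; rewrite mxE ?eqxx ?mulr1 //.
  by rewrite (negbTE hq) mulr0.
by rewrite big1 ?mul0r // => q' _; rewrite mxE (negbTE hq) andbF mulr0.
Qed.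

Lemma schur_eq l : exists c : K, forall i j k p,
  \sum_w rho l w i j * rho l w^-1%g k p = ((i == p) && (j == k))%:R * c.
Proof.
have hE j k (M := \sum_w rho l w *m delta_mx j k *m rho l w^-1%g) i p :
    M i p = \sum_w rho l w i j * rho l w^-1%g k p.
  rewrite summxE; apply: eq_bigr => w _; rewrite mxE (bigD1 k) //= big1 ?addr0 => [|q hq]; rewrite mxE.
    rewrite (bigD1 j) //= big1 ?addr0 => [|q hq]; rewrite mxE ?eqxx ?mulr1 //.
    by rewrite (negbTE hq) mulr0.
  by rewrite big1 ?mul0r // => q' _; rewrite mxE (negbTE hq) andbF mulr0.
have hs j k : exists c, forall i p, \sum_w rho l w i j * rho l w^-1%g k p = (i == p)%:R * c.
  have [|c hc] := @commutant l (\sum_w rho l w *m delta_mx j k *m rho l w^-1%g).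
    by move=> x; apply: casimir.
  by exists c => i p; rewrite -hE hc mxE mulr_natl.
(* Inverting the summation variable exchanges the two pairs of indices; this makes the scalar given
   by [commutant] independent of [j] and [k]. *)
have hsym i j k p : \sum_w rho l w i j * rho l w^-1%g k p = \sum_w rho l w k p * rho l w^-1%g i j.
  rewrite (reindex_inj invg_inj) /=; apply: eq_bigr => w _.
  by rewrite invgK mulrC.
have [c hc] := hs (i0 l) (i0 l); exists c => i j k p.
have [c' hc'] := hs j k.
case: (eqVneq i p) => [->|hip]; last by rewrite hc' (negbTE hip) !mul0r.
have := hc' (i0 l) (i0 l); rewrite hsym hc [in RHS]eqxx mul1r => e1.
by rewrite hc' eqxx mul1r -e1 [k == j]eq_sym.
Qed.
Definition schur l : K := proj1_sig (constructive_indefinite_description _ (schur_eq l)).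
Lemma schurP l i j k p :
  \sum_w rho l w i j * rho l w^-1%g k p = ((i == p) && (j == k))%:R * schur l.
Proof. exact: (proj2_sig (constructive_indefinite_description _ (schur_eq l))). Qed.

Definition ua l : K := vK ^+ a l * vK ^+ a l.

Lemma gram_loc l m i j k p :
  locTerm 0 (vK ^+ a l * vK ^+ a m * \sum_w rho l w i j * rho m w^-1%g k p)
    (\sum_w cc l w i j * cc m w p k)%:~R.
Proof.
rewrite mulr_sumr rmorph_sum /=; apply: loc_sum => w _.
rewrite mulrACA; apply: loc_eq (locM (ccP w i j) (ccP w^-1%g k p)).
by rewrite lenV mulrACA -expr2 -exprM mulnC exprM sqrrN !expr1n mul1r ccV -intrM.
Qed.

Definition schur0 l : int := \sum_w cc l w (i0 l) (i0 l) * cc l w (i0 l) (i0 l).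

Lemma ua_schur_loc l : locTerm 0 (ua l * schur l) (schur0 l)%:~R.
Proof.
by have := gram_loc (i0 l) (i0 l) (i0 l) (i0 l); rewrite schurP !eqxx mul1r.
Qed.

(** The Schur relations at [v = 0]: for fixed [l], the leading coefficients are pairwise orthogonal
    integer functions of [w] with the common squared norm [schur0 l]. *)
Lemma gram_eq l i j p k :
  \sum_w cc l w i j * cc l w p k = if (i == p) && (j == k) then schur0 l else 0.
Proof.
apply: (@intr_inj Real); have := gram_loc i j k p; rewrite schurP.
case: ifP => _ /=; last by rewrite mul0r mulr0 => /loc_uniq h; exact: (h _ (loc0 0)).
by rewrite mul1r => /loc_uniq h; apply: h; exact: ua_schur_loc.
Qed.

Lemma schur0_gt0 l : 0 < schur0 l.
Proof.
rewrite /schur0 (bigD1 (wlong l)) //= ltr_pwDl ?sumr_ge0 //.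
  by rewrite lt_neqAle eq_sym mulf_neq0 ?cc_wl0 // -expr2 sqr_ge0.
by move=> w _; rewrite -expr2 sqr_ge0.
Qed.

Lemma schur_neq0 l : schur l != 0.
Proof.
have h : ua l * schur l != 0.
  by apply: loc_neq0 (ua_schur_loc l); rewrite intr_eq0 gt_eqF ?schur0_gt0.
by move: h; rewrite mulf_eq0 negb_or => /andP[].
Qed.

(** Fourier inversion: [h'] is assembled from traces, the Schur relations give it the same image as
    [h] in every representation, and faithfulness gives [h' = h]; then compare the coefficients of
    1. *)
Lemma tau_formula h : h 1%g = \sum_l (schur l)^-1 * \tr (X l h).
Proof.
pose h' : H := \sum_m (schur m)^-1 *: \sum_w \tr (X m (h * T w^-1%g)) *: T w.
have e : h' = h.
  apply/eqP; rewrite -subr_eq0; apply/eqP/X_faithful => m; rewrite linearB /=.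
  apply/eqP; rewrite subr_eq0; apply/eqP/matrixP => i j.
  have hX q : X m (\sum_w \tr (X q (h * T w^-1%g)) *: T w) i j =
      \sum_k \sum_p X q h k p * \sum_w rho m w i j * rho q w^-1%g p k.
    rewrite linear_sum summxE.
    under [RHS]eq_bigr => k _ do (under eq_bigr => p _ do rewrite mulr_sumr; rewrite exchange_big).
    rewrite [RHS]exchange_big /=; apply: eq_bigr => w _.
    rewrite linearZ /= mxE XT XM // XT /mxtrace mulr_suml; apply: eq_bigr => k _.
    rewrite mxE mulr_suml; apply: eq_bigr => p _.
    by rewrite -mulrA [rho q _ _ _ * _]mulrC.
  rewrite /h' linear_sum summxE (bigD1 m) //= [Y in _ + Y]big1 ?addr0 => [|q hq].
    rewrite linearZ /= mxE hX (bigD1 i) //= (bigD1 j) //= schurP !eqxx mul1r.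
    rewrite big1 ?addr0 => [|p hp]; last by rewrite schurP [j == p]eq_sym (negbTE hp) andbF mul0r mulr0.
    rewrite big1 ?addr0 => [|k hk]; last first.
      by rewrite big1 // => p _; rewrite schurP [i == k]eq_sym (negbTE hk) mul0r mulr0.
    by rewrite mulrC mulfK ?schur_neq0.
  rewrite linearZ /= mxE hX big1 ?mulr0 // => k _; rewrite big1 // => p _.
  by rewrite schur_neq ?mulr0 // eq_sym.
rewrite -{1}e /h' hE_sum; apply: eq_bigr => m _; rewrite hE_scale hE_sum; congr (_ * _).
rewrite (bigD1 1%g) //= hE_scale TE eqxx mulr1 invg1 T1 mulr1 big1 ?addr0 // => w hw.
by rewrite hE_scale TE eq_sym (negbTE hw) mulr0.
Qed.

Lemma Pbz_neq0 (b : 'I_n -> nat) : Pb b (- vK^-1) != 0.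
Proof.
apply/eqP => h0; pose f (u : W) : K := if Wb b u then (- vK^-1) ^+ len u else 0.
have h : \sum_u f u ^+ 2 = 0.
  rewrite -[RHS]h0 /Pb [RHS]big_mkcond; apply: eq_bigr => u _; rewrite /f.
  by case: ifP => _; rewrite ?expr0n // -exprM mulnC.
have := sumsq_eq0 h 1%g; rewrite /f Wb1 len1 expr0 => /eqP.
by rewrite oner_eq0.
Qed.

Lemma Pb_neq0 l : Pb (prow l) (- vK^-1) != 0.
Proof. exact: Pbz_neq0. Qed.

Definition eh l : H := (Pb (prow l) (- vK^-1))^-1 *: e_ l.

Lemma eh_idem l : eh l * eh l = eh l.
Proof.
by rewrite /eh -scalerAl -scalerAr e_sq [_^-1 *: (Pb _ _ *: _)]scalerA mulVf ?Pb_neq0 // scale1r.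
Qed.

Lemma idem_trace k (M : 'M[K]_k) : M *m M = M -> \tr M = (\rank M)%:R.
Proof.
move=> hM; rewrite -{1}(mulmx_base M) mxtrace_mulC.
suff -> : row_base M *m col_base M = 1%:M by rewrite mxtrace1.
apply: (row_full_inj (col_base_full M)); apply: (row_free_inj (row_base_free M)).
rewrite mulmx1 mulmxA mulmx_base -mulmxA mulmx_base; exact: hM.
Qed.

Lemma matrix_unit_ex l k p : exists h, X l h = delta_mx k p.
Proof.
exists ((schur l)^-1 *: \sum_w rho l w^-1%g p k *: T w); apply/matrixP => i j.
rewrite linearZ linear_sum /= mxE summxE.
rewrite (eq_bigr (fun w => rho l w i j * rho l w^-1%g p k)) => [|w _]; last first.
  by rewrite linearZ /= mxE XT mulrC.
by rewrite schurP mxE mulrC mulfK ?schur_neq0.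
Qed.

(** Inserting a matrix unit between [e_ l] and [E_ l], whose products lie on a line, shows that all
    columns of the idempotent are multiples of one column of [X l (star B)]. A nonzero idempotent of
    rank one has trace 1. *)
Lemma tr_eh l : \tr (X l (eh l)) = 1.
Proof.
rewrite idem_trace; last by rewrite -XM // eh_idem.
suff -> : \rank (X l (eh l)) = 1%N by [].
apply/eqP; rewrite eqn_leq; apply/andP; split; last first.
  rewrite lt0n mxrank_eq0 /eh linearZ /= scaler_eq0 invr_eq0 (negbTE (Pb_neq0 l)).
  exact: X_e_neq0.
have [B [_ hB]] := E_C_line l.
have hB' h : exists c : K, e_ l * h * E_ l = c *: star B.
  have [c hc] := hB (star h); exists c; have := congr1 (@star n) hc.
  by rewrite !starM linearZ /= !star_eb starK mulrA.
have [q [r hqt]] : exists q r, X l (E_ l) q r != 0.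
  have := X_E_neq0 l => h; suff /existsP[q /existsP[r ht]] : [exists q, exists r, X l (E_ l) q r != 0].
    by exists q, r.
  apply: contraNT h; rewrite negb_exists => /forallP h; apply/eqP/matrixP => q r.
  by have := h q; rewrite negb_exists mxE => /forallP /(_ r); rewrite negbK => /eqP.
have hcol p : exists c : K, forall i, X l (eh l) i p = X l (star B) i r * c.
  have [h hh] := matrix_unit_ex p q.
  have [c hc] := hB' h; exists (c / X l (E_ l) q r / Pb (prow l) (- vK^-1)) => i.
  have := congr1 (fun g => X l g i r) hc; rewrite !XM // hh linearZ /= [RHS]mxE mxE.
  rewrite (bigD1 q) //= big1 ?addr0 => [|k hk]; rewrite mxE; last first.
    by rewrite big1 ?mul0r // => k' _; rewrite mxE (negbTE hk) andbF mulr0.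
  rewrite (bigD1 p) //= mxE !eqxx mulr1 big1 ?addr0 => [|k hk]; last by rewrite mxE (negbTE hk) mulr0.
  move=> e; rewrite /eh linearZ /= mxE !mulrA [X l (star B) i r * c]mulrC -e.
  by rewrite mulfK // mulrC.
have /fin_all_exists[c hc] := hcol.
have -> : X l (eh l) = (\col_i X l (star B) i r) *m (\row_p c p).
  by apply/matrixP => i p; rewrite hc mxE big_ord1 !mxE.
exact: mulmx_max_rank.
Qed.

Lemma inv_rescale (F : fieldType) (x y c : F) : y != 0 -> (x * c)^-1 = (y * c)^-1 * (y * x^-1).
Proof. by move=> hy; rewrite !invfM mulrACA mulVf // mul1r mulrC. Qed.

Lemma vK_expB k p : (k <= p)%N -> vK ^+ (p - k) = vK ^+ p / vK ^+ k.
Proof. by move=> h; rewrite expfB_cond // (negbTE vK_neq0). Qed.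

Lemma ua_Pb_loc l : locTerm 0 (ua l * Pb (prow l) (- vK^-1)) 1.
Proof.
have hw := wlongP l; apply: (@loc_eq _ _ (\sum_(u | Wb (prow l) u) (u == wlong l)%:R)).
  rewrite (bigD1 (wlong l)) /=; last by case: hw.
  by rewrite eqxx big1 ?addr0 // => u /andP[_ /negbTE ->].
rewrite mulr_sumr; apply: loc_sum => u hu.
have hle : (len u <= a l)%N by case: hw => _; apply.
have -> : ua l * (- vK^-1) ^+ (2 * len u) = vK ^+ (a l - len u) * vK ^+ (a l - len u).
  by rewrite exprM sqrrN -exprM mulnC exprM expr2 exprVn /ua mulrACA vK_expB.
case: eqVneq => [->|hne]; first by rewrite subnn expr0 mulr1; exact: loc1.
have : (0 < a l - len u)%N.
  rewrite subn_gt0 ltn_neqAle hle andbT; apply: contra hne => /eqP e.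
  by apply/eqP/(longest_of_len (@row_mono n l) hw hu e).
case: (a l - len u)%N => [//|k _]; rewrite exprS -mulrA.
apply: loc_eq (locM (loc_v 0) (locM (locX k (loc_v 0)) (locM (loc_v 0) (locX k (loc_v 0))))).
by rewrite mul0r.
Qed.

(** Apply [tau_formula] to the idempotent [eh l], whose coefficient at 1 is the inverse of [Pb], and
    divide by [ua l]. At [v = 0] the left side is 1 and the right side keeps only the term of [l],
    which is the inverse of [schur0 l]. *)
Lemma schur0_1 l : schur0 l = 1.
Proof.
have ht m : \tr (X m (eh l)) = (\rank (X m (eh l)))%:R.
  by apply: idem_trace; rewrite -XM // eh_idem.
have e1 : (ua l * Pb (prow l) (- vK^-1))^-1 = \sum_m (ua l * schur m)^-1 * \tr (X m (eh l)).
  rewrite (invfM (ua l)); have := tau_formula (eh l); rewrite {1}/eh hE_scale ebE Wb1 len1 mulr1 => ->.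
  by rewrite mulr_sumr; apply: eq_bigr => m _; rewrite mulrA (invfM (ua l)).
have h1 : locTerm 0 (ua l * Pb (prow l) (- vK^-1))^-1 1^-1.
  exact: locV (oner_neq0 _) (ua_Pb_loc l).
have hf m : (schur0 m)%:~R != 0 :> Real by rewrite intr_eq0 gt_eqF ?schur0_gt0.
have h2 : locTerm 0 (\sum_m (ua l * schur m)^-1 * \tr (X m (eh l))) (schur0 l)%:~R^-1.
  rewrite (bigD1 l) //= tr_eh mulr1 -[Y in locTerm _ _ Y]addr0; apply: locD.
    exact: locV (hf l) (ua_schur_loc l).
  apply: (@loc_eq _ _ (\sum_(m | m != l) 0)); first by rewrite big1.
  apply: loc_sum => m hm.
  case: (eqVneq (X m (eh l)) 0) => [->|hX]; first by rewrite mxtrace0 mulr0; exact: loc0.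
  have hlm : sdomlt l m.
    rewrite /sdomlt eq_sym hm andbT; apply: X_e_dom; apply: contra_neq hX => e.
    by rewrite /eh linearZ /= e scaler0.
  have ha : (a l < a m)%N.
    rewrite (longest_len (@row_mono n l) (wlongP l)) (longest_len (@row_mono n m) (wlongP m)).
    exact: Nb_strict.
  have hu0 q : ua q != 0 by rewrite mulf_neq0 ?expf_neq0 ?vK_neq0.
  (* Renormalizing the Schur element of [m] by its own power of [v] leaves a factor
     [v ^ (2 (a m - a l))], which vanishes at 0. *)
  have -> : (ua l * schur m)^-1 = (ua m * schur m)^-1 * (vK ^+ (a m - a l) * vK ^+ (a m - a l)).
    by rewrite vK_expB ?(ltnW ha) // mulrACA -invfM; apply: inv_rescale; exact: hu0.
  rewrite ht; apply: loc_eq (locM (locM (locV (hf m) (ua_schur_loc m)) (locM (locX _ (loc_v 0)) (locX _ (loc_v 0)))) (loc_nat _ _)).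
  by rewrite -subn_gt0 in ha; rewrite expr0n -[(_ == _)%N]negbK -lt0n ha /= !mulr0 mul0r.
rewrite e1 in h1; have := loc_uniq h1 h2; rewrite invr1 => /esym /eqP.
by rewrite invr_eq1 -[1]/(1%:~R) eqr_int => /eqP.
Qed.

Lemma sumsq_int1 (I : finType) (f : I -> int) : \sum_i f i * f i = 1 ->
  exists i, f i * f i = 1 /\ forall j, j != i -> f j = 0.
Proof.
move=> h; have [i hi] : exists i, f i != 0.
  apply/existsP; apply: contra_eqT h; rewrite negb_exists => /forallP h.
  rewrite big1 // => i _; have := h i; rewrite negbK => /eqP ->; by rewrite mulr0.
have hsq j : 0 <= f j * f j by rewrite -expr2 sqr_ge0.
have h1 : 1 <= f i * f i by rewrite -gtz0_ge1 lt_neqAle eq_sym mulf_neq0 ?hsq.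
move: h; rewrite (bigD1 i) //= => h.
have hs : \sum_(j | j != i) f j * f j = 0.
  apply/eqP; rewrite eq_le sumr_ge0 ?andbT //.
  by rewrite -(lerD2l (f i * f i)) addr0 h.
exists i; split; first by rewrite hs addr0 in h.
move=> j hj; move/eqP: hs; rewrite psumr_eq0 // => /allP /(_ j); rewrite mem_index_enum hj.
by move=> /(_ isT) /=; rewrite mulf_eq0 orbb => /eqP.
Qed.

Lemma cc_ex l i j : exists w, cc l w i j * cc l w i j = 1 /\ forall y, y != w -> cc l y i j = 0.
Proof. by apply: sumsq_int1; rewrite gram_eq !eqxx schur0_1. Qed.

(** The dual orthogonality: the trace of [T w * T w^-1] is 1, and its constant term is the sum of
    the squares of all leading coefficients at [w]. *)
Lemma cc_cover w : exists t : {l : part n & ('I_(d l) * 'I_(d l))%type},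
  (cc (tag t) w (tagged t).1 (tagged t).2 != 0) /\
  forall t' : {l : part n & ('I_(d l) * 'I_(d l))%type},
    cc (tag t') w (tagged t').1 (tagged t').2 != 0 -> t' = t.
Proof.
pose f (t : {l : part n & ('I_(d l) * 'I_(d l))%type}) := cc (tag t) w (tagged t).1 (tagged t).2.
have [|t [h1 h2]] := @sumsq_int1 _ f.
  apply: (@intr_inj Real).
  rewrite -(sig_big_dep xpredT (fun _ => xpredT) (fun l (ij : 'I_(d l) * 'I_(d l)) => cc l w ij.1 ij.2 * cc l w ij.1 ij.2)) /=.
  under eq_bigr => l _ do rewrite -(pair_big xpredT xpredT (fun i j => cc l w i j * cc l w i j)) /=.
  have e : \sum_l (schur l)^-1 * \tr (X l (T w * T w^-1%g)) = 1 by rewrite -tau_formula tau_TT eqxx.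
  have h := loc1 0; rewrite -e in h; apply/esym/(loc_uniq h).
  rewrite rmorph_sum /=; apply: loc_sum => l _.
  have -> : (schur l)^-1 * \tr (X l (T w * T w^-1%g)) = (ua l * schur l)^-1 *
     \sum_i \sum_j (vK ^+ a l * rho l w i j) * (vK ^+ a l * rho l w^-1%g j i).
    rewrite (invfM (ua l)) -mulrA mulrCA; congr (_ * _).
    rewrite XM // !XT /mxtrace; under [Y in _ * Y]eq_bigr => i _ do under eq_bigr => j _ do rewrite mulrACA -/(ua l).
    rewrite mulr_sumr; apply: eq_bigr => i _; rewrite mxE mulr_sumr; apply: eq_bigr => j _.
    by rewrite mulKf // mulf_neq0 ?expf_neq0 ?vK_neq0.
  rewrite -[Y in locTerm _ _ Y]mul1r; apply: locM.
    have := locV _ (ua_schur_loc l); rewrite schur0_1 invr1; apply; exact: oner_neq0.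
  rewrite rmorph_sum /=; apply: loc_sum => i _; rewrite rmorph_sum /=; apply: loc_sum => j _.
  apply: loc_eq (locM (ccP w i j) (ccP w^-1%g j i)).
  by rewrite lenV mulrACA -expr2 -exprM mulnC exprM sqrrN !expr1n mul1r ccV -intrM.
exists t; split=> [|t' h']; last by apply/eqP; apply: contraNT h' => /h2; rewrite /f => ->.
by apply/eqP => e; move: h1; rewrite /f e mulr0 => /eqP; rewrite eq_sym oner_eq0.
Qed.

Lemma cc_uniq_lij w l m i j p k : cc l w i j != 0 -> cc m w p k != 0 ->
  Tagged (fun l => ('I_(d l) * 'I_(d l))%type) (i, j) = Tagged (fun l => ('I_(d l) * 'I_(d l))%type) (p, k).
Proof.
have [t [_ ht]] := cc_cover w => h1 h2.
by rewrite (ht (Tagged _ (i, j))) // (ht (Tagged _ (p, k))).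
Qed.
End Family.

(** * The integral form of the Hecke algebra *)

Section IntegralForm.
Variable n : nat.
Local Notation W := 'S_n.
Local Notation H := (heck n).
Local Notation T := (@T n).
Local Infix "**" := (@wmul n) (at level 40, left associativity).
Implicit Types (w x y z s t u : 'S_n) (h g : heck n) (l m : part n).

Lemma inH0 : inH (0 : H). Proof. by move=> y; rewrite hE_zero; exact: inA0. Qed.
Lemma inHD h g : inH h -> inH g -> inH (h + g).
Proof. by move=> hh hg y; rewrite hE_add; apply: inAD. Qed.
Lemma inHZ c h : inA c -> inH h -> inH (c *: h).
Proof. by move=> hc hh y; rewrite hE_scale; apply: inAM. Qed.
Lemma inH_sum (I : Type) (r : seq I) (P : pred I) (f : I -> H) :
  (forall i, P i -> inH (f i)) -> inH (\sum_(i <- r | P i) f i).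
Proof.
move=> h; apply: (big_rec (@inH n)); first exact: inH0.
by move=> i x /h; apply: inHD.
Qed.
Lemma inHT w : inH (T w). Proof. by move=> y; rewrite TE; exact: inA_nat. Qed.
Lemma inH_star h : inH h -> inH (star h). Proof. by move=> hh y; rewrite starE. Qed.
Lemma inHM h g : inH h -> inH g -> inH (h * g).
Proof.
move=> hh hg; have hT w : inH (T w * g).
  elim/len_ind: w => [|s w hs hl IH]; first by rewrite T1 mul1r.
  rewrite -(TsT_up hs hl) -mulrA TsM // => y; rewrite LsmE; apply: inAD => //.
  case: ifP => _; last exact: inA0.
  by apply: inAM => //; apply: inAB; [exact: inAv | exact: inAvV].
rewrite (heck_sum h) mulr_suml; apply: inH_sum => w _; rewrite -scalerAl.
exact: inHZ.
Qed.
Lemma inA_vz : inA (- vK^-1). Proof. by apply/inAN/inAvV. Qed.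
End IntegralForm.

(** * Integrality and bar-invariance of the elements Z *)

Section ZElement.
Variable n : nat.
Local Notation W := 'S_n.
Local Notation H := (heck n).
Local Notation T := (@T n).
Local Infix "**" := (@wmul n) (at level 40, left associativity).
Implicit Types (w x y z s t u : 'S_n) (h g : heck n) (l m : part n).
Variable C : W -> hecke n.
Hypothesis HC : isKL C.
Local Notation C' := (CC C).
Local Notation a l := (len (wlong l)).
Local Notation PP l := (Pb (prow l) (- vK^-1)).

Lemma inHC w : inH (C' w).
Proof. by move=> y; apply: inZv_inA; exact: CC_Zv. Qed.

Lemma CC_wl_sq l : C' (wlong l) * C' (wlong l) = ((- vK) ^+ a l * PP l) *: C' (wlong l).
Proof.
by rewrite (CC_wl HC) -scalerAl -scalerAr e_sq !scalerA mulrAC.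
Qed.

(** This is the scalar by which the square of the bar-invariant element [C_{w_l}] is a multiple of
    that element. *)
Lemma bar_cPP l : bar ((- vK) ^+ a l * PP l) = (- vK) ^+ a l * PP l.
Proof.
have hC0 : C' (wlong l) != 0.
  by apply: contra_neq (CC_w_neq0 HC (wlong l)) => ->; rewrite hE_zero.
have := congr1 (@hbar n) (CC_wl_sq l); rewrite hbarM hbarZ hbarC // CC_wl_sq.
move=> /eqP; rewrite -subr_eq0 -scalerBl scaler_eq0 (negbTE hC0) orbF subr_eq0.
by move=> /eqP.
Qed.

Lemma Plam_PP l : Plam l = (ua l) * PP l.
Proof.
have e := bar_cPP l.
have ePP : bar (PP l) = Plam l.
  rewrite PlamE /Pb rmorph_sum /=; apply: eq_bigr => u _.
  by rewrite barX barN barV bar_v invrK !exprM sqrrN.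
rewrite barM barX barN bar_v ePP in e.
have -> : Plam l = (- vK) ^+ a l * ((- vK^-1) ^+ a l * Plam l).
  by rewrite mulrA -exprMn mulrNN mulfV ?vK_neq0 // expr1n mul1r.
by rewrite e mulrA -exprMn mulrNN exprMn.
Qed.

Lemma Plam_neq0 l : Plam l != 0.
Proof.
have hv : vK ^+ a l != 0 by apply: expf_neq0; exact: vK_neq0.
by rewrite Plam_PP; apply: mulf_neq0; [exact: mulf_neq0 | exact: Pb_neq0].
Qed.

Fact mul_shuffle (R : comNzRingType) (p s x q : R) :
  p * s * x * (s * x * q) = s * s * (p * (x * x * q)).
Proof. by ring. Qed.

Definition gx l x : H := \sum_(y | binc (prow l) y) C' (x ** wlong l) (y ** wlong l) *: T y.
Lemma inH_gx l x : inH (gx l x).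
Proof.
apply: inH_sum => y _; apply: inHZ; last exact: inHT.
by apply: inZv_inA; exact: CC_Zv.
Qed.
Lemma gx_C l x : binc (prow l) x -> C' (x ** wlong l) = gx l x * C' (wlong l).
Proof.
move=> hx; rewrite {1}(CC_xwl HC hx) /gx mulr_suml; apply: eq_bigr => y _.
by rewrite -scalerAl.
Qed.

(** [Z_w] with its denominator cancelled: both Kazhdan-Lusztig factors are integral multiples of
    [C_{w_l}], and [kappa] is the inverse of the scalar produced by squaring [C_{w_l}]. This form
    shows integrality, [Zel_kappa] shows bar-invariance. *)
Definition Zel l x y : H := gx l x * C' (wlong l) * star (gx l y).

Lemma C_wlV l : star (C' (wlong l)) = C' (wlong l).
Proof. by rewrite (starC HC) (longestV (@row_mono n l) (wlongP l)). Qed.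

Definition kappa l : K := (Plam l)^-1 * eps (wlong l) * vK ^+ a l.

Lemma kappa_sq l : kappa l * ((- vK) ^+ a l * PP l) = 1.
Proof.
have es : eps (wlong l) * eps (wlong l) = 1 by rewrite -expr2 -exprM mulnC exprM sqrrN !expr1n.
have -> : (- vK) ^+ a l = eps (wlong l) * vK ^+ a l by rewrite -mulN1r exprMn.
by rewrite /kappa mul_shuffle es mul1r -/(ua l) -Plam_PP mulVf // Plam_neq0.
Qed.

Lemma Zw_Zel l x y : binc (prow l) x -> binc (prow l) y -> Zw C l x y = Zel l x y.
Proof.
move=> hx hy; rewrite /Zw hscaleE hmulE -/(kappa l).
have -> : C (wmul (wlong l) y^-1%g) = C' (wlong l) * star (gx l y).
  rewrite -C_wlV -starM -gx_C // (starC HC); congr C.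
  by rewrite wmulV (longestV (@row_mono n l) (wlongP l)).
have -> : C (wmul x (wlong l)) = gx l x * C' (wlong l) by rewrite -gx_C.
rewrite mulrA -(mulrA (gx l x)) CC_wl_sq -scalerAr -scalerAl scalerA kappa_sq.
by rewrite scale1r.
Qed.

Lemma Zel_kappa l x y : binc (prow l) x -> binc (prow l) y ->
  Zel l x y = kappa l *: (C' (x ** wlong l) * star (C' (y ** wlong l))).
Proof.
move=> hx hy; rewrite !gx_C // starM C_wlV mulrA -(mulrA (gx l x)) CC_wl_sq.
by rewrite -scalerAr -scalerAl scalerA kappa_sq scale1r.
Qed.

Lemma bar_kappa l : bar (kappa l) = kappa l.
Proof.
have h : bar (kappa l) * ((- vK) ^+ a l * PP l) = kappa l * ((- vK) ^+ a l * PP l).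
  by rewrite -{1}bar_cPP -barM kappa_sq bar1.
apply: mulIf h.
by apply/eqP => e; have /eqP := kappa_sq l; rewrite e mulr0 eq_sym oner_eq0.
Qed.

Lemma hbar_Zel l x y : binc (prow l) x -> binc (prow l) y -> hbar (Zel l x y) = Zel l x y.
Proof.
by move=> hx hy; rewrite Zel_kappa // hbarZ bar_kappa hbarM hbar_star !(hbarC HC).
Qed.

Lemma inH_Zel l x y : inH (Zel l x y).
Proof.
by apply: inHM; [apply: inHM; [exact: inH_gx | exact: inHC] | apply: inH_star; exact: inH_gx].
Qed.
End ZElement.

(** * Garnir relations *)

(* In the parabolic subgroup of the interval [pa, pb] that joins the end of
   a row of [l] to the beginning of the next one, the sum [gG] over minimal coset
   representatives is, up to the scalar [Pb b2], the product [eA * e_ l]. *)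
Section Garnir.
Variable n : nat.
Local Notation W := 'S_n.
Local Notation H := (heck n).
Local Notation T := (@T n).
Local Infix "**" := (@wmul n) (at level 40, left associativity).
Implicit Types (w x y z s t u : 'S_n) (h g : heck n).
Local Notation zeta := (- vK^-1).
Variables (l : part n) (r c : nat) (pa pb : 'I_n).
Hypotheses (hc : (c < lam l r.+1)%N) (hpa : pa = (partsum l r + c)%N :> nat)
  (hpb : pb = (partsum l r.+1 + c)%N :> nat).

Definition inI (p : 'I_n) := (pa <= p <= pb)%N.
(** Three block functions: [cA] has the interval as its only nontrivial block, [bA] adds the rows
    above row [r], and [b2] cuts the interval at the end of row [r]. Each value is the first point
    of the block, which makes them monotone. *)
Definition cA (p : 'I_n) : nat := if inI p then pa else p.
Definition bA (p : 'I_n) : nat :=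
  if (p < partsum l r)%N then partsum l (prow l p) else cA p.
Definition b2 (p : 'I_n) : nat :=
  if inI p then (if prow l p == r then (pa : nat) else partsum l r.+1) else p.

Lemma pa_bounds : [/\ (partsum l r <= pa)%N, (pa < partsum l r.+1)%N, (partsum l r.+1 <= pb)%N &
  (pb < partsum l r.+2)%N].
Proof.
have := lam_anti l (leqnSn r); have := hpa; have := hpb; have := hc; rewrite !partsumS.
by move=> ? ? ? ?; split; lia.
Qed.

Lemma inI_row p : inI p -> prow l p = if (p < partsum l r.+1)%N then r else r.+1.
Proof.
have [h1 h2 h3 h4] := pa_bounds; case/andP=> h5 h6; case: ifP => h; apply: row_uniq; lia.
Qed.

Lemma cA_mono (p q : 'I_n) : (p <= q)%N -> (cA p <= cA q)%N.
Proof. by rewrite /cA /inI; case: ifP; case: ifP; lia. Qed.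

Lemma bA_mono (p q : 'I_n) : (p <= q)%N -> (bA p <= bA q)%N.
Proof.
have [h1 h2 h3 h4] := pa_bounds; have [_ hp _] := row_spec l p.
move=> h; have hr := partsum_mono l (row_mono l h); move: hr hp.
by rewrite /bA /cA /inI; do ![case: ifP]; lia.
Qed.

Lemma b2_mono (p q : 'I_n) : (p <= q)%N -> (b2 p <= b2 q)%N.
Proof.
have [h1 h2 h3 h4] := pa_bounds; rewrite /b2 => h.
case: (boolP (inI p)) => hp; case: (boolP (inI q)) => hq.
- rewrite (inI_row hp) (inI_row hq); do ![case: ifP]; lia.
- move: hp hq; rewrite /inI; case: ifP; lia.
- move: hp hq; rewrite /inI; case: ifP => // /eqP e; first by lia.
  move=> hp /andP[hq1 hq2]; lia.
- by [].
Qed.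

Local Notation eA := (eb cA zeta).

Lemma b2_cA p q : adj p q -> b2 p = b2 q -> cA p = cA q /\ prow l p = prow l q.
Proof.
have [h1 h2 h3 h4] := pa_bounds; move=> /eqP /= hpq; rewrite /b2 /cA.
case: (boolP (inI p)) => hp; case: (boolP (inI q)) => hq.
- rewrite (inI_row hp) (inI_row hq); do ![case: ifP => //]; lia.
- move: hp hq; rewrite /inI; case: ifP; lia.
- move: hp hq; rewrite /inI; case: ifP; lia.
- by lia.
Qed.

Definition gG : H := \sum_(z | Wb cA z && binc b2 z) zeta ^+ len z *: (T z * e_ l).

Lemma eb2_e : eb b2 zeta * e_ l = Pb b2 zeta *: e_ l.
Proof.
rewrite {1}eb_sum /Pb mulr_suml scaler_suml; apply: eq_bigr => u hu.
have : T u * e_ l = zeta ^+ len u *: e_ l.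
  move: u hu; apply: (Wb_ind b2_mono) => [|u i j hu hij e hl IH].
    by rewrite T1 mul1r len1 scale1r.
  have hg : tperm i j \in gens n by apply/gensP; exists i, j.
  have [_ er] := b2_cA hij e.
  rewrite -(TTs_up hg hl) -mulrA (Ts_eb vz0 vzq hij er) -scalerAr IH scalerA.
  by rewrite (len_genSr hg hl) exprS.
by move=> e; rewrite -scalerAl e scalerA -exprD addnn mul2n.
Qed.

Lemma eA_gG : eA * e_ l = Pb b2 zeta *: gG.
Proof.
have hz i j : adj i j -> b2 i = b2 j -> eA * T (tperm i j) = zeta *: eA.
  by move=> hij /(b2_cA hij)[e _]; apply: (eb_Ts vz0 vzq hij e).
rewrite {1}(right_eigen_expand b2_mono hz) mulr_suml /gG scaler_sumr.
rewrite [RHS]big_mkcond [LHS]big_mkcond; apply: eq_bigr => z _.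
case: (boolP (binc b2 z)) => hb; rewrite ?andbF // andbT ebE.
case: ifP => _; last by rewrite scale0r mul0r.
by rewrite -scalerAl -mulrA eb2_e -scalerAr !scalerA mulrC.
Qed.

(** Generators inside the rows above row [r] fix the interval, so they commute with [eA] and act on
    [e_ l]; those inside the interval act on [eA] itself. *)
Lemma eA_left i j : adj i j -> bA i = bA j -> T (tperm i j) * (eA * e_ l) = zeta *: (eA * e_ l).
Proof.
move=> hij e; have [h1 h2 h3 h4] := pa_bounds; rewrite mulrA.
have hg : tperm i j \in gens n by apply/gensP; exists i, j.
have [[hlt er]|ec] : ((j < partsum l r)%N /\ prow l i = prow l j) \/ cA i = cA j.
  have /eqP /= hij' := hij.
  have [hi1 hi2 hi3] := row_spec l i; have [hj1 hj2 hj3] := row_spec l j.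
  move: e; rewrite /bA; case: ifP => hi; case: ifP => hj; last by right.
  - move=> e; left; split=> //; have hle : (prow l i <= prow l j)%N by apply: row_mono; lia.
    apply/eqP; rewrite eqn_leq hle /=.
    rewrite leqNgt; apply/negP => /(partsum_mono l); lia.
  - by rewrite /cA; case: ifP; lia.
  - by lia.
have hcom : T (tperm i j) * eA = eA * T (tperm i j).
  rewrite eb_sum mulr_suml mulr_sumr; apply: eq_bigr => u hu.
  rewrite -scalerAr -scalerAl; congr (_ *: _).
  have hfix (k : 'I_n) : (k < partsum l r)%N -> u k = k.
    move=> hk; have := WbP _ _ hu k; rewrite /cA /inI.
    case: ifP => h5; case: ifP => h6; try by lia.
    by move=> e1; apply/val_inj.
  have ec : tperm i j ** u = u ** tperm i j.
    have /eqP /= hij' := hij.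
    by apply/permP => k; rewrite !wmulE [RHS](inj_tperm _ _ _ perm_inj) (hfix i) ?(hfix j) //; lia.
  by rewrite TsTw // TwTs // ec.
  by rewrite hcom -mulrA (Ts_eb vz0 vzq hij er) scalerAr.
by rewrite (Ts_eb vz0 vzq hij ec) scalerAl.
Qed.

Lemma eA_bA : exists k, eA * e_ l = eb bA zeta * k.
Proof.
have hz i j : adj i j -> bA i = bA j ->
    star (eA * e_ l) * T (tperm i j) = zeta *: star (eA * e_ l).
  move=> hij e; have := congr1 (@star n) (eA_left hij e).
  by rewrite starM starT tpermV linearZ.
have hf f : (forall i j, adj i j -> bA i = bA j -> f * T (tperm i j) = zeta *: f) ->
    star f = eb bA zeta * \sum_(x | binc bA x) f x *: T x^-1%g.
  move=> hfz; rewrite {1}(right_eigen_expand bA_mono hfz) linear_sum mulr_sumr.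
  by apply: eq_bigr => x _; rewrite linearZ /= starM star_eb starT scalerAr.
by have := hf _ hz; rewrite starK => ->; eexists.
Qed.

Definition gS : {set 'I_n} := [set p : 'I_n | (p < partsum l r)%N || inI p].
Definition gB : seq nat := (pa : nat) :: [seq partsum l i | i <- iota 0 r].

Lemma gS_gB : {in gS, forall p, bA p \in gB}.
Proof.
move=> p; rewrite inE /bA /cA; case: ifP => [hp _|_ /= ->]; last by rewrite inE eqxx.
rewrite inE; apply/orP; right; apply/mapP; exists (prow l p) => //.
by rewrite mem_iota add0n row_lt.
Qed.

(** The interval has one point more than row [r], while [gB] has [r + 1] values: this excess is what
    violates the Gale-Ryser condition. *)
Lemma gS_card : (partsum l (size gB) < #|gS|)%N.
Proof.
have [h1 h2 h3 h4] := pa_bounds; rewrite /= size_map size_iota.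
have -> : gS = [set p : 'I_n | (p < pb.+1)%N] :\: [set p : 'I_n | (p < pa)%N] :|: [set p : 'I_n | (p < partsum l r)%N].
  by apply/setP => p; rewrite !inE /inI ltnS -leqNgt orbC.
rewrite cardsU (_ : _ :&: _ = set0); last first.
  by apply/setP => p; rewrite !inE; apply/negP => /andP[/andP[]]; lia.
rewrite cards0 subn0 cardsD (_ : _ :&: _ = [set p : 'I_n | (p < pa)%N]); last first.
  by apply/setP => p; rewrite !inE; case: (ltnP p pa) => h; rewrite ?andbF ?andbT //; lia.
rewrite !card_ord_lt ?partsum_le //; last by rewrite ltnW.
have := hpb; have := hpa; rewrite !partsumS; lia.
Qed.

(* A permutation increasing on the two rows that meets the interval in the wrong order is
   [x0 ** u], where [u] inverts all pairs of the interval lying in different rows. *)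
Definition gR : {set 'I_n * 'I_n} :=
  [set p : 'I_n * 'I_n | [&& inI p.1, inI p.2, (p.1 < p.2)%N & prow l p.1 != prow l p.2]].

Lemma invset_gR z : Wb cA z -> binc b2 z -> invset z \subset gR.
Proof.
move=> hz hb; apply/subsetP => -[p q]; rewrite !inE /= => /andP[hpq hlt].
have hzc := WbP _ _ hz.
have hin k : ~~ inI k -> z k = k.
  move=> hk; have := hzc k; rewrite {2}/cA (negbTE hk) /cA.
  case: ifP => [h5 e|_ e]; last exact/val_inj.
  by move: hk; rewrite /inI -e leqnn /=; have [] := pa_bounds; lia.
have hst k : inI k -> inI (z k).
  move=> hk; apply: contraT => hn; have := hin _ hn => /perm_inj e.
  by rewrite e hk in hn.
have hp : inI p.
  apply: contraT => hn; have e := hin _ hn; rewrite e in hlt.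
  case: (boolP (inI q)) => hq; last by rewrite (hin _ hq) in hlt; lia.
  by have := hst _ hq; move: hq hn; rewrite /inI; lia.
have hq : inI q.
  apply: contraT => hn; have e := hin _ hn; rewrite e in hlt.
  by have := hst _ hp; move: hp hn; rewrite /inI; lia.
rewrite hp hq hpq /=; apply/negP => /eqP e.
have := binc_lt b2_mono hb _ hpq; rewrite /b2 hp hq e => /(_ erefl); lia.
Qed.

Lemma invset_inj (z u : W) : invset z = invset u -> z = u.
Proof.
move=> e; have e1 : z ** u^-1%g = 1%g.
  apply: mono_perm1 => i j /eqP /= hij; rewrite !wmulE.
  have hne : u^-1%g i != u^-1%g j by rewrite (inj_eq perm_inj) -val_eqE /= hij; lia.
  have hne' : (val (u^-1%g i) != val (u^-1%g j)) by rewrite val_eqE.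
  case: (ltngtP (u^-1%g i) (u^-1%g j)) hne' => // h _.
    have := congr1 (fun S : {set _} => (u^-1%g i, u^-1%g j) \in S) e.
    rewrite !inE /= h !permKV /= (_ : (j < i)%N = false); last by lia.
    by move/negbT; rewrite -leqNgt leq_eqVlt val_eqE (inj_eq perm_inj) (negbTE hne).
  have := congr1 (fun S : {set _} => (u^-1%g j, u^-1%g i) \in S) e.
  by rewrite !inE /= h !permKV /= (_ : (i < j)%N = true) //; lia.
by rewrite -[z](wmulVr u) e1 w1mul.
Qed.

Section Violation.
Variable x : W.
Hypotheses (hx : binc (prow l) x) (hab : (x pb < x pa)%N).

(** For [p] in row [r] and [q] in the next row, [x q <= x pb < x pa <= x p]. Hence [u] inverts every
    pair that a representative can invert, and it is the unique longest one. *)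
Lemma garnir_dec : exists x0 u, [/\ x = x0 ** u, binc cA x0, Wb cA u, binc b2 u &
  forall z, Wb cA z -> binc b2 z -> z != u -> (len z < len u)%N].
Proof.
have [x0 [u [ex h0 hu]]] := block_dec cA x; exists x0, u.
have hlt p q : cA p = cA q -> (x p < x q)%N -> (u p < u q)%N.
  move=> ec; rewrite ex !wmulE => h; rewrite ltnNge leq_eqVlt; apply/negP => /orP[/eqP/val_inj e|h'].
    by rewrite e ltnn in h.
  have := binc_lt cA_mono h0 _ h'; rewrite !(WbP _ _ hu) ec => /(_ erefl); lia.
have hb2 : binc b2 u.
  apply/bincP => i j hij e; have [ec er] := b2_cA hij e; apply: hlt => //.
  by move/bincP: hx; apply.
have hinv : invset u = gR.
  apply/eqP; rewrite eqEsubset invset_gR //=; apply/subsetP => -[p q].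
  rewrite !inE /= => /and4P[hp hq hpq hr]; rewrite hpq /=; apply: hlt.
    by rewrite /cA hp hq.
  have [h1 h2 h3 h4] := pa_bounds.
  have hrp := inI_row hp; have hrq := inI_row hq; move: hr; rewrite hrp hrq.
  case: ifP => h5; case: ifP => h6; rewrite ?eqxx //; last by lia.
  move=> _; rewrite h5 in hrp; rewrite h6 in hrq.
  have hra : prow l pa = r by apply: row_uniq; lia.
  have hrb : prow l pb = r.+1 by apply: row_uniq; lia.
  have e1 : (x pa <= x p)%N.
    case: (eqVneq pa p) => [->//|hne]; apply: ltnW; apply: (binc_lt (@row_mono n l) hx).
      by rewrite hra hrp.
    by rewrite ltn_neqAle val_eqE hne; case/andP: hp.
  have e2 : (x q <= x pb)%N.
    case: (eqVneq q pb) => [->//|hne]; apply: ltnW; apply: (binc_lt (@row_mono n l) hx).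
      by rewrite hrb hrq.
    by rewrite ltn_neqAle val_eqE hne; case/andP: hq.
  by apply: leq_ltn_trans e2 _; apply: leq_trans hab e1.
split=> // z hz hbz hne; rewrite !lenE.
change (#|invset z| < #|invset u|)%N; rewrite hinv; apply: proper_card.
rewrite properEneq invset_gR // andbT; apply: contra hne => /eqP e.
by apply/eqP/invset_inj; rewrite e hinv.
Qed.

(** [T x0 * gG] has the multiple of [T x * e_ l] as its longest term; solving for it produces [R].
    The Poincare polynomial [c0] need not be invertible in [A], so [R] is described twice: over [K]
    it factors through [eb bA], which decides where it vanishes, and with an integral left factor it
    is a multiple of [e_ l]. *)
Lemma garnir_rel : exists (R : H) (s : W -> K) (g k k' : H) (c0 : K),
  [/\ T x * e_ l = \sum_(y | (len y < len x)%N) s y *: (T y * e_ l) + R,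
      forall y, inA (s y), c0 != 0, c0 *: R = g * eb bA zeta * k & R = k' * e_ l /\ inH k'].
Proof.
have [x0 [u [ex h0 hu hb hmax]]] := garnir_dec.
have hz k : zeta ^+ k != 0 by apply: expf_neq0; exact: vz0.
have hzA k : inA (zeta ^+ k)^-1.
  by rewrite -exprVn invrN invrK; apply/inAX/inAN/inAv.
pose Q z := Wb cA z && binc b2 z.
have hl z : Wb cA z -> len (x0 ** z) = (len x0 + len z)%N.
  exact: (len_binc_add cA_mono h0).
have hT z : Q z -> T x0 * (T z * e_ l) = T (x0 ** z) * e_ l.
  by case/andP=> h1 _; rewrite mulrA TT_add // hl.
have eG : T x0 * gG = zeta ^+ len u *: (T x * e_ l) +
    \sum_(z | Q z && (z != u)) zeta ^+ len z *: (T (x0 ** z) * e_ l).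
  rewrite /gG mulr_sumr (bigD1 u) /=; last by rewrite hu hb.
  rewrite -scalerAr hT /Q ?hu // -ex; congr (_ + _); apply: eq_bigr => z /andP[h1 _].
  by rewrite -scalerAr hT.
pose s y := if Q (x0^-1%g ** y) && (x0^-1%g ** y != u) then
   - ((zeta ^+ len u)^-1 * zeta ^+ len (x0^-1%g ** y)) else 0.
have [k hk] := eA_bA.
exists ((zeta ^+ len u)^-1 *: (T x0 * gG)), s, ((zeta ^+ len u)^-1 *: T x0), k,
  ((zeta ^+ len u)^-1 *: (T x0 * \sum_(z | Q z) zeta ^+ len z *: T z)), (Pb b2 zeta).
split.
- rewrite eG scalerDr scalerA mulVf // scale1r addrCA -[LHS]addr0; congr (_ + _).
  rewrite (reindex_inj (@wmulI _ x0)) /= scaler_sumr.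
  rewrite [Y in Y + _]big_mkcond [Y in _ + Y]big_mkcond -big_split big1 //= => z _.
  rewrite /s wmulVK; case: (boolP (Q z && (z != u))) => [/andP[hq hne]|_]; last first.
    by rewrite scale0r if_same addr0.
  have /andP[hq1 hq2] := hq.
  rewrite ex !hl // ltn_add2l hmax // scaleNr scalerA addrC subrr //.
- move=> y; rewrite /s; case: ifP => _; last exact: inA0.
  by apply/inAN/inAM => //; apply/inAX/inA_vz.
- exact: Pbz_neq0.
- rewrite scalerA mulrC -scalerA scalerAr -eA_gG hk -!scalerAl; congr (_ *: _).
  by rewrite mulrA.
- split; last first.
    apply: inHZ => //; apply: inHM; first exact: inHT.
    by apply: inH_sum => z _; apply: inHZ; [exact/inAX/inA_vz | exact: inHT].
  rewrite -scalerAl -mulrA mulr_suml; congr (_ *: (_ * _)).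
  by apply: eq_bigr => z _; rewrite scalerAl.
Qed.
End Violation.
End Garnir.

(** * Cells *)

Fact mul_shuffle2 (R : comNzRingType) (p s x : R) :
  s * s * (p * (x * x)) = p * s * x * (s * x).
Proof. by ring. Qed.

Fact sq_shuffle (R : comNzRingType) (s t c u e : R) :
  s * (t * c * (u * e)) * (s * (t * c * (u * e))) =
  s * s * (t * t) * (u * u) * (c * c) * (e * e).
Proof. by ring. Qed.

Section MainArgument.
Variables (n : nat) (d : part n -> nat) (rho : forall l : part n, 'S_n -> 'M[K]_(d l)).
Variable C : 'S_n -> hecke n.
Hypotheses (HC : isKL C) (Hrep : forall l, is_rep (rho l)) (Hirr : forall l, is_irr (rho l))
  (Hlab : labelling rho) (Horth : forall l, orthogonal_rep (rho l))
  (Hint : forall l, integral_ltc (rho l) l) (Hnorm : forall l, normalized (rho l) l).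
Local Notation W := 'S_n.
Local Notation H := (heck n).
Local Notation T := (@T n).
Local Notation C' := (CC C).
Local Infix "**" := (@wmul n) (at level 40, left associativity).
Implicit Types (w x y z s t u : 'S_n) (h g : heck n) (l m : part n).
Local Notation X l := (@X n (d l) (rho l)).
Local Notation a l := (len (wlong l)).
Local Notation cc l w i j := (@cc n d rho Hint l w i j).
Local Notation o l := (i0 Hirr l).
Local Notation PP l := (Pb (prow l) (- vK^-1)).
Local Notation zeta := (- vK^-1).
Local Notation cover := (cc_cover HC Hrep Hirr Hlab Horth Hint Hnorm).

Let ccexact l i j := cc_ex HC Hrep Hirr Hlab Horth Hint Hnorm (l := l) i j.

Lemma cc_unit l w i j : cc l w i j != 0 -> cc l w i j * cc l w i j = 1.
Proof.
move=> h; have [w0 [h1 h2]] := ccexact i j.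
by have -> : w = w0 by apply/eqP; apply: contraNT h => /h2 ->.
Qed.

Lemma cc_inj l w w' i j : cc l w i j != 0 -> cc l w' i j != 0 -> w = w'.
Proof.
move=> h h'; have [w0 [h1 h2]] := ccexact i j.
have -> : w = w0 by apply/eqP; apply: contraNT h => /h2 ->.
by apply/esym/eqP; apply: contraNT h' => /h2 ->.
Qed.

Lemma cc_same_l l m w i j p k : cc l w i j != 0 -> cc m w p k != 0 -> l = m.
Proof.
move=> h1 h2; have e := cc_uniq_lij HC Hrep Hirr Hlab Horth Hnorm h1 h2.
exact: (congr1 (@tag _ _) e).
Qed.

Lemma cc_same_ij l w i j p k : cc l w i j != 0 -> cc l w p k != 0 -> i = p /\ j = k.
Proof.
move=> h1 h2; have e := cc_uniq_lij HC Hrep Hirr Hlab Horth Hnorm h1 h2.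
by have /eqP := e; rewrite eq_Tagged /= => /eqP [-> ->].
Qed.

Lemma cc_wl_ij l i j : cc l (wlong l) i j != 0 -> i = o l /\ j = o l.
Proof. by move=> h; apply: cc_same_ij h (cc_wl0 Hirr Hint Hnorm l). Qed.

Lemma eh_C l : eh l = ((ua l * PP l)^-1 * (-1) ^+ a l * vK ^+ a l) *: C' (wlong l).
Proof.
rewrite (CC_wl HC) scalerA /eh; congr (_ *: _).
have -> : (- vK) ^+ a l = (-1) ^+ a l * vK ^+ a l by rewrite -[- vK]mulN1r exprMn.
have h1 : (-1) ^+ a l * (-1) ^+ a l = 1 :> K by rewrite -expr2 -exprM mulnC exprM sqrrN !expr1n.
have hu : ua l != 0 by apply: mulf_neq0; apply: expf_neq0; exact: vK_neq0.
transitivity ((-1) ^+ a l * (-1) ^+ a l * ((ua l * PP l)^-1 * ua l)).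
  by rewrite h1 mul1r (invfM (ua l)) mulrAC mulVf // mul1r.
by rewrite /ua; exact: mul_shuffle2.
Qed.

Lemma loc_sgn k : locTerm 0 ((-1) ^+ k) ((-1) ^+ k).
Proof. by apply: locX; apply: locN; exact: loc1. Qed.

Lemma sgn_sq (R : nzRingType) k : (-1) ^+ k * (-1) ^+ k = 1 :> R.
Proof. by rewrite -expr2 -exprM mulnC exprM sqrrN !expr1n. Qed.

Lemma ua_PP_locV l : locTerm 0 (ua l * PP l)^-1 1.
Proof. by have := locV (oner_neq0 _) (ua_Pb_loc l); rewrite invr1. Qed.

Lemma loc_eh l k p : locTerm 0 (X l (eh l) k p) (cc l (wlong l) k p)%:~R.
Proof.
rewrite eh_C linearZ /= mxE -(mulrA ((ua l * PP l)^-1 * (-1) ^+ a l)).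
apply: loc_eq (locM (locM (ua_PP_locV l) (loc_sgn (a l))) (loc_C HC Hint (wlong l) k p)).
by rewrite mul1r mulrA sgn_sq mul1r.
Qed.

Lemma loc_vz l k : (k <= a l)%N ->
  locTerm 0 (vK ^+ a l * zeta ^+ k) (if k == a l then (-1) ^+ k else 0).
Proof.
move=> hk; have -> : vK ^+ a l * zeta ^+ k = (-1) ^+ k * vK ^+ (a l - k).
  by rewrite vK_expB // -[zeta]mulN1r exprMn exprVn mulrCA.
case: eqP => [->|hne].
  by rewrite subnn -[Y in locTerm _ _ Y]mulr1; apply: locM; [exact: loc_sgn | exact: loc1].
apply: loc_eq (locM (loc_sgn k) (locX _ (loc_v 0))).
by rewrite expr0n subn_eq0; case: leqP => h; rewrite ?mulr0 //; lia.
Qed.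

Lemma TxC_loc l x y : binc (prow l) x -> exists c, locTerm 0 ((T x * C' (wlong l)) y) c.
Proof.
move=> hx; have -> : (T x * C' (wlong l)) y = C' (wlong l) (x^-1%g ** y).
  by rewrite (CC_wl HC) -scalerAr !hE_scale (Tx_ebE (@row_mono n l)) // ebE.
exact: inZv_loc (CC_Zv HC _ _).
Qed.

(** Write the element at position [(i, 1)] as [x ** u]. Then [T y * eh l] is [T x * C_{w_l}] times a
    scalar which, after multiplication by [v ^ a], would kill the constant term if [u] were not the
    longest element; but that constant term is a product of nonzero leading coefficients. *)
Lemma x_ex l i : exists x, binc (prow l) x /\ cc l (x ** wlong l) i (o l) != 0.
Proof.
have [y [hy _]] := ccexact i (o l).
have hy0 : cc l y i (o l) != 0 by apply/eqP => e; rewrite e mulr0 in hy.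
have [x [u [ey hx hu]]] := block_dec (prow l) y.
have hw := wlongP l.
suff e : u = wlong l by exists x; split; rewrite // -e -ey.
have hle : (len u <= a l)%N by case: hw => _; apply.
apply: (longest_of_len (@row_mono n l) hw hu); apply/eqP; apply: contraT => hne; exfalso.
have hA : locTerm 0 (vK ^+ a l * X l (T y * eh l) i (o l))
    (\sum_k ((-1) ^+ len y * (cc l y i k)%:~R) * (cc l (wlong l) k (o l))%:~R).
  rewrite XM // XT mxE mulr_sumr; apply: loc_sum => k _.
  by rewrite mulrA; apply: locM; [exact: ccP | exact: loc_eh].
rewrite (bigD1 (o l)) //= big1 ?addr0 in hA; last first.
  move=> k hk; suff -> : cc l (wlong l) k (o l) = 0 by rewrite mulr0.
  by apply/eqP; apply: contraNT hk => /cc_wl_ij [-> _].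
have [r0 hr0] : exists r0, locTerm 0 (vK ^+ a l * X l (T x * C' (wlong l)) i (o l)) r0.
  have /fin_all_exists[k hk] := fun y => TxC_loc y hx.
  by eexists; apply: (loc_X Hint i (o l) hk).
have eT : T y * eh l = ((ua l * PP l)^-1 * (-1) ^+ a l * (vK ^+ a l * zeta ^+ len u)) *:
    (T x * C' (wlong l)).
  have e1 : T y * C' (wlong l) = zeta ^+ len u *: (T x * C' (wlong l)).
    rewrite (CC_wl HC) ey -TT_add ?(len_binc_add (@row_mono n l)) //.
    rewrite -!scalerAr -mulrA (Tu_eb (@row_mono n l) vz0 vzq hu) -scalerAr.
    by rewrite !scalerA mulrC.
  by rewrite eh_C -scalerAr e1 scalerA mulrA.
have hB := locM (locM (ua_PP_locV l) (loc_sgn (a l))) (loc_vz hle).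
have hB' := locM hB hr0; rewrite (negbTE hne) mulr0 mul0r in hB'.
move: hA; rewrite eT linearZ /= mxE mulrCA => /loc_uniq /(_ hB') /eqP.
have hsn : (-1) ^+ len y != 0 :> Real by apply: sgn_neq0.
rewrite mulf_eq0 mulf_eq0 (negbTE hsn) !intr_eq0 (negbTE hy0) /=.
by rewrite (negbTE (cc_wl0 Hirr Hint Hnorm l)).
Qed.

Definition sg w : int := (-1) ^+ len w.
Lemma sgE w : (sg w)%:~R = (-1) ^+ len w :> Real.
Proof. by rewrite /sg rmorphXn /= rmorphN1. Qed.

(** By [loc_Z], the constant term of [v ^ a] times an entry of [Z]: the additional [v ^ a] inside
    [kappa] provides one power for each of the two Kazhdan-Lusztig factors. *)
Definition zval l x y i j : int :=
  sg (wlong l) * \sum_k (sg (x ** wlong l) * cc l (x ** wlong l) i k) *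
                        (sg (y ** wlong l) * cc l (y ** wlong l) j k).

Lemma loc_Z l x y i j : binc (prow l) x -> binc (prow l) y ->
  locTerm 0 (vK ^+ a l * X l (Zel C l x y) i j) (zval x y i j)%:~R.
Proof.
move=> hx hy; rewrite (Zel_kappa HC) // linearZ /= mxE XM // mxE.
have -> : vK ^+ a l * (kappa l * \sum_k X l (C' (x ** wlong l)) i k * X l (star (C' (y ** wlong l))) k j) =
  (Plam l)^-1 * eps (wlong l) * \sum_k (vK ^+ a l * X l (C' (x ** wlong l)) i k) *
     (vK ^+ a l * X l (star (C' (y ** wlong l))) k j).
  rewrite mulrCA /kappa -!mulrA; congr (_ * (_ * _)).
  rewrite mulr_sumr mulr_sumr; apply: eq_bigr => k _.
  by rewrite [RHS]mulrACA -[RHS]mulrA.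
rewrite rmorphM /= rmorph_sum /= -[(sg _)%:~R]mul1r; apply: locM.
  apply: locM; first by rewrite (Plam_PP HC); exact: ua_PP_locV.
  by rewrite sgE; exact: loc_sgn.
apply: loc_sum => k _; rewrite !rmorphM /= !sgE; apply: locM; first exact: loc_C.
by rewrite (starC HC) -(lenV (y ** _)) -(ccV Horth Hint (y ** _)); exact: loc_C.
Qed.

Lemma zval0 l x y p q i j : cc l (x ** wlong l) p (o l) != 0 -> cc l (y ** wlong l) q (o l) != 0 ->
  (i, j) != (p, q) -> zval x y i j = 0.
Proof.
move=> h1 h2 hne; rewrite /zval big1 ?mulr0 // => k _.
case: (eqVneq (cc l (x ** wlong l) i k) 0) => [->|h3]; first by rewrite mulr0 mul0r.
case: (eqVneq (cc l (y ** wlong l) j k) 0) => [->|h4]; first by rewrite !mulr0.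
have [e1 _] := cc_same_ij h1 h3; have [e2 _] := cc_same_ij h2 h4.
by rewrite -e1 -e2 eqxx in hne.
Qed.

Lemma zval_unit l x y p q : cc l (x ** wlong l) p (o l) != 0 -> cc l (y ** wlong l) q (o l) != 0 ->
  zval x y p q * zval x y p q = 1.
Proof.
move=> h1 h2; rewrite /zval (bigD1 (o l)) //= big1 ?addr0 => [|k hk].
  have hs w : sg w * sg w = 1 by exact: sgn_sq.
  rewrite sq_shuffle.
  by rewrite !hs !cc_unit.
case: (eqVneq (cc l (x ** wlong l) p k) 0) => [->|h3]; first by rewrite mulr0 mul0r.
have [_ e1] := cc_same_ij h1 h3.
by rewrite -e1 eqxx in hk.
Qed.

(* Leading coefficients detect the [v]-adic valuation of coordinates in the basis [C]. *)
Lemma vadic (Y : pred W) (vl : forall l, 'I_(d l) -> 'I_(d l) -> Real) k (p : W -> {poly int}) h :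
  h = \sum_(y | Y y) (evZ (p y) vK / vK ^+ k) *: C' y ->
  (forall y, Y y -> forall l i j, cc l y i j != 0 -> locTerm 0 (vK ^+ a l * X l h i j) (vl l i j)) ->
  forall y, Y y -> (forall q, (q < k)%N -> (p y)`_q = 0) /\
    forall l i j, cc l y i j != 0 -> ((p y)`_k)%:~R * ((sg y)%:~R * (cc l y i j)%:~R) = vl l i j.
Proof.
(* With polynomial coefficients, the constant term at a position [(l, i, j)] sees only the one
   [C' y] whose leading coefficient there is nonzero. *)
have base (p' : W -> {poly int}) (h' : H) : h' = \sum_(y | Y y) evZ (p' y) vK *: C' y ->
    forall y, Y y -> forall l i j, cc l y i j != 0 ->
    locTerm 0 (vK ^+ a l * X l h' i j) (((p' y)`_0)%:~R * ((sg y)%:~R * (cc l y i j)%:~R)).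
  move=> -> y hy l i j hc; rewrite linear_sum summxE mulr_sumr.
  have -> : ((p' y)`_0)%:~R * ((sg y)%:~R * (cc l y i j)%:~R) =
      \sum_(y | Y y) ((p' y)`_0)%:~R * ((sg y)%:~R * (cc l y i j)%:~R) :> Real.
    rewrite (bigD1 y) //= big1 ?addr0 // => z /andP[_ hz].
    suff -> : cc l z i j = 0 by rewrite !mulr0.
    by apply/eqP; apply: contraNT hz => h0; apply/eqP; apply: cc_inj h0 hc.
  apply: loc_sum => z _; rewrite linearZ /= mxE mulrCA sgE.
  by apply: locM; [exact: loc_evZ | exact: loc_C].
elim: k p h vl => [|k IH] p h vl eh hv y hy.
  split=> // l i j hc.
  have eh0 : h = \sum_(y | Y y) evZ (p y) vK *: C' y.
    by rewrite eh; apply: eq_bigr => z _; rewrite expr0 divr1.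
  exact: loc_uniq (base _ _ eh0 y hy l i j hc) (hv y hy l i j hc).
have eh1 : vK ^+ k.+1 *: h = \sum_(y | Y y) evZ (p y) vK *: C' y.
  rewrite eh scaler_sumr; apply: eq_bigr => z _.
  by rewrite scalerA mulrC divfK // expf_neq0 // vK_neq0.
(* After multiplication by [v ^ k.+1] the coefficients are polynomials, while the images of [h],
   already bounded, acquire constant term 0; so every [p z] is divisible by [v]. *)
have hp0 z : Y z -> (p z)`_0 = 0.
  move=> hz; have [[l [i j]] /= [hc _]] := cc_cover HC Hrep Hirr Hlab Horth Hint Hnorm z.
  have h1 := base _ _ eh1 z hz l i j hc.
  have h2 := locM (locX k.+1 (loc_v 0)) (hv z hz l i j hc).
  rewrite linearZ /= mxE mulrCA in h1.
  have := loc_uniq h1 h2; rewrite expr0n mul0r => /eqP.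
  rewrite !mulf_eq0 !intr_eq0 (negbTE hc) orbF => /orP[/eqP //|].
  by rewrite -(intr_eq0 Real) sgE (negbTE (sgn_neq0 _)).
pose q z := drop_poly 1 (p z).
have pq z : Y z -> p z = q z * 'X.
  move=> hz; apply/polyP => -[|i]; rewrite coefMX //= ?hp0 //.
  by rewrite coef_drop_poly addn1.
have eq : h = \sum_(z | Y z) (evZ (q z) vK / vK ^+ k) *: C' z.
  rewrite eh; apply: eq_bigr => z hz; congr (_ *: _).
  by rewrite (pq z hz) evZM evZX exprS (invfM vK) -(mulrA (evZ (q z) vK)) mulVKf ?vK_neq0.
have [h1 h2] := IH q h vl eq hv y hy; split=> [[|i] hi|l i j hc].
- exact: hp0.
- by have := h1 i hi; rewrite coef_drop_poly addn1.
- by have := h2 l i j hc; rewrite coef_drop_poly addn1.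
Qed.

Definition cell (G : pred (part n)) y : bool :=
  [exists m, G m && [exists i, exists j, cc m y i j != 0]].

Lemma cellP (G : pred (part n)) y : reflect (exists m i j, G m /\ cc m y i j != 0) (cell G y).
Proof.
apply: (iffP existsP) => [[m /andP[hm /existsP[i /existsP[j h]]]]|[m [i [j [hm h]]]]].
  by exists m, i, j.
by exists m; rewrite hm /=; apply/existsP; exists i; apply/existsP; exists j.
Qed.

Definition triangular l := forall w i j m, cc l w i j != 0 -> X m (C' w) != 0 -> domle l m.

Lemma X_cell0 (G : pred (part n)) y m : (forall m', G m' -> triangular m') ->
  (forall l' m', G l' -> domle l' m' -> G m') -> cell G y -> ~~ G m -> X m (C' y) = 0.
Proof.
move=> hG hup /cellP[m' [i [j [hm' hc]]]] hm; apply/eqP; apply: contraNT hm => h.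
by apply: (hup m') => //; apply: (hG m' hm' y i j m hc).
Qed.

Lemma X_cell_sum0 (G : pred (part n)) (z : W -> K) m : (forall m', G m' -> triangular m') ->
  (forall l' m', G l' -> domle l' m' -> G m') -> ~~ G m ->
  X m (\sum_(y | cell G y) z y *: C' y) = 0.
Proof.
move=> hG hup hm; rewrite linear_sum big1 //= => y hy.
by rewrite linearZ /= (X_cell0 hG hup hy hm) scaler0.
Qed.

Lemma X_addr m (f g h : H) : f = g + h -> X m g = 0 -> X m h = X m f.
Proof. by move=> -> e; rewrite linearD /= e add0r. Qed.

Lemma bar_inv_coef (p : {poly int}) k : (forall q, (q < k)%N -> p`_q = 0) ->
  bar (evZ p vK / vK ^+ k) = evZ p vK / vK ^+ k -> evZ p vK / vK ^+ k = (p`_k)%:~R.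
Proof.
move=> hp; have -> : evZ p vK / vK ^+ k = evZ (drop_poly k p) vK.
  have -> : p = drop_poly k p * 'X^k.
    apply/polyP => i; rewrite coefMXn; case: ltnP => [/hp //|h].
    by rewrite coef_drop_poly subnK.
  by rewrite drop_polyMXn_id evZM evZXn mulfK // expf_neq0 // vK_neq0.
by move/bar_inv_const => ->; rewrite coef_drop_poly.
Qed.

Lemma X_Zel_dom l m x y : X m (Zel C l x y) != 0 -> domle l m.
Proof.
move=> h; apply: (X_e_dom HC Hrep Hirr Hlab Hint Hnorm); apply: contraNN h => /eqP h.
by rewrite /Zel XM // XM // (CC_wl HC) linearZ /= h scaler0 mulmx0 mul0mx.
Qed.

Lemma C_coef_bar h (z : W -> K) : hbar h = h -> h = \sum_y z y *: C' y ->
  forall y, bar (z y) = z y.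
Proof.
move=> hb eh y; apply/eqP; rewrite -subr_eq0; apply/eqP.
apply: (C_indep HC (a := fun y => bar (z y) - z y)).
rewrite -[RHS](subrr h) -{1}hb eh hbar_sum -sumrB; apply: eq_bigr => t _.
by rewrite hbarZ (hbarC HC) scalerBl.
Qed.

Definition up l := cell (sdomlt l).

(** Outside the larger cells, [vadic] shows that the coefficients of [Z] have no negative powers of
    [v]; being bar-invariant, they are integers. The leading matrix of [Z] has a single nonzero
    entry, a unit at the position of [w], so only [C' w] survives. *)
Lemma C_Zel l : (forall m, sdomlt l m -> triangular m) ->
  forall w i j x y, cc l w i j != 0 -> binc (prow l) x -> binc (prow l) y ->
  cc l (x ** wlong l) i (o l) != 0 -> cc l (y ** wlong l) j (o l) != 0 ->
  exists (e : int) (z : W -> K), [/\ e * e = 1, forall y, inA (z y),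
    forall y, ~~ up l y -> z y = 0 &
    Zel C l x y = e%:~R *: C' w + \sum_y z y *: C' y].
Proof.
move=> htri w i j x y hw hx hy hcx hcy.
have [z [hzA eZ]] := inH_C HC (inH_Zel HC l x y).
have hzb := C_coef_bar (hbar_Zel HC hx hy) eZ.
have [k [p hp]] := common_denA hzA.
(* Leading terms of [Z] outside the strict upset of [l]: every [X m] there other than [X l] kills
   [Z]. *)
pose vl m (i' j' : 'I_(d m)) : Real := if m == l then (zval x y i' j')%:~R else 0.
pose Z' : H := \sum_(t | ~~ up l t) (evZ (p t) vK / vK ^+ k) *: C' t.
have eZ' : Zel C l x y = \sum_(t | up l t) z t *: C' t + Z'.
  rewrite {1}eZ (bigID (up l)) /=; congr (_ + _); apply: eq_bigr => t _.
  by rewrite hp.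
have hup l' m' : sdomlt l l' -> domle l' m' -> sdomlt l m'.
  move=> /andP[h1 n1] h2; rewrite /sdomlt (domle_trans h1 h2) /=.
  by apply: contraNneq n1 => e; rewrite -e in h2; rewrite (domle_anti h1 h2).
have hX m : ~~ sdomlt l m -> X m Z' = X m (Zel C l x y).
  by move=> hm; apply: (X_addr eZ'); apply: X_cell_sum0.
have hv t : ~~ up l t -> forall m i' j', cc m t i' j' != 0 ->
    locTerm 0 (vK ^+ a m * X m Z' i' j') (vl m i' j').
  move=> ht m i' j' hc; have hm : ~~ sdomlt l m.
    by apply: contraNN ht => hm; apply/cellP; exists m, i', j'.
  rewrite hX // /vl; case: eqP => [e|hne].
    by case: _ / (esym e) in i' j' hc hm *; apply: loc_Z.
  suff -> : X m (Zel C l x y) = 0 by rewrite mxE mulr0; exact: loc0.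
  apply/eqP; apply: contraNT hm => /X_Zel_dom hd.
  by rewrite /sdomlt hd /=; apply/eqP => e; case: hne.
have hco t (ht : ~~ up l t) := vadic (erefl Z') hv ht.
have hzt t : ~~ up l t -> z t = ((p t)`_k)%:~R.
  move=> ht; have [h1 _] := hco t ht; rewrite hp; apply: bar_inv_coef => //.
  by rewrite -hp.
have hwu : ~~ up l w.
  apply/negP => /cellP[m [i' [j' [hm hc]]]].
  by move: hm; rewrite /sdomlt (cc_same_l hw hc) eqxx andbF.
exists (p w)`_k, (fun t => if up l t then z t else 0); split.
- have [_ h] := hco w hwu; have := h l i j hw; rewrite /vl eqxx -!rmorphM /=.
  move=> /(@intr_inj Real) h1; have h2 := zval_unit hcx hcy.
  rewrite -h1 in h2; rewrite -{}h2.
  transitivity ((p w)`_k * (p w)`_k * (sg w * sg w) * (cc l w i j * cc l w i j)); last by ring.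
  by rewrite sgn_sq (cc_unit hw) !mulr1.
- by move=> t; case: ifP => _; [exact: hzA | exact: inA0].
- by move=> t /negbTE ->.
rewrite eZ' addrC; congr (_ + _); last first.
  by rewrite big_mkcond; apply: eq_bigr => t _; case: ifP; rewrite // scale0r.
rewrite /Z' (bigD1 w) //= -hp hzt // big1 ?addr0 // => t /andP[ht hne].
rewrite -hp hzt //; suff -> : (p t)`_k = 0 by rewrite scale0r.
have [[m [i' j']] /= [hc _]] := cover t.
have [_ h] := hco t ht; have := h m i' j' hc.
suff -> : vl m i' j' = 0.
  move/eqP; rewrite !mulf_eq0 !intr_eq0 (negbTE hc) orbF => /orP[/eqP //|].
  by rewrite -(intr_eq0 Real) sgE (negbTE (sgn_neq0 _)).
rewrite /vl; case: eqP => // e.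
case: _ / (esym e) in i' j' hc *; rewrite (zval0 hcx hcy) //.
apply/eqP => -[e1 e2]; move: hc; rewrite e1 e2 => hc.
by move: hne; rewrite (cc_inj hc hw) eqxx.
Qed.

Lemma sdomlt_up l l' m' : sdomlt l l' -> domle l' m' -> sdomlt l m'.
Proof.
move=> /andP[h1 n1] h2; rewrite /sdomlt (domle_trans h1 h2) /=.
by apply: contraNneq n1 => e; rewrite -e in h2; rewrite (domle_anti h1 h2).
Qed.

Lemma triangular_all l : triangular l.
Proof.
elim/dom_ind: l => l IH w i j m hw hX.
have [x [hx hcx]] := x_ex i.
have [y [hy hcy]] := x_ex j.
have [e [z [e1 _ z0 eZ]]] := C_Zel IH hw hx hy hcx hcy.
apply: contraNT hX => hm; have hm' : ~~ sdomlt l m by apply: contraNN hm => /sdomlt_domle.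
have h0 : X m (\sum_y z y *: C' y) = 0.
  have -> : \sum_y z y *: C' y = \sum_(y | cell (sdomlt l) y) z y *: C' y.
    rewrite [RHS]big_mkcond; apply: eq_bigr => t _; case: ifP => // /negbT /z0 ->.
    by rewrite scale0r.
  by apply: X_cell_sum0 => //; exact: sdomlt_up.
rewrite addrC in eZ; have := X_addr eZ h0.
have -> : X m (Zel C l x y) = 0.
  by apply/eqP; apply: contraNT hm => /X_Zel_dom.
move=> h; have -> : C' w = e%:~R *: (e%:~R *: C' w) by rewrite scalerA -rmorphM /= e1 scale1r.
by rewrite linearZ /= h scaler0.
Qed.

(** * Purity: integral elements supported on an upset of partitions *)

Definition upset (G : pred (part n)) := forall l m, G l -> domle l m -> G m.

(** The part [h'] of [h] lying in the other cells is killed by every [X m] with [m] outside [G], and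
    so is each multiple of it by a negative power of [v]. Applied to all these multiples, [vadic]
    makes every coefficient divisible by arbitrarily high powers of [v]. *)
Lemma purity (G : pred (part n)) h : upset G -> inH h -> (forall m, ~~ G m -> X m h = 0) ->
  Aspn (fun y => cell G y) C' h.
Proof.
move=> hup hh hX; have [z [hzA eh]] := inH_C HC hh.
have [k [p hp]] := common_denA hzA.
pose h' : H := \sum_(y | ~~ cell G y) z y *: C' y.
have eh' : h = \sum_(y | cell G y) z y *: C' y + h' by rewrite {1}eh (bigID (cell G)).
have hX' m : ~~ G m -> X m h' = 0.
  move=> hm; rewrite -(hX m hm); apply: (X_addr eh'); apply: X_cell_sum0 => // m' _.
  exact: triangular_all.
exists z; do 2!split=> //; move=> y /negP hy.
suff -> : z y = 0 by [].
rewrite hp; suff -> : p y = 0 by rewrite evZ0 mul0r.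
apply/polyP => q; rewrite coef0.
have e N : vK ^- N *: h' = \sum_(y | ~~ cell G y) (evZ (p y) vK / vK ^+ (k + N)) *: C' y.
  rewrite /h' scaler_sumr; apply: eq_bigr => t _; rewrite scalerA; congr (_ *: _).
  by rewrite hp exprD (invfM (vK ^+ k)) mulrC mulrA.
have hv t : ~~ cell G t -> forall m i j, cc m t i j != 0 ->
    locTerm 0 (vK ^+ a m * X m (vK ^- q.+1 *: h') i j) 0.
  move=> ht m i j hc; rewrite linearZ /= hX' ?scaler0 ?mxE ?mulr0; first exact: loc0.
  by apply: contraNN ht => hm; apply/cellP; exists m, i, j.
have [h1 _] := vadic (vl := fun m _ _ => 0) (e q.+1) hv hy.
by apply: h1; rewrite ltn_addl.
Qed.

(** In an orthogonal representation, [star h] acts by a conjugate of the transpose of [X m h]. *)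
Lemma X_star0 m h : X m h = 0 -> X m (star h) = 0.
Proof.
move=> h0; have [P [_ [_ [_ hr]]]] := Horth m.
have -> : X m (star h) = invmx P *m (X m h)^T *m P; last first.
  by rewrite h0 trmx0 mulmx0 mul0mx.
rewrite !XE linear_sum /= mulmx_sumr mulmx_suml (reindex_inj invg_inj) /=.
apply: eq_bigr => w _; rewrite starE invgK hr linearZ /=.
by rewrite -scalemxAr -scalemxAl.
Qed.

(* Modulo these elements one works in the quotient by the ideal N-hat of [l]. *)
Definition hat l h := inH h /\ forall m, ~~ sdomlt l m -> X m h = 0.

Lemma hatD l h g : hat l h -> hat l g -> hat l (h + g).
Proof.
move=> [h1 h2] [g1 g2]; split=> [|m hm]; first exact: inHD.
by rewrite linearD /= h2 // g2 // addr0.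
Qed.
Lemma hatMr l h g : hat l h -> inH g -> hat l (h * g).
Proof.
move=> [h1 h2] hg; split=> [|m hm]; first exact: inHM.
by rewrite XM // h2 // mul0mx.
Qed.
Lemma hatMl l h g : hat l h -> inH g -> hat l (g * h).
Proof.
move=> [h1 h2] hg; split=> [|m hm]; first exact: inHM.
by rewrite XM // h2 // mulmx0.
Qed.
Lemma hatZ l c h : inA c -> hat l h -> hat l (c *: h).
Proof.
move=> hc [h1 h2]; split=> [|m hm]; first exact: inHZ.
by rewrite linearZ /= h2 // scaler0.
Qed.
Lemma hat0 l : hat l 0.
Proof. by split=> [|m hm]; [exact: inH0 | rewrite linear0]. Qed.
Lemma hat_star l h : hat l h -> hat l (star h).
Proof.
by move=> [h1 h2]; split=> [|m hm]; [exact: inH_star | apply: X_star0; exact: h2].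
Qed.

(** * Straightening to standard tableaux modulo larger partitions *)

Definition straight l h := exists g r,
  [/\ Aspn (fun x => std l x) T g, hat l r & h = g * C' (wlong l) + r].

Lemma straightD l h h' : straight l h -> straight l h' -> straight l (h + h').
Proof.
move=> [g [r [hg hr ->]]] [g' [r' [hg' hr' ->]]]; exists (g + g'), (r + r').
by split; [exact: AspnD | exact: hatD | rewrite mulrDl addrACA].
Qed.
Lemma straightZ l c h : inA c -> straight l h -> straight l (c *: h).
Proof.
move=> hc [g [r [hg hr ->]]]; exists (c *: g), (c *: r).
by split; [exact: AspnZ | exact: hatZ | rewrite scalerDr scalerAl].
Qed.
Lemma straight_hat l h : hat l h -> straight l h.
Proof. by move=> hh; exists 0, h; split; rewrite ?mul0r ?add0r //; exact: Aspn0. Qed.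
Lemma straight_sum l (I : Type) (s : seq I) (Q : pred I) (f : I -> H) :
  (forall i, Q i -> straight l (f i)) -> straight l (\sum_(i <- s | Q i) f i).
Proof.
move=> h; apply: (big_rec (straight l)); first exact/straight_hat/hat0.
by move=> i f' /h; apply: straightD.
Qed.

Lemma std_col l x : binc (prow l) x -> ~~ std l x -> exists r c (pa pb : 'I_n),
  [/\ (c < lam l r.+1)%N, pa = (partsum l r + c)%N :> nat,
      pb = (partsum l r.+1 + c)%N :> nat & (x pb < x pa)%N].
Proof.
move=> hx; rewrite /std => /forallPn[p /forallPn[q /forallPn[i /forallPn[j]]]].
rewrite negb_and !negb_imply => /orP[/andP[/and3P[h1 /eqP h2 /eqP h3]]|/andP[/and3P[h1 /eqP h2 /eqP h3]]] h4.
  case/negP: h4; move/bincP: hx; apply; first by apply/eqP; rewrite h3 h2 addnS.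
  rewrite (@row_uniq n l p i) ?(@row_uniq n l q i) // ?h2 ?h3 ?partsumS ?leq_addr ?ltn_add2l //.
  exact: ltnW.
exists i, j, p, q; split=> //.
move: h4; rewrite -leqNgt leq_eqVlt => /orP[/eqP/val_inj/perm_inj e|//].
have := h2; rewrite -e h3 partsumS.
have := lam_anti l (leqnSn i); lia.
Qed.

(** For [m = l] the counting lemma [gS_card] shows that [X l] kills [eb bA], hence [R] since [c0] is
    a nonzero scalar. For other [m] the factor [e_ l] of [R] already forces [l] to be dominated by
    [m]. *)
Lemma garnir_hat l r c (pa pb : 'I_n) g k c0 k' R :
  (c < lam l r.+1)%N -> pa = (partsum l r + c)%N :> nat -> pb = (partsum l r.+1 + c)%N :> nat ->
  c0 != 0 -> c0 *: R = g * eb (bA l r pa pb) zeta * k -> R = k' * e_ l -> forall m,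
  ~~ sdomlt l m -> X m R = 0.
Proof.
move=> hc hpa hpb hc0 e1 e2 m hm; case: (eqVneq l m) => [elm|hne]; last first.
  rewrite e2 XM //; apply/eqP; apply: contraNT hm => h.
  rewrite /sdomlt hne andbT; apply: (X_e_dom HC Hrep Hirr Hlab Hint Hnorm).
  by apply: contraNN h => /eqP ->; rewrite mulmx0.
rewrite -{m hm}elm.
have h0 : X l (eb (bA l r pa pb) zeta) = 0.
  apply/eqP/negP => /negP /(X_eb_sandwich HC Hrep Hirr Hlab Hint Hnorm)[w hw].
  have := E_C_card (bA_mono hc hpa hpb) hw (@gS_gB n l r pa pb).
  by rewrite leqNgt (gS_card hc hpa hpb).
apply/eqP; have : c0 *: X l R == 0.
  by rewrite -linearZ /= e1 XM // XM // h0 mulmx0 mul0mx.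
by rewrite scaler_eq0 (negbTE hc0).
Qed.

(** Induction on length with two rewriting steps: a Young factor is absorbed by [C_{w_l}] at the
    cost of a power of [-v^-1], and a descent in a column is replaced through the Garnir relation by
    shorter elements and a remainder in [hat l]. *)
Lemma straight_T l y : straight l (T y * C' (wlong l)).
Proof.
elim: {y}(len y).+1 {-2}y (ltnSn (len y)) => [//|N IH] y hN.
have [x [u [ey hx hu]]] := block_dec (prow l) y.
case: (eqVneq u 1%g) => [eu|hne]; last first.
  have hl := len_binc_add (@row_mono n l) hx hu.
  have hu0 : (0 < len u)%N by rewrite lt0n len_eq0.
  have -> : T y * C' (wlong l) = zeta ^+ len u *: (T x * C' (wlong l)).
    rewrite ey -TT_add // (CC_wl HC) -!scalerAr -mulrA (Tu_eb (@row_mono n l) vz0 vzq hu).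
    by rewrite -scalerAr !scalerA mulrC.
  apply: straightZ; first by apply/inAX/inA_vz.
  by apply: IH; rewrite ey hl in hN; lia.
have {x u ey hx hu eu}hx : binc (prow l) y by rewrite ey eu wmul1.
case: (boolP (std l y)) => [hs|/(std_col hx)[r [c [pa [pb [hc hpa hpb hxy]]]]]].
  by exists (T y), 0; split; [exact: Aspn_mem | exact: hat0 | rewrite addr0].
have [R [s [g [k [k' [c0 [eT hsA hc0 e1 [e2 hk']]]]]]]] := garnir_rel hc hpa hpb hx hxy.
rewrite (CC_wl HC) -scalerAr eT scalerDr; apply: straightD.
  rewrite scaler_sumr; apply: straight_sum => t ht; rewrite scalerA mulrC -scalerA scalerAr.
  by rewrite -(CC_wl HC); apply: straightZ => //; apply: IH; apply: leq_trans ht _.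
apply: straight_hat; split; last first.
  by move=> m hm; rewrite linearZ /= (garnir_hat hc hpa hpb hc0 e1 e2 hm) scaler0.
by rewrite e2 scalerAr -(CC_wl HC); apply: inHM => //; exact: inHC.
Qed.

Lemma straight_inH l h : inH h -> straight l (h * C' (wlong l)).
Proof.
move=> hh; rewrite (heck_sum h) mulr_suml; apply: straight_sum => y _.
by rewrite -scalerAl; apply: straightZ => //; exact: straight_T.
Qed.

(** * Comparison of the Murphy and Kazhdan-Lusztig spans *)

Definition murphy (p : part n * W * W) : H := let '(m, x, y) := p in T x * C' (wlong m) * star (T y).
Definition murphy_idx (G : pred (part n)) (p : part n * W * W) : Prop :=
  let '(m, x, y) := p in G m /\ std m x /\ std m y.

Lemma murphy_cell (G : pred (part n)) h : upset G ->
  Aspn (murphy_idx G) murphy h -> Aspn (fun y => cell G y) C' h.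
Proof.
move=> hup; apply: Aspn_trans => -[[m x] y] /= [hm _].
apply: (purity hup) => [|m' hm'].
  by apply: inHM; [apply: inHM; [exact: inHT | exact: inHC] | apply/inH_star/inHT].
rewrite XM // XM //; suff -> : X m' (C' (wlong m)) = 0 by rewrite mulmx0 mul0mx.
rewrite (CC_wl HC) linearZ /=; apply/eqP; apply: contraNT hm' => h0.
apply: (hup m) => //; apply: (X_e_dom HC Hrep Hirr Hlab Hint Hnorm).
by apply: contraNN h0 => /eqP ->; rewrite scaler0.
Qed.

Lemma murphy_mono (G G' : pred (part n)) h : (forall m, G m -> G' m) ->
  Aspn (murphy_idx G) murphy h -> Aspn (murphy_idx G') murphy h.
Proof.
move=> hG; apply: Aspn_trans => -[[m x] y] /= [hm hs].
by apply: (Aspn_mem (P := murphy_idx G') murphy (i := (m, x, y))); split=> //; apply: hG.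
Qed.

Lemma murphy_prod l (g1 g2 : H) : Aspn (fun x => std l x) T g1 -> Aspn (fun x => std l x) T g2 ->
  Aspn (murphy_idx (domle l)) murphy (g1 * C' (wlong l) * star g2).
Proof.
move=> [b1 [h1 [z1 ->]]] [b2 [h2 [z2 ->]]].
rewrite mulr_suml mulr_suml; apply: Aspn_sum => x _.
rewrite linear_sum mulr_sumr; apply: Aspn_sum => y _.
rewrite linearZ /= -scalerAr -!scalerAl scalerA.
case: (boolP (std l x)) => hx; last by rewrite (z1 x) ?mulr0 ?scale0r; [exact: Aspn0 | exact/negP].
case: (boolP (std l y)) => hy; last by rewrite (z2 y) ?mul0r ?scale0r; [exact: Aspn0 | exact/negP].
apply: AspnZ; first exact: inAM.
by apply: (Aspn_mem (P := murphy_idx (domle l)) murphy (i := (l, x, y))); split=> //; exact: domle_refl.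
Qed.

Definition cellular l := forall w i j, cc l w i j != 0 -> Aspn (murphy_idx (domle l)) murphy (C' w).

Lemma cell_murphy (G : pred (part n)) h : upset G -> (forall m, G m -> cellular m) ->
  Aspn (fun y => cell G y) C' h -> Aspn (murphy_idx G) murphy h.
Proof.
move=> hup hG; apply: Aspn_trans => y /cellP[m [i [j [hm hc]]]].
by apply: murphy_mono (hG m hm y i j hc) => m'; exact: hup.
Qed.

Lemma upset_sdomlt l : upset (sdomlt l). Proof. exact: sdomlt_up. Qed.
Lemma upset_domle l : upset (domle l). Proof. by move=> m k; exact: domle_trans. Qed.

(** Both outer factors are straightened against the single middle [C_{w_l}]. The two remainders stay
    in [hat l], which is stable under integral multiplication and [star]; purity and the induction
    hypothesis convert them into Murphy elements for larger partitions. *)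
Lemma Zel_murphy l x y : (forall m, sdomlt l m -> cellular m) ->
  binc (prow l) x -> binc (prow l) y -> Aspn (murphy_idx (domle l)) murphy (Zel C l x y).
Proof.
move=> IH hx hy.
have st t := straight_inH l (inH_gx HC l t).
have [g1 [r1 [hg1 hr1 e1]]] := st x; have [g2 [r2 [hg2 hr2 e2]]] := st y.
have hin (g : H) : Aspn (fun t => std l t) T g -> inH g.
  by move=> [b [hb [_ ->]]]; apply: inH_sum => t _; apply: inHZ => //; exact: inHT.
(* The left factor is straightened while the right one is untouched; then [C_{w_l}], fixed by
   [star], is moved into the right factor to straighten it as well. *)
have -> : Zel C l x y = g1 * C' (wlong l) * star g2 + (g1 * star r2 + r1 * star (gx C l y)).
  rewrite /Zel e1 mulrDl addrA; congr (_ + _).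
  by rewrite -mulrA -{1}(C_wlV HC) -starM e2 linearD /= mulrDr starM (C_wlV HC) mulrA.
apply: AspnD; first exact: murphy_prod.
apply: (@murphy_mono (sdomlt l)) => [m|]; first exact: sdomlt_domle.
apply: cell_murphy (@upset_sdomlt l) IH _.
have [h1 h2] : hat l (g1 * star r2 + r1 * star (gx C l y)).
  apply: hatD; first by apply: hatMl; [exact: hat_star | exact: hin].
  by apply: hatMr => //; apply: inH_star; exact: inH_gx.
exact: (purity (@upset_sdomlt l)).
Qed.

Lemma cellular_all l : cellular l.
Proof.
elim/dom_ind: l => l IH w i j hw.
have [x [hx hcx]] := x_ex i.
have [y [hy hcy]] := x_ex j.
have htri m : sdomlt l m -> triangular m.
  by move=> _; exact: triangular_all.
have [e [z [e1 zA z0 eZ]]] := C_Zel htri hw hx hy hcx hcy.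
have -> : C' w = e%:~R *: (Zel C l x y - \sum_y z y *: C' y).
  by rewrite eZ addrK scalerA -rmorphM /= e1 scale1r.
apply: AspnZ; first exact: inZv_inA (inZv_int e).
apply: AspnB; first exact: Zel_murphy.
apply: (@murphy_mono (sdomlt l)) => [m|]; first exact: sdomlt_domle.
apply: cell_murphy (@upset_sdomlt l) IH _.
by exists z; do 2!split=> //; move=> t /negP; exact: z0.
Qed.

Lemma murphyE (G : pred (part n)) (h : hecke n) :
  Aspan (fun p : part n * W * W => let '(m, x, y) := p in G m /\ std m x /\ std m y)
        (fun p => let '(m, x, y) := p in ytilde C m x y) h <-> Aspn (murphy_idx G) murphy h.
Proof.
have e m x y : ytilde C m x y = murphy (m, x, y) by rewrite /ytilde !hmulE !TbE -starT.
rewrite Aspan_Aspn; split; apply: Aspn_trans => -[[m x] y] hm.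
  by rewrite e; exact: Aspn_mem.
by rewrite -e; apply: (Aspn_mem _ (i := (m, x, y)) hm).
Qed.

Lemma cellE l (h : hecke n) :
  Aspan (fun p : part n * W => domle l p.1 /\ inRcell rho p.1 p.2) (fun p => C p.2) h <->
  Aspn (fun y => cell (domle l) y) C' h.
Proof.
rewrite Aspan_Aspn; split.
  apply: Aspn_trans => -[m y] /= [hm [i [j /(isWE Hint) hc]]].
  by apply: (Aspn_mem C' (i := y)); apply/cellP; exists m, i, j.
apply: Aspn_trans => y /cellP[m [i [j [hm hc]]]]; apply: (Aspn_mem _ (i := (m, y))); split=> //.
by exists i, j; apply/(isWE Hint).
Qed.

Lemma murphy_cellP (G : pred (part n)) h : upset G ->
  Aspn (murphy_idx G) murphy h <-> Aspn (fun y => cell G y) C' h.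
Proof.
move=> hG; split; first exact: murphy_cell.
by apply: cell_murphy => // m _; exact: cellular_all.
Qed.

Lemma hadd_ffun (f g : hecke n) : f + g = (f : H) + (g : H).
Proof. by apply/ffunP => y; rewrite ffunE hE_add. Qed.
End MainArgument.

Theorem theorem4p10
  (n : nat) (d : part n -> nat) (rho : forall l : part n, 'S_n -> 'M[K]_(d l))
  (C : 'S_n -> hecke n)
  (HC : isKL C)
  (Hrep : forall l, is_rep (rho l))
  (Hirr : forall l, is_irr (rho l))
  (Hlab : labelling rho)
  (Horth : forall l, orthogonal_rep (rho l))
  (Hint : forall l, integral_ltc (rho l) l)
  (Hnorm : forall l, normalized (rho l) l)
  (l : part n) :
  (forall (i j : 'I_(d l)) (w xi xj : 'S_n),
     isW (rho l) l i j w -> inX l xi -> inX l xj ->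
     (forall j0 : 'I_(d l), val j0 = 0%N ->
        isW (rho l) l i j0 (wmul xi (wlong l)) /\
        isW (rho l) l j j0 (wmul xj (wlong l))) ->
     exists eta : K, (eta = 1 \/ eta = -1) /\
       (exists h, inNhat C l h /\ hscale eta (C w) = Zw C l xi xj + h) /\
       (forall h, inNhat C l h -> inN C l (Zw C l xi xj + h)))
  /\
  (forall h : hecke n,
     inN C l h <->
     Aspan (fun p : part n * 'S_n => domle l p.1 /\ inRcell rho p.1 p.2)
           (fun p : part n * 'S_n => C p.2) h).
Proof.
have hup : upset (domle l) by exact: upset_domle.
have hup' : upset (sdomlt l) by exact: sdomlt_up.
have cell_murphyP := @murphy_cellP _ _ _ _ HC Hrep Hirr Hlab Horth Hint Hnorm.
split=> [i j w x y /(isWE Hint) hw|h]; last first.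
  split=> [/murphyE/(cell_murphyP _ _ hup)/(cellE C Hint) //|].
  by move/(cellE C Hint)/(cell_murphyP _ _ hup)/murphyE.
rewrite !inXE => hx hy h0.
(* The first row and column of a matrix have index 0 here, which is the ordinal [i0]. *)
have [/(isWE Hint) hcx /(isWE Hint) hcy] := h0 (i0 Hirr l) erefl.
have htri m : sdomlt l m -> triangular C Hint m.
  by move=> _; exact: (triangular_all HC Hrep Hirr Hlab Horth Hnorm).
have [e [z [e1 zA z0 eZ]]] := C_Zel HC Hrep Hlab Horth Hnorm htri hw hx hy hcx hcy.
(* The sign is the integer coefficient of [C w] in [Z]; its square is 1. *)
exists e%:~R; split; last split.
- have : (e - 1) * (e + 1) = 0 by rewrite -subr_sqr_1 expr2 e1 subrr.
  by move/eqP; rewrite mulf_eq0 subr_eq0 addr_eq0 => /orP[] /eqP ->; [left | right].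
- exists (- \sum_u z u *: CC C u); split; last first.
    by rewrite hadd_ffun (Zw_Zel HC) // eZ addrK hscaleE.
  apply/murphyE/(cell_murphyP _ _ hup')/AspnN.
  by exists z; do 2!split=> //; move=> t /negP; exact: z0.
move=> h /murphyE hh; apply/murphyE; rewrite hadd_ffun (Zw_Zel HC) //; apply: AspnD.
  apply: (Zel_murphy HC Hrep Hirr Hlab Horth Hnorm) => // m _.
  exact: (cellular_all HC Hrep Hirr Hlab Horth Hnorm).
by apply: murphy_mono hh => m; exact: sdomlt_domle.
Qed.
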